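(* Let $\phi \colon \Gamma' \rightarrow \Gamma$ be an infinite Galois covering of a compact metric graph $\Gamma$. Let $\{\phi_n \colon \Gamma_n \rightarrow \Gamma : n \geq 1\}$ be an ascending sequence (tower) of finite Galois covers converging to $\Gamma'$, in the sense that the equality $$\bigcap_{n \geq 1} \pi_1(\Gamma_n) = \pi_1(\Gamma')$$ of subgroups of $\pi_1(\Gamma)$ holds. Then $\lim_{n\rightarrow\infty}\mu_{\phi_n, \mathrm{can}}=\mu_{\phi, \mathrm{can}}$, with strong convergence of measures on $\Gamma$.
   Context: Metric graphs. A metric graph is a connected metric space $\Gamma$ such that, for some fixed $\epsilon>0$, every point has a neighborhood isometric to a star-shaped set $S(n,r)=\{te^{2\pi i k/n} : 0\le t<r,\ k\in\mathbb{Z}\}\subset\mathbb{C}$ of finite valence $n$ and radius $r\geq\epsilon$, endowed with the path metric. $\Gamma$ need not be compact. A vertex set is a discrete subset $V\subset\Gamma$ containing all points of valence $\neq 2$ such that every connected component of $\Gamma\setminus V$ is isometric (in its path metric) to a bounded open interval. It determines a model $G$: the weighted graph with vertex set $V(G)=V$, edge set $E(G)$ the set of components of $\Gamma\setminus V$, and $\ell(e)>0$ the length of the edge $e$ (loops and multiple edges are allowed). $\mathbb{E}(G)$ is the set of oriented edges; each edge has two orientations $e,\bar e\in\mathbb{E}(G)$; $e^-$ and $e^+$ are the initial and terminal vertices of $e$. An orientation $\mathcal{O}\subset\mathbb{E}(G)$ selects one orientation of each edge. Forms. $C^1(G,\mathbb{R})$ is the space of functions $\omega:\mathbb{E}(G)\to\mathbb{R}$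 with $\omega(\bar e)=-\omega(e)$; put $\omega_e=\omega(e)/\ell(e)$, and let $de\in C^1(G,\mathbb{R})$ be defined by $(de)(e)=\ell(e)$ and $(de)(e')=0$ for $e'\in\mathcal{O}$, $e'\ne e$. The (partially defined) pairing is $\langle\omega,\omega'\rangle=\sum_{e\in\mathcal{O}}\omega_e\omega'_e\ell(e)$, and $C^1_{L^2}(G,\mathbb{R})=\{\omega : \langle\omega,\omega\rangle<\infty\}$ is a Hilbert space. A form is harmonic if for every $v\in V(G)$, $\sum_{e\in\mathcal{O},\,e^+=v}\omega_e-\sum_{e\in\mathcal{O},\,e^-=v}\omega_e=0$. The harmonic $L^2$ forms form a closed subspace $\mathcal{H}_{L^2}(\Gamma)$ of $C^1_{L^2}(G,\mathbb{R})$; when models are refined (edges subdivided, keeping the values $\omega_e$ on the pieces) this space does not change. Canonical measure. The canonical measure $\mu_{\mathrm{can}}=\mu^{\Gamma}_{\mathrm{can}}$ is the Borel measure on $\Gamma$ which on each edge of a model $G$ is a constant multiple of Lebesgue measure $dx$, with $\mu_{\mathrm{can}}(e)=(\pi(de))_e=\frac{1}{\ell(e)}\langle\pi(de),de\rangle$, where $\pi$ is the orthogonal projection onto $\mathcal{H}_{L^2}(\Gamma)$. It is independent of the model and orientation and invariant under isometries. Covers. A covering map of metric spaces is a continuous map $Y\to X$ such that every point of $X$ has an open neighborhood $U$ whose preimage is a disjoint union of open sets each sent isometrically onto $U$; its degree is the number of these copies. For path-connected spaces the cover is Galois if the image of $\pi_1(Y)$ in $\pi_1(X)$ is a normal subgroup;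 fundamental groups of covers are identified with their images. ''Ascending'' means $\Gamma_{n+1}\to\Gamma$ factors through $\Gamma_n\to\Gamma$. For a Galois cover $\phi:\Gamma'\to\Gamma$, $\mu_{\phi,\mathrm{can}}$ denotes the pushdown of $\mu^{\Gamma'}_{\mathrm{can}}$: the measure on $\Gamma$ whose density on each edge $e$ of a model $G$ of $\Gamma$ is constant and with $\mu_{\phi,\mathrm{can}}(e)=\mu^{\Gamma'}_{\mathrm{can}}(e')$ for any lift $e'$ of $e$ to $\Gamma'$. Convergence. All the measures $\mu_{\phi_n,\mathrm{can}}$, $\mu_{\phi,\mathrm{can}}$ lie in the finite-dimensional space of measures having constant density on each edge of a fixed finite model $G$ of $\Gamma$; on this space strong and weak convergence coincide with convergence of the values on every $e\in E(G)$. *)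

(* Defs.v *)
From HB Require Import structures.
From mathcomp Require Import all_boot all_order all_algebra.
From mathcomp Require Import all_classical all_reals all_analysis.

Set Implicit Arguments.
Unset Strict Implicit.
Unset Printing Implicit Defensive.
Import Order.TTheory GRing.Theory Num.Theory.
Import numFieldTopology.Exports numFieldNormedType.Exports.
Local Open Scope classical_set_scope.
Local Open Scope ring_scope.

Section Paths.
Context {R : realType} {X : metricType R}.

Definition is_path (A : set X) (x y : X) (g : R -> X) : Prop :=
  [/\ {within `[0, 1], continuous g}, g 0 = x, g 1 = y
    & g @` `[0, 1] `<=` A].

(* Same indexing convention as [variation] for real functions. *)
Definition path_length (g : R -> X) : \bar R :=
  ereal_sup [set (\sum_(0 <= i < size s)
      mdist (g (nth 1 (0 :: s) i)) (g (nth 1 (0 :: s) i.+1)))%:E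
    | s in itv_partition 0 1].

(* The path metric of the subset A; it is +oo when no path joins x to y. *)
Definition path_dist (A : set X) (x y : X) : \bar R :=
  ereal_inf [set path_length g | g in is_path A x y].

End Paths.

Section FundamentalGroup.
Context {R : realType} {X : metricType R}.

Definition loops (x : X) : set (R -> X) := is_path setT x x.

Definition loop_mul (g h : R -> X) : R -> X :=
  fun t => if t <= 2^-1 then g (2 * t) else h (2 * t - 1).

Definition loop_inv (g : R -> X) : R -> X := fun t => g (1 - t).

Definition homotopic (g h : R -> X) : Prop := exists H : R * R -> X,
  [/\ {within `[0, 1] `*` `[0, 1], continuous H},
      (forall t, t \in `[0, 1] -> H (0, t) = g t /\ H (1, t) = h t) &
      (forall s, s \in `[0, 1] -> H (s, 0) = g 0 /\ H (s, 1) = g 1)].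

(* An element of the fundamental group is a homotopy class of loops.
   A loop is a function on the whole line of which only the restriction to
   [0, 1] is relevant: loops agreeing there have the same class. *)
Definition pi1_class (x : X) (g : R -> X) : set (R -> X) :=
  [set h | loops x h /\ homotopic g h].

Definition pi1_normal (x : X) (N : set (set (R -> X))) : Prop :=
  forall g h, loops x g -> loops x h ->
    N (pi1_class x g) ->
    N (pi1_class x (loop_mul (loop_mul h g) (loop_inv h))).

End FundamentalGroup.

Section Covers.
Context {R : realType} {Y X : metricType R}.

Definition pi1_image (f : Y -> X) (y : Y) : set (set (R -> X)) :=
  [set pi1_class (f y) (f \o g) | g in loops y].

(* W is the set of copies of U of which the preimage of U is the disjoint
   union. *)
Definition sheets (f : Y -> X) (U : set X) (W : set (set Y)) : Prop :=
  [/\ trivIset W id, \bigcup_(w in W) w = f @^-1` U &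
      forall w, W w -> [/\ open w, f @` w = U &
        forall a b, w a -> w b -> mdist (f a) (f b) = mdist a b]].

Definition covering (f : Y -> X) : Prop :=
  continuous f /\
  forall x, exists U W, [/\ open U, U x & sheets f U W].

Definition finite_degree (f : Y -> X) : Prop :=
  forall U W, open U -> U !=set0 -> sheets f U W -> finite_set W.

Definition infinite_degree (f : Y -> X) : Prop :=
  forall U W, open U -> U !=set0 -> sheets f U W -> infinite_set W.

Definition galois_cover (f : Y -> X) : Prop :=
  covering f /\ forall y, pi1_normal (f y) (pi1_image f y).

End Covers.

Section MetricGraphs.
Context {R : realType}.

(* The point t e^(2 i pi k / n) of the star S(n, r) is encoded by the pair
   (k, t); this is the length of the shortest path joining two points: along
   their common ray, or through the centre. *)
Definition star_dist n (p q : 'I_n * R) : R :=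
  if p.1 == q.1 then `|p.2 - q.2| else p.2 + q.2.

(* c is an isometry from S(n, r) onto U.  Since (i, 0) and (j, 0) are at
   distance 0, all the c i 0 coincide: this is the image of the centre. *)
Definition star_chart (X : metricType R) n (r : R) (U : set X)
    (c : 'I_n -> R -> X) : Prop :=
  (forall i j s t, 0 <= s < r -> 0 <= t < r ->
     mdist (c i s) (c j t) = star_dist (i, s) (j, t)) /\
  U = [set c p.1 p.2 | p in [set p : 'I_n * R | 0 <= p.2 < r]].

Definition metric_graph (X : metricType R) : Prop :=
  connected [set: X] /\
  exists2 eps : R, 0 < eps & forall p : X,
    exists n r U (c : 'I_n -> R -> X),
      [/\ (0 < n)%N, eps <= r, nbhs p U & star_chart r U c].

Definition has_valence (X : metricType R) (p : X) (n : nat) : Prop :=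
  (0 < n)%N /\ exists r U (c : 'I_n -> R -> X),
    [/\ 0 < r, nbhs p U, star_chart r U c & forall i, c i 0 = p].

End MetricGraphs.

Section Models.
Context {R : realType} {X : metricType R}.
Implicit Types (V e : set X).

Definition edges V : set (set X) :=
  [set connected_component (~` V) x | x in ~` V].

(* g is an isometry from the interval ]0, l[ onto e with its path metric. *)
Definition itv_param e (l : R) (g : R -> X) : Prop :=
  g @` `]0, l[ = e /\
  forall s t, s \in `]0, l[ -> t \in `]0, l[ ->
    path_dist e (g s) (g t) = `|s - t|%:E.

Definition vertex_set V : Prop :=
  [/\ (forall v, V v -> exists2 U, nbhs v U & U `&` V = [set v]),
      (forall p, ~ has_valence p 2 -> V p) &
      (forall e, edges V e -> exists l g, 0 < l /\ itv_param e l g)].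

End Models.

(* An oriented edge is represented by its length l and its unit speed
   parametrization by ]0, l[, extended to a continuous function on the line
   which is constant on ]-oo, 0] and on [l, +oo[.  Each edge thus has exactly
   two orientations. *)
Record oarc (R : realType) (X : metricType R) :=
  Oarc { len : R; arc : R -> X }.
HB.instance Definition _ (R : realType) (X : metricType R) :=
  gen_eqMixin (oarc X).
HB.instance Definition _ (R : realType) (X : metricType R) :=
  gen_choiceMixin (oarc X).

Section Forms.
Context {R : realType} {X : metricType R}.
Implicit Types (V : set X) (a b : oarc X) (w h k : oarc X -> R).

Definition source a : X := arc a 0.
Definition target a : X := arc a (len a).
Definition support a : set X := arc a @` `]0, len a[.
Definition rev a : oarc X := Oarc (len a) (fun t => arc a (len a - t)).

Definition oriented_edges V : set (oarc X) :=
  [set a | [/\ edges V (support a), 0 < len a,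
    itv_param (support a) (len a) (arc a),
    continuous (arc a) &
    (forall t, t <= 0 -> arc a t = source a) /\
    (forall t, len a <= t -> arc a t = target a)]].

Definition is_orientation V (O : set (oarc X)) : Prop :=
  O `<=` oriented_edges V /\
  forall a, oriented_edges V a -> (O (rev a) <-> ~ O a).

(* Nothing below depends on which orientation is chosen. *)
Definition orientation V : set (oarc X) := xget set0 (is_orientation V).

Definition C1 V w : Prop :=
  forall a, oriented_edges V a -> w (rev a) = - w a.

Definition coef w a : R := w a / len a.

Definition dform a : oarc X -> R :=
  fun b => if b == a then len a else if b == rev a then - len a else 0.

Definition L2 V w : Prop :=
  C1 V w /\ (\esum_(a in orientation V) (coef w a ^+ 2 * len a)%:E < +oo)%E.

(* Sum of an absolutely summable family of reals. *)
Definition abs_sum (T : choiceType) (D : set T) (f : T -> R) : R :=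
  fine (\esum_(i in D) (Num.max (f i) 0)%:E) -
  fine (\esum_(i in D) (Num.max (- f i) 0)%:E).

Definition pairing V w h : R :=
  abs_sum (orientation V) (fun a => coef w a * coef h a * len a).

(* A vertex is incident to finitely many edges, so that these sums are
   finite. *)
Definition harmonic V w : Prop := forall v, V v ->
  \sum_(a \in [set a | orientation V a /\ target a = v]) coef w a -
  \sum_(a \in [set a | orientation V a /\ source a = v]) coef w a = 0.

Definition harmonic_L2 V : set (oarc X -> R) :=
  [set w | L2 V w /\ harmonic V w].

(* Orthogonal projection onto the space of harmonic L2 forms; it is unique as
   a function on the oriented edges of the model. *)
Definition harmonic_proj V w : oarc X -> R :=
  xget (fun=> 0) [set h | harmonic_L2 V h /\
    forall k, harmonic_L2 V k -> pairing V (fun a => w a - h a) k = 0].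

End Forms.

Section Measures.
Context {R : realType}.

(* The Borel measure having constant density on each edge (with respect to
   the length) and giving the mass m a to the edge a.  Vertices have mass 0. *)
Definition edge_measure (X : metricType R) (V : set X) (m : oarc X -> \bar R)
    (A : set X) : \bar R :=
  (\esum_(a in orientation V) (m a * ((len a)^-1)%:E *
     lebesgue_measure (`]0%R, len a[ `&` arc a @^-1` A)))%E.

(* The canonical measure, computed in the model with vertex set V. *)
Definition mu_can (X : metricType R) (V : set X) : set X -> \bar R :=
  edge_measure V (fun a => (coef (harmonic_proj V (dform a)) a)%:E).

Definition lift_edge (Y X : metricType R) (f : Y -> X) (V : set X)
    (e : set X) : set Y :=
  xget set0 [set e' | edges (f @^-1` V) e' /\ f @` e' = e].

(* The pushdown of the canonical measure of Y by a Galois cover f.  The lift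
   of an edge is arbitrary: two lifts differ by an automorphism of the cover,
   which is an isometry. *)
Definition mu_pushdown (Y X : metricType R) (f : Y -> X) (V : set X) :
    set X -> \bar R :=
  edge_measure V
    (fun a => mu_can (f @^-1` V) (lift_edge f V (support a))).

(* The total variation distance, up to a factor 2. *)
Definition variation_dist (X : metricType R) (mu nu : set X -> \bar R) :
    \bar R :=
  ereal_sup [set `|mu A - nu A|%E | A in <<s (@open X) >>].

End Measures.

(* Main.v *)
(* Let d be the coboundary of a model and d* its adjoint. For c large, the
   powers of Q = 1 - d d*/c converge strongly to the projection onto the
   harmonic L2 forms, so the mass of an edge e is the limit of the decreasing
   sequence of the amplitudes (Q^(2k) 1_e)_e. On a Galois cover of a finite
   graph, amplitudes depend only on which pairs of walks in the base, of length
   at most 2k, have lifts with the same end. Their excess over the limit is at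
   most twice the sum, over the vertices of the base, of the return
   probabilities T^(2k)(v, v) of the random walk T = 1 - d* d/c. On the
   infinite cover these tend to 0: fix k for which they are small. Since the
   fundamental groups of the tower decrease to that of the infinite cover, for
   n large the n-th cover has the same pairs of walks of length at most 2k, so
   that both masses of e lie in the same short interval. *)

From Pilot Require Import Defs.
From mathcomp Require Import all_boot all_order all_algebra.
From mathcomp Require Import all_classical all_reals all_analysis.
From mathcomp Require Import finmap ring lra.

Set Implicit Arguments.
Unset Strict Implicit.
Unset Printing Implicit Defensive.
Import Order.TTheory GRing.Theory Num.Theory.
Import numFieldTopology.Exports numFieldNormedType.Exports.
Local Open Scope classical_set_scope.
Local Open Scope ring_scope.

(* These names are otherwise taken by path, seq, ssralg and sequences. *)
Local Notation arc := Pilot.Defs.arc.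
Local Notation rev := Pilot.Defs.rev.
Local Notation support := Pilot.Defs.support.
Local Notation harmonic := Pilot.Defs.harmonic.

(** The covers carry different spaces of forms, so their projections can only be compared through
    data on the base. Powers of Q serve this purpose because they have finite range, while the
    projection sees the whole cover. The one-step decrease of an amplitude is a combination of four
    entries of T^j. Summed over the oriented edges of the base, these decreases are twice those of
    the return probabilities: d d* Q^j and d* d T^j have the same trace over a fundamental domain.
    Along even powers every amplitude decreases, so the sum over all edges dominates the term of a
    single one. The decay of T^(2k)(v, v) comes from the same energy estimate. The norm lost between
    successive powers controls d* Q^(2k) 1_e, so the kernels of neighbouring vertices become nearly
    equal; a kernel of total mass at most 1 that is nearly constant on many vertices is small. The
    constant c is fixed on the base and serves every cover. The Galois condition makes the
    coincidence of ends independent of the starting point in the fibre. *)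

Lemma ler_sum_subset (R : realType) (T : eqType) (s t : seq T) (F : T -> R) :
  uniq s -> uniq t -> {subset s <= t} -> (forall i, i \in t -> 0 <= F i) ->
  \sum_(i <- s) F i <= \sum_(i <- t) F i.
Proof.
move=> us ut st F0; rewrite [leRHS](bigID (mem s)) /=.
have -> : \sum_(i <- s) F i = \sum_(i <- t | i \in s) F i.
  rewrite -[RHS]big_filter; apply: perm_big; apply: uniq_perm => //.
    exact: filter_uniq.
  by move=> i; rewrite mem_filter; case: (boolP (i \in s)) => // /st ->.
rewrite lerDl big_seq_cond sumr_ge0// => i /andP[it _]; exact: F0.
Qed.

Lemma near_all_seq (I : eqType) (X : Type) (F : set_system X) (s : seq I)
    (P : I -> X -> Prop) : Filter F ->
  (forall i, i \in s -> \forall x \near F, P i x) ->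
  \forall x \near F, forall i, i \in s -> P i x.
Proof.
move=> FF; elim: s => [|i s IH] h; first exact: nearW.
have hi := h i (mem_head _ _).
have hs : \forall x \near F, forall j, j \in s -> P j x.
  by apply: IH => j js; apply: h; rewrite inE js orbT.
near=> x => j; rewrite inE => /orP[/eqP->|]; first by near: x.
by move: j; near: x.
Unshelve. all: by end_near. Qed.

(** * Harmonic projection on a weighted graph *)

(* The constant [gc] bounds the norms of [d d*] and [d* d], so that the
   operators [qop] and [top] below are contractions. *)
Record lfgraph (R : realType) (T U : choiceType) := LFGraph {
  gD : set T; grv : T -> T; gsrc : T -> U; glen : T -> R;
  gout : U -> seq T; gc : R;
  gDrv : forall a, gD a -> gD (grv a);
  grvK : forall a, gD a -> grv (grv a) = a;
  grv_neq : forall a, gD a -> grv a != a;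
  glen_gt0 : forall a, gD a -> 0 < glen a;
  glen_rv : forall a, gD a -> glen (grv a) = glen a;
  goutP : forall v a, a \in gout v <-> gD a /\ gsrc a = v;
  gout_uniq : forall v, uniq (gout v);
  gc_gt0 : 0 < gc;
  goutc : forall v, \sum_(a <- gout v) (glen a)^-1 <= gc / 2 }.

Section LocallyFiniteGraph.
Context {R : realType} {T U : choiceType} (g : lfgraph R T U).
Local Notation D := (gD g).
Local Notation rv := (grv g).
Local Notation src := (gsrc g).
Local Notation len := (glen g).
Local Notation out := (gout g).
Local Notation c := (gc g).
Let Drv := @gDrv _ _ _ g.
Let rvK := @grvK _ _ _ g.
Let rv_neq := @grv_neq _ _ _ g.
Let len_gt0 := @glen_gt0 _ _ _ g.
Let len_rv := @glen_rv _ _ _ g.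
Let outP := @goutP _ _ _ g.
Let out_uniq := @gout_uniq _ _ _ g.
Let c_gt0 : 0 < c := gc_gt0 g.
Let outc := @goutc _ _ _ g.
Implicit Types (y z : T -> R) (u : U -> R) (B : seq U) (s : seq T).

Definition star_edges B : seq T := flatten [seq out v | v <- B].

Lemma star_edgesP B a : a \in star_edges B <-> D a /\ src a \in B.
Proof.
split=> [/flatten_mapP[v vB /outP[Da sa]]|[Da sB]]; first by rewrite sa.
by apply/flatten_mapP; exists (src a) => //; apply/outP.
Qed.

Lemma star_edges_uniq B : uniq B -> uniq (star_edges B).
Proof.
elim: B => [//|v B IH] /= /andP[vB uB]; rewrite /star_edges /= cat_uniq.
rewrite out_uniq (IH uB) andbT /=; apply/hasPn => a /star_edgesP[Da aB].
by apply/negP => /outP[_ e]; move: vB; rewrite -e aB.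
Qed.

Lemma big_star_edges B (F : T -> R) :
  \sum_(a <- star_edges B) F a = \sum_(v <- B) \sum_(a <- out v) F a.
Proof. by rewrite /star_edges big_flatten big_map. Qed.

Definition supported B y := forall a, D a -> src a \notin B -> y a = 0.
Definition antisym y := forall a, D a -> y (rv a) = - y a.
Definition finform y := antisym y /\ exists2 B, uniq B & supported B y.

Lemma fsum_star B (F : T -> R) : uniq B -> supported B F ->
  \sum_(a \in D) F a = \sum_(a <- star_edges B) F a.
Proof.
move=> uB sF; rewrite (fsbigE (star_edges B)) ?star_edges_uniq//.
- rewrite [RHS]big_seq_cond [LHS]big_mkcond [RHS]big_mkcond /=.
  apply: eq_bigr => a _; rewrite andbT; case: ifPn => [/set_mem Da|nDa].
    by case: ifPn => // /negP; rewrite star_edgesP => h; apply: sF => //;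
      apply/negP => sB; apply: h.
  by case: ifP => // /star_edgesP[Da _]; rewrite mem_set in nDa.
- by move=> a /star_edgesP[].
move=> a Da h; apply: sF => //; apply: contra h => sB; exact/star_edgesP.
Qed.

Lemma supported_sub B B' y : {subset B <= B'} -> supported B y -> supported B' y.
Proof. by move=> BB' sy a Da aB'; apply: sy => //; apply: contra aB' => /BB'. Qed.

Definition tgt a := src (rv a).

(** A form is handled through its coefficients [w a / len a]. In these coordinates [bdry] is [- d*],
    so that [qop] is [1 - d d*/c] on forms and [top] is [1 - d* d/c] on functions. The latter is a
    lazy random walk, crossing the edge [a] with probability [1/(c len a)]. *)
Definition bdry y : U -> R := fun v => \sum_(a <- out v) y a.
Definition qop y : T -> R :=
  fun a => y a - (bdry y (src a) - bdry y (tgt a)) / (c * len a).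
Definition top u : U -> R :=
  fun v => u v - \sum_(a <- out v) (u v - u (tgt a)) / (c * len a).

Lemma bdry_qop y : bdry (qop y) = top (bdry y).
Proof.
apply/funext => v; rewrite /top {1}/bdry /qop big_split /= sumrN; congr (_ - _).
by apply: eq_big_seq => a /outP[_ ->].
Qed.

Lemma bdry_supp B y v : supported B y -> v \notin B -> bdry y v = 0.
Proof.
move=> sy vB; rewrite /bdry big1_seq// => a /andP[_ /outP[Da av]].
by apply: sy => //; rewrite av.
Qed.

Definition hood B : seq U := undup (B ++ [seq tgt a | a <- star_edges B]).

Lemma hood_uniq B : uniq (hood B). Proof. exact: undup_uniq. Qed.

Lemma sub_hood B : {subset B <= hood B}.
Proof. by move=> v vB; rewrite mem_undup mem_cat vB. Qed.

Lemma src_hood B a : D a -> tgt a \in B -> src a \in hood B.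
Proof.
move=> Da tB; rewrite mem_undup mem_cat; apply/orP; right.
apply/mapP; exists (rv a); last by rewrite /tgt rvK.
by apply/star_edgesP; split=> //; exact: Drv.
Qed.

Lemma supported_qop B y : supported B y -> supported (hood B) (qop y).
Proof.
move=> sy a Da aB; have sB : src a \notin B by apply: contra aB => /sub_hood.
have tB : tgt a \notin B by apply: contra aB => /(src_hood Da).
by rewrite /qop sy// (bdry_supp sy sB) (bdry_supp sy tB) subrr mul0r subrr.
Qed.

Lemma antisym_qop y : antisym y -> antisym (qop y).
Proof.
by move=> ay a Da; rewrite /qop /tgt rvK// ay// len_rv//; ring.
Qed.

Lemma finform_qop y : finform y -> finform (qop y).
Proof.
move=> [ay [B uB sy]]; split; first exact: antisym_qop.
by exists (hood B); [exact: hood_uniq|exact: supported_qop].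
Qed.

Lemma fsum_rv (F : T -> R) : \sum_(a \in D) F (rv a) = \sum_(a \in D) F a.
Proof.
symmetry; apply: (reindex_fsbig rv); split=> [//|a b /set_mem Da /set_mem Db e|a Da].
  by rewrite -(rvK Da) -(rvK Db) e.
by exists (rv a); [exact: Drv|rewrite rvK].
Qed.

(** Both orientations of an edge are counted, so on antisymmetric functions this is twice the [L2]
    pairing; most factors 2 below come from here. *)
Definition dot y z : R := \sum_(a \in D) len a * (y a * z a).
Definition vdot u u' : R := \sum_(v \in [set: U]) u v * u' v.

Lemma dotC y z : dot y z = dot z y.
Proof. by apply: eq_fsbigr => a _; rewrite (mulrC (y a)). Qed.

Lemma vdotC u u' : vdot u u' = vdot u' u.
Proof. by apply: eq_fsbigr => a _; rewrite mulrC. Qed.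

Lemma dotE B y z : uniq B -> supported B y ->
  dot y z = \sum_(a <- star_edges B) len a * (y a * z a).
Proof. by move=> uB sy; apply: fsum_star => // a Da /sy -> //; rewrite mul0r mulr0. Qed.

Lemma vdotE B u u' : uniq B -> (forall v, v \notin B -> u v = 0) ->
  vdot u u' = \sum_(v <- B) u v * u' v.
Proof.
move=> uB uv; rewrite /vdot (fsbigE B)//.
- by apply: eq_bigl => v; rewrite mem_set.
by move=> v _ vB; rewrite uv// mul0r.
Qed.

Lemma dot_ge0 y : 0 <= dot y y.
Proof.
apply: fsumr_ge0 => a Da; apply: mulr_ge0; first exact/ltW/len_gt0.
by rewrite -expr2 sqr_ge0.
Qed.

Lemma dot_ge s y : finform y -> uniq s -> {in s, forall a, D a} ->
  \sum_(a <- s) len a * y a ^+ 2 <= dot y y.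
Proof.
move=> [_ [B uB sy]] us sD.
pose B' := undup (B ++ map src s).
have sy' : supported B' y.
  by apply: supported_sub sy => v vB; rewrite mem_undup mem_cat vB.
rewrite (dotE _ (undup_uniq _) sy') -/B'.
have -> : \sum_(a <- s) len a * y a ^+ 2 = \sum_(a <- s) len a * (y a * y a).
  by apply: eq_bigr => a _; rewrite expr2.
apply: ler_sum_subset => //; first by rewrite star_edges_uniq// undup_uniq.
- by move=> a as_; apply/star_edgesP; split; [exact: sD|rewrite mem_undup mem_cat map_f ?orbT].
- by move=> a /star_edgesP[Da _]; rewrite mulr_ge0 -?expr2 ?sqr_ge0// ltW// len_gt0.
Qed.

Lemma dot_bdry B y z : uniq B -> supported B y ->
  \sum_(a <- star_edges B) bdry y (src a) * z a = vdot (bdry y) (bdry z).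
Proof.
move=> uB sy; rewrite big_star_edges (vdotE _ uB); last by move=> v; exact: bdry_supp.
apply: eq_bigr => v _; rewrite mulr_sumr; apply: eq_big_seq => a /outP[_ ->].
by [].
Qed.

Lemma fsum_bdry_src B y z : uniq B -> supported B y ->
  \sum_(a \in D) bdry y (src a) * z a = vdot (bdry y) (bdry z).
Proof.
move=> uB sy; rewrite (fsum_star uB) ?dot_bdry// => a Da aB.
by rewrite (bdry_supp sy aB) mul0r.
Qed.

Lemma fsum_bdry_tgt B y z : uniq B -> supported B y -> antisym z ->
  \sum_(a \in D) bdry y (tgt a) * z a = - vdot (bdry y) (bdry z).
Proof.
move=> uB sy az; rewrite -fsum_rv -(fsum_bdry_src z uB sy) -mulN1r mulr_fsumr.
by apply: eq_fsbigr => a /set_mem Da; rewrite /tgt rvK// az// mulrN mulN1r.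
Qed.

Lemma supported_tgt B y z : supported B y ->
  supported (hood B) (fun a => bdry y (tgt a) * z a).
Proof.
move=> sy a Da aB; rewrite (bdry_supp sy) ?mul0r//.
by apply: contra aB => /(src_hood Da).
Qed.

Lemma supported_src B y z : supported B y ->
  supported B (fun a => bdry y (src a) * z a).
Proof. by move=> sy a Da aB; rewrite (bdry_supp sy) ?mul0r. Qed.

(** Summation by parts. Only [y] has finite support: [z] may be a harmonic form spread over an
    infinite graph. *)
Lemma dot_qop y z : finform y -> antisym z ->
  dot (qop y) z = dot y z - 2 / c * vdot (bdry y) (bdry z).
Proof.
move=> [ay [B uB sy]] az; have uH := hood_uniq B.
have syH : supported (hood B) y by exact: supported_sub (@sub_hood B) _.
rewrite (dotE _ uH (supported_qop sy)) (dotE _ uH syH).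
have -> : 2 / c * vdot (bdry y) (bdry z) =
    c^-1 * \sum_(a <- star_edges (hood B)) bdry y (src a) * z a
  - c^-1 * \sum_(a <- star_edges (hood B)) bdry y (tgt a) * z a.
  rewrite (dot_bdry _ uH syH) -(fsum_star uH (supported_tgt z sy)).
  by rewrite (fsum_bdry_tgt uB)//; ring.
rewrite !mulr_sumr opprB addrCA -sumrB -big_split /=.
apply: eq_big_seq => a /star_edgesP[Da _]; rewrite /qop.
by field; rewrite !gt_eqF ?len_gt0.
Qed.

Lemma vdot_ge0 u : 0 <= vdot u u.
Proof. by apply: fsumr_ge0 => v _; rewrite -expr2 sqr_ge0. Qed.

Lemma fsum_sqr_bdry B y : uniq B -> supported B y ->
  \sum_(a \in D) bdry y (src a) * (bdry y (src a) / len a)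
    <= c / 2 * vdot (bdry y) (bdry y).
Proof.
move=> uB sy; rewrite (fsum_star uB) ?big_star_edges; last exact: supported_src.
rewrite (vdotE _ uB); last by move=> v; exact: bdry_supp.
rewrite mulr_sumr; apply: ler_sum => v _.
rewrite (_ : \sum_(_ <- _) _ =
             bdry y v ^+ 2 * \sum_(a <- out v) (len a)^-1); last first.
  by rewrite mulr_sumr; apply: eq_big_seq => a /outP[_ ->]; rewrite mulrA expr2.
by rewrite -expr2 mulrC ler_wpM2r ?sqr_ge0.
Qed.

(** With [V] the squared norm of [bdry y], the cross term of the expanded square is [- 4 V / c]. By
    [(p - q)^2 <= 2 p^2 + 2 q^2] the quadratic term splits over the two ends of each edge, and the
    bound [c / 2] on the stars makes it at most [2 V / c], half of the gain. *)
Lemma dot_qop_le y : finform y ->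
  dot (qop y) (qop y) <= dot y y - 2 / c * vdot (bdry y) (bdry y).
Proof.
move=> fy; have [ay [B uB sy]] := fy; have uH := hood_uniq B.
have syH : supported (hood B) y by exact: supported_sub (@sub_hood B) _.
rewrite (dotE _ uH (supported_qop sy)).
pose F a := bdry y (src a) * (bdry y (src a) / len a).
have sF : supported (hood B) F.
  exact: supported_sub (@sub_hood B) (supported_src _ sy).
have sF' : supported (hood B) (F \o rv).
  move=> a Da aB; rewrite /F /= -/(tgt a) (bdry_supp sy) ?mul0r//.
  by apply: contra aB => /(src_hood Da).
have SF := fsum_sqr_bdry uB sy; rewrite -/F in SF.
have SF' : \sum_(a \in D) F (rv a) <= c / 2 * vdot (bdry y) (bdry y).
  by rewrite fsum_rv.
rewrite (fsum_star uH sF) in SF; rewrite (fsum_star uH sF') in SF'.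
have E1 := dot_bdry y uH syH.
have E2 := fsum_bdry_tgt uB sy ay.
rewrite (fsum_star uH (supported_tgt y sy)) in E2.
rewrite (dotE y uH syH); set V := vdot _ _ in SF SF' E1 E2 *.
apply: (@le_trans _ _ (\sum_(a <- star_edges (hood B))
   (len a * (y a * y a) - 2 / c * (bdry y (src a) * y a)
    + 2 / c * (bdry y (tgt a) * y a) + 2 / c ^+ 2 * F a + 2 / c ^+ 2 * F (rv a)))).
  rewrite big_seq [leRHS]big_seq; apply: ler_sum => a /star_edgesP[Da _].
  rewrite /qop /F -/(tgt a) len_rv// -subr_ge0.
  (* The slack in [(p - q)^2 <= 2 p^2 + 2 q^2] is [(p + q)^2]. *)
  rewrite (_ : _ - _ = (bdry y (src a) + bdry y (tgt a)) ^+ 2 / (c ^+ 2 * len a)).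
    by rewrite divr_ge0 ?sqr_ge0// mulr_ge0 ?sqr_ge0// ltW// len_gt0.
  by field; rewrite !gt_eqF ?len_gt0.
rewrite !big_split /= sumrN -!mulr_sumr E1 E2.
have cc : 2 / c ^+ 2 * (c / 2 * V) = V / c by field; rewrite gt_eqF.
have {}SF : 2 / c ^+ 2 * (\sum_(a <- star_edges (hood B)) F a) <= V / c.
  by rewrite -cc ler_wpM2l// divr_ge0// sqr_ge0.
have {}SF' : 2 / c ^+ 2 * (\sum_(a <- star_edges (hood B)) F (rv a)) <= V / c.
  by rewrite -cc ler_wpM2l// divr_ge0// sqr_ge0.
have -> : 2 / c * V = V / c + V / c by field; rewrite gt_eqF.
have -> : 2 / c * - V = - (V / c) - V / c by field; rewrite gt_eqF.
lra.
Qed.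

Lemma dot_sym_qop y z : finform y -> finform z -> dot (qop y) z = dot y (qop z).
Proof.
move=> fy fz; rewrite (dotC y) !dot_qop//; try by case: fy; case: fz.
by rewrite dotC (vdotC (bdry y)).
Qed.

Lemma finform_iter j y : finform y -> finform (iter j qop y).
Proof. by move=> fy; elim: j => [//|j IH]; exact: finform_qop. Qed.

Lemma dot_iter i j y : finform y ->
  dot (iter i qop y) (iter j qop y) = dot (iter (i + j) qop y) y.
Proof.
move=> fy; elim: j i => [|j IH] i; first by rewrite addn0.
rewrite iterS -dot_sym_qop; [|exact: finform_iter..].
by rewrite -iterS IH addSnnS.
Qed.

Lemma finformB y z : finform y -> finform z -> finform (fun a => y a - z a).
Proof.
move=> [ay [B uB sy]] [az [B' uB' sz]]; split.
  by move=> a Da; rewrite ay// az//; ring.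
exists (undup (B ++ B')); first exact: undup_uniq.
move=> a Da; rewrite mem_undup mem_cat negb_or => /andP[h h'].
by rewrite sy// sz// subrr.
Qed.

Lemma dot_supp2 y z : finform y -> finform z -> exists B,
  [/\ uniq B, supported B y & supported B z].
Proof.
move=> [ay [B uB sy]] [az [B' uB' sz]]; exists (undup (B ++ B')).
split; first exact: undup_uniq.
  by apply: supported_sub sy => v vB; rewrite mem_undup mem_cat vB.
by apply: supported_sub sz => v vB; rewrite mem_undup mem_cat vB orbT.
Qed.

Lemma dot_subsub y z : finform y -> finform z ->
  dot (fun a => y a - z a) (fun a => y a - z a) = dot y y - 2 * dot y z + dot z z.
Proof.
move=> fy fz; have [B [uB sy sz]] := dot_supp2 fy fz.
rewrite (dotE y uB sy) (dotE z uB sy) (dotE z uB sz) (@dotE B)//; last first.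
  by move=> a Da aB; rewrite sy// sz// subrr.
rewrite mulr_sumr -sumrN -!big_split /=; apply: eq_bigr => a _; ring.
Qed.

Definition edge_form e : T -> R :=
  fun a => (if a == e then 1 else 0) - (if a == rv e then 1 else 0).

Lemma finform_edge e : D e -> finform (edge_form e).
Proof.
move=> De; split.
  move=> a Da; rewrite /edge_form.
  have -> : (rv a == e) = (a == rv e).
    by apply/eqP/eqP => [<-|->]; rewrite rvK.
  have -> : (rv a == rv e) = (a == e).
    by apply/eqP/eqP => [h|->//]; rewrite -(rvK Da) h rvK.
  by rewrite opprB.
exists (undup [:: src e; tgt e]); first exact: undup_uniq.
move=> a Da; rewrite mem_undup !inE negb_or /edge_form => /andP[h1 h2].
case: (eqVneq a e) h1 => [->|_ _]; first by rewrite eqxx.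
by case: (eqVneq a (rv e)) h2 => [->|_ _]; rewrite ?subrr// /tgt eqxx.
Qed.

Lemma dot_edge y e : D e -> antisym y -> dot y (edge_form e) = 2 * len e * y e.
Proof.
move=> De ay; have [_ [B uB sB]] := finform_edge De.
rewrite dotC /dot (fsbigE [:: e; rv e]) //=.
- rewrite big_mkcond /= !big_cons big_nil !mem_set//; last exact: Drv.
  rewrite /edge_form !eqxx (negbTE (rv_neq De)) eq_sym (negbTE (rv_neq De)).
  by rewrite len_rv// ay//; ring.
- by rewrite inE eq_sym rv_neq.
- by move=> a /=; rewrite !inE => /orP[]/eqP->//; exact: Drv.
move=> a Da; rewrite !inE negb_or => /andP[/negbTE h1 /negbTE h2].
by rewrite /edge_form h1 h2 subrr mul0r mulr0.
Qed.

(** * Powers of Q applied to an edge *)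

Section Orbit.
Variable e : T.
Hypothesis De : D e.

Definition orb j : T -> R := iter j qop (edge_form e).
Definition amp j : R := orb j e.

Lemma finform_orb j : finform (orb j).
Proof. exact/finform_iter/finform_edge. Qed.

(** Self-adjointness turns every inner product in the orbit into an amplitude. Amplitudes of even
    index are squared norms, hence nonnegative and decreasing; this is why limits are taken along
    even powers. *)
Lemma dot_orb i j : dot (orb i) (orb j) = 2 * len e * amp (i + j).
Proof.
rewrite dot_iter; last exact: finform_edge.
by rewrite dot_edge//; case: (finform_orb (i + j)).
Qed.

Lemma amp_double_ge0 k : 0 <= amp k.*2.
Proof.
have := dot_ge0 (orb k); rewrite dot_orb addnn pmulr_rge0//.
by rewrite mulr_gt0// len_gt0.
Qed.

Lemma vdot_orb k : 2 / c * vdot (bdry (orb k)) (bdry (orb k)) <=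
  2 * len e * (amp k.*2 - amp k.+1.*2).
Proof.
have := dot_qop_le (finform_orb k); rewrite -[qop _]/(orb k.+1) !dot_orb !addnn.
by move=> h; rewrite mulrBr; lra.
Qed.

Lemma amp_decr k : amp k.+1.*2 <= amp k.*2.
Proof.
have := vdot_orb k; have v0 := vdot_ge0 (bdry (orb k)) => h.
rewrite -subr_ge0 -(@pmulr_rge0 _ (2 * len e)) ?mulr_gt0 ?len_gt0//.
by apply: le_trans h; rewrite mulr_ge0// divr_ge0// ltW.
Qed.

Lemma amp_nonincreasing : nonincreasing_seq (fun k => amp k.*2).
Proof. by apply/nonincreasing_seqP => k; exact: amp_decr. Qed.

Lemma is_cvg_amp : cvgn (fun k => amp k.*2).
Proof.
apply: nonincreasing_is_cvgn; first exact: amp_nonincreasing.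
by exists 0 => _ [k _ <-]; exact: amp_double_ge0.
Qed.

Definition amp_lim : R := limn (fun k => amp k.*2).

Lemma amp_lim_le k : amp_lim <= amp k.*2.
Proof. by apply: nonincreasing_cvgn_ge; [exact: amp_nonincreasing|exact: is_cvg_amp]. Qed.

Lemma cvg_amp : (fun k => amp k.*2) @ \oo --> amp_lim.
Proof. exact: is_cvg_amp. Qed.

(** Bound for the squared distance from [orb k.*2] to its limit; the index [4k] arises because the
    squared norm of [orb k.*2] is an amplitude at twice its index. *)
Definition gap k := 2 * len e * (amp k.*2.*2 - amp_lim).

Lemma gap_cvg : gap @ \oo --> (0 : R).
Proof.
rewrite -(mulr0 (2 * len e)); apply: cvgMr; rewrite -(subrr amp_lim).
apply: cvgB; last exact: cvg_cst.
have := @cvg_comp _ _ _ (fun k => k.*2) (fun k => amp k.*2) \oo \oo (nbhs amp_lim).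
apply; last exact: cvg_amp.
apply/cvgnyPge => M; exists M => //= k Mk.
by rewrite (leq_trans Mk)// -addnn leq_addr.
Qed.

(** Up to the factor [2 * len e], the squared norm of the difference is
    [amp (4k) - 2 amp (2k + 2m) + amp (4m)]. Monotonicity bounds [amp (4m)] by the mixed amplitude,
    which in turn is at least [amp_lim]. *)
Lemma orb_sub_le k m s : (k <= m)%N -> uniq s -> {in s, forall a, D a} ->
  \sum_(a <- s) len a * (orb k.*2 a - orb m.*2 a) ^+ 2 <= gap k.
Proof.
move=> km us sD; have fk := finform_orb k.*2; have fm := finform_orb m.*2.
have := dot_ge (finformB fk fm) us sD; move=> /le_trans; apply.
rewrite dot_subsub// !dot_orb /gap.
have -> : (k.*2 + k.*2 = k.*2.*2)%N by rewrite addnn.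
have -> : (m.*2 + m.*2 = m.*2.*2)%N by rewrite addnn.
rewrite -doubleD.
have h1 := amp_lim_le (k + m)%N.
have h2 : amp m.*2.*2 <= amp (k + m).*2.
  by apply: (amp_nonincreasing); rewrite -addnn leq_add2r.
rewrite -subr_ge0 (_ : _ - _ = 2 * len e * (2 * amp (k + m).*2 - amp m.*2.*2 - amp_lim)).
  by apply: mulr_ge0; [rewrite ltW// mulr_gt0// len_gt0|lra].
by ring.
Qed.

Lemma orb_is_cvg a : D a -> cvgn (fun k => orb k.*2 a).
Proof.
move=> Da; apply/cauchy_cvgP/cauchy_exP => eps eps0.
have la := len_gt0 Da.
have /cvgrPdist_lt/(_ (len a * eps ^+ 2)) := gap_cvg.
rewrite pmulr_rgt0// exprn_gt0// => /(_ isT)[K _ hK].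
exists (orb K.*2 a), K => //= m Km.
have := @orb_sub_le K m [:: a] Km isT.
rewrite big_seq1; have aD : {in [:: a], forall b, D b}.
  by move=> b; rewrite inE => /eqP->.
move=> /(_ aD) h.
have := hK K (leqnn K); rewrite /= sub0r normrN => /(le_lt_trans (ler_norm _)) h1.
have := le_lt_trans h h1; rewrite ltr_pM2l// => h3.
rewrite /ball /= -ltr_sqr ?nnegrE ?(ltW eps0)//.
by rewrite real_normK ?num_real.
Qed.

(** The projection of the edge form, obtained as an edgewise limit; [orb_lim_sub_le] upgrades it to
    a limit in norm. *)
Definition orb_lim a : R := limn (fun k => orb k.*2 a).

Lemma orb_cvg a : D a -> (fun k => orb k.*2 a) @ \oo --> orb_lim a.
Proof. exact: orb_is_cvg. Qed.

Lemma orb_lim_edge : orb_lim e = amp_lim.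
Proof. by []. Qed.

Lemma antisym_orb_lim : antisym orb_lim.
Proof.
move=> a Da; rewrite /orb_lim -limN; last exact: orb_is_cvg.
by congr (limn _); apply/funext => k; have [->] := finform_orb k.*2.
Qed.

Lemma orb_lim_sub_le k s : uniq s -> {in s, forall a, D a} ->
  \sum_(a <- s) len a * (orb k.*2 a - orb_lim a) ^+ 2 <= gap k.
Proof.
move=> us sD.
have h : (fun m => \sum_(a <- s) len a * (orb k.*2 a - orb m.*2 a) ^+ 2) @ \oo
    --> \sum_(a <- s) len a * (orb k.*2 a - orb_lim a) ^+ 2.
  rewrite [in X in _ --> X]big_seq; under eq_fun do rewrite big_seq.
  apply: cvg_big => [|a]; [exact: add_continuous|]; move=> /sD Da; apply: cvgMr; rewrite expr2.
  by apply: cvgM; apply: cvgB; (try exact: cvg_cst); exact: orb_cvg.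
apply: (cvgr_to_le h); exists k => //= m km.
exact: orb_sub_le.
Qed.

(** By [vdot_orb] the squared norm of the boundary is paid for by a decrease of the amplitude, and
    the decreases of a convergent sequence vanish. This gives both the harmonicity of [orb_lim] and
    the decay of the random walk kernel. *)
Lemma bdry_orb_cvg v : (fun k => bdry (orb k.*2) v) @ \oo --> (0 : R).
Proof.
have h k : bdry (orb k.*2) v ^+ 2 <= c * len e * (amp k.*2.*2 - amp_lim).
  have [_ [B uB sB]] := finform_orb k.*2.
  have h1 := vdot_orb k.*2; have h2 := amp_lim_le k.*2.+1.
  have h3 : bdry (orb k.*2) v ^+ 2 <= vdot (bdry (orb k.*2)) (bdry (orb k.*2)).
    have uB' := undup_uniq (v :: B).
    rewrite (@vdotE (undup (v :: B)))//; last first.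
      move=> w; rewrite mem_undup inE negb_or => /andP[_].
      exact: bdry_supp.
    rewrite (bigD1_seq v) ?mem_undup ?inE ?eqxx//= expr2 lerDl.
    by rewrite sumr_ge0// => w _; rewrite -expr2 sqr_ge0.
  have h4 : 2 / c * bdry (orb k.*2) v ^+ 2 <= 2 * len e * (amp k.*2.*2 - amp_lim).
    apply: le_trans (le_trans h1 _); first by rewrite ler_wpM2l// divr_ge0// ltW.
    by rewrite ler_wpM2l ?lerB// mulr_ge0// ltW// len_gt0.
  rewrite -(@ler_pM2l _ (2 / c)) ?divr_gt0//; apply: le_trans h4 _.
  by rewrite le_eqVlt; apply/orP; left; apply/eqP; field; rewrite gt_eqF.
have hc : (fun k => c * len e * (amp k.*2.*2 - amp_lim)) @ \oo --> (0 : R).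
  have -> : (fun k => c * len e * (amp k.*2.*2 - amp_lim)) = (fun k => c / 2 * gap k).
    by apply/funext => k; rewrite /gap; field.
  by rewrite -(mulr0 (c / 2)); apply: cvgMr; exact: gap_cvg.
apply/cvgrPdist_lt => eps eps0.
have /cvgrPdist_lt/(_ (eps ^+ 2)) := hc; rewrite exprn_gt0// => /(_ isT).
apply: filterS => k; rewrite !sub0r !normrN => /(le_lt_trans (ler_norm _)) h1.
have := le_lt_trans (h k) h1; rewrite -[X in X < _]real_normK ?num_real//.
by rewrite ltr_sqr ?nnegrE// ltW.
Qed.

Lemma bdry_orb_lim v : bdry orb_lim v = 0.
Proof.
have h : (fun k => bdry (orb k.*2) v) @ \oo --> bdry orb_lim v.
  rewrite /bdry [in X in _ --> X]big_seq; under eq_fun do rewrite big_seq.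
  by apply: cvg_big => [|a]; [exact: add_continuous|]; move=> /outP[Da _]; exact: orb_cvg.
exact: (cvg_unique _ h (bdry_orb_cvg v)).
Qed.

Lemma dot_harmonic j z : antisym z -> (forall v, bdry z v = 0) ->
  dot (orb j) z = dot (edge_form e) z.
Proof.
move=> az z0; elim: j => [//|j IH].
rewrite dot_qop//; last exact: finform_orb.
rewrite [vdot _ _](_ : _ = 0) ?mulr0 ?subr0//.
by rewrite /vdot fsbig1// => v _; rewrite z0 mulr0.
Qed.

(** The residual is split at [orb k.*2]: the first part has finite support and is exactly orthogonal
    to [z], the second is small in norm. Since [z] may have infinite support, orthogonality is
    expressed by finite sums over all sets containing a fixed star. *)
Lemma orb_lim_orth z (M delta : R) : antisym z -> (forall v, bdry z v = 0) ->
  (forall s, uniq s -> {in s, forall a, D a} ->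
     \sum_(a <- s) len a * z a ^+ 2 <= M) ->
  0 < delta -> exists2 B, uniq B & forall s, uniq s -> {in s, forall a, D a} ->
  {subset star_edges B <= s} ->
  `|\sum_(a <- s) len a * ((edge_form e a - orb_lim a) * z a)| <= delta.
Proof.
move=> az z0 zM d0.
have M0 : 0 <= M by have := zM [::] isT (fun _ => False_ind _ \o notF); rewrite big_nil.
(* Once [gap k <= delta / t], this weight makes each of the two AM-GM terms at most [delta / 2]; the
   [+ 1] keeps [t] positive when [M] is 0. *)
pose t := (M + 1) / delta; have t0 : 0 < t by rewrite divr_gt0// ltr_wpDl.
have /cvgrPdist_lt/(_ (delta / t)) := gap_cvg; rewrite divr_gt0// => /(_ isT)[k _ hk].
have {}hk : gap k <= delta / t.
  have := hk k (leqnn k); rewrite /= sub0r normrN => /(le_lt_trans (ler_norm _)).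
  exact: ltW.
have fx := finform_edge De; have fo := finform_orb k.*2.
have [_ [B uB sB]] := finformB fx fo.
exists B => // s us sD sub.
have -> : \sum_(a <- s) len a * ((edge_form e a - orb_lim a) * z a) =
   \sum_(a <- s) len a * ((edge_form e a - orb k.*2 a) * z a) +
   \sum_(a <- s) len a * ((orb k.*2 a - orb_lim a) * z a).
  by rewrite -big_split /=; apply: eq_bigr => a _; ring.
(* The set [s] contains the whole support of this difference, so the finite sum is the full pairing,
   which [Q] leaves unchanged because [z] has no boundary. *)
have -> : \sum_(a <- s) len a * ((edge_form e a - orb k.*2 a) * z a) = 0.
  have h0 : dot (fun a => edge_form e a - orb k.*2 a) z = 0.
    have [B' [uB' sx so]] := dot_supp2 fx fo.
    rewrite (dotE _ uB') => [|a Da aB]; last by rewrite sx// so// subrr.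
    have := dot_harmonic k.*2 az z0.
    rewrite (dotE _ uB' sx) (dotE _ uB' so) => h.
    rewrite (eq_bigr (fun a => len a * (edge_form e a * z a) - len a * (orb k.*2 a * z a))).
      by rewrite sumrB h subrr.
    by move=> a _; ring.
  rewrite -[RHS]h0 /dot (fsbigE s)//=.
  - rewrite big_seq_cond [in RHS]big_seq_cond; apply: eq_bigl => a.
    by case: (boolP (a \in s)) => // /sD Da; rewrite mem_set.
  - move=> a Da ns; rewrite sB ?mul0r ?mulr0//; apply: contra ns => aB.
    by apply: sub; apply/star_edgesP.
rewrite add0r; apply: (le_trans (ler_norm_sum _ _ _)).
(* AM-GM with weight [t] *)
apply: (@le_trans _ _ (\sum_(a <- s) (t / 2 * (len a * (orb k.*2 a - orb_lim a) ^+ 2)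
    + (2 * t)^-1 * (len a * z a ^+ 2)))).
  rewrite big_seq [leRHS]big_seq; apply: ler_sum => a /sD Da.
  have la := len_gt0 Da; set p := orb _ _ - _.
  rewrite !normrM (gtr0_norm la) -(real_normK (num_real p)) -(real_normK (num_real (z a))).
  move: `|p| `|z a| => P Z; rewrite -subr_ge0.
  rewrite (_ : _ - _ = len a * (t * P - Z) ^+ 2 / (2 * t)).
    apply: divr_ge0; last by rewrite mulr_ge0// ltW.
    by apply: mulr_ge0; [exact: ltW|exact: sqr_ge0].
  by field; rewrite gt_eqF.
rewrite big_split /= -!mulr_sumr.
apply: (@le_trans _ _ (t / 2 * (delta / t) + (2 * t)^-1 * M)).
  apply: lerD; apply: ler_wpM2l.
  - by rewrite divr_ge0// ltW.
  - exact: le_trans (orb_lim_sub_le _ us sD) hk.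
  - by rewrite invr_ge0 mulr_ge0// ltW.
  - exact: zM.
have -> : t / 2 * (delta / t) = delta / 2 by field; rewrite gt_eqF.
have : (2 * t)^-1 * M <= delta / 2.
  rewrite mulrC ler_pdivrMr; last exact: mulr_gt0.
  rewrite /t.
  have -> : delta / 2 * (2 * ((M + 1) / delta)) = M + 1 by field; rewrite gt_eqF.
  by rewrite lerDl.
lra.
Qed.

(** * The random walk kernel and its decay *)

Definition dirac w : U -> R := fun v => (v == w)%:R.
(** The probability that the walk started at [v] is at [w] after [j] steps. *)
Definition ker j w : U -> R := iter j top (dirac w).

Lemma bdry_edge : bdry (edge_form e) = fun v => dirac (src e) v - dirac (tgt e) v.
Proof.
apply/funext => v; rewrite /bdry /edge_form big_split /= sumrN.
have h b : D b -> \sum_(a <- out v) (if a == b then 1 else 0) = dirac (src b) v.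
  move=> Db; rewrite /dirac; case: eqP => [->|/eqP vb].
    have bo : b \in out (src b) by apply/outP.
    rewrite (bigD1_seq b)//= eqxx big1 ?addr0// => a /negbTE->//.
  rewrite big1_seq// => a /andP[_ /outP[_ av]]; case: eqP => // ab.
  by rewrite -av ab eqxx in vb.
by rewrite h// h//; exact: Drv.
Qed.

Lemma topB u u' : top (fun v => u v - u' v) = fun v => top u v - top u' v.
Proof.
apply/funext => v; rewrite /top.
rewrite (eq_bigr (fun a => (u v - u (tgt a)) / (c * len a) - (u' v - u' (tgt a)) / (c * len a))).
  by rewrite sumrB; ring.
by move=> a _; rewrite -mulrBl; congr (_ / _); ring.
Qed.

Lemma bdry_orb j : bdry (orb j) = fun v => ker j (src e) v - ker j (tgt e) v.
Proof.
elim: j => [|j IH]; first exact: bdry_edge.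
by rewrite /orb /= bdry_qop -[iter _ _ _]/(orb j) IH topB.
Qed.

(** From [d* Q^j = T^j d*]: the decrease of an amplitude is read off the vertex kernel at the two
    ends of [e]. This is what lets amplitudes be computed from walks. *)
Lemma amp_step j : amp j - amp j.+1 =
  (ker j (src e) (src e) + ker j (tgt e) (tgt e)
   - ker j (src e) (tgt e) - ker j (tgt e) (src e)) / (c * len e).
Proof.
rewrite /amp {2}/orb /= -[iter _ _ _]/(orb j) /qop bdry_orb opprB addrC subrK.
by congr (_ / _); ring.
Qed.

End Orbit.

(** Collecting the terms in [w v], its coefficient is one minus the total probability of leaving
    [v], which is at most 1/2; so all coefficients of [top] are nonnegative. *)
Lemma le_top u u' : (forall v, u v <= u' v) -> forall v, top u v <= top u' v.
Proof.
move=> uu v; have E w : top w v = w v * (1 - \sum_(a <- out v) (c * len a)^-1)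
    + \sum_(a <- out v) w (tgt a) / (c * len a).
  rewrite /top mulrBr mulr1 mulr_sumr -addrA; congr (_ + _).
  rewrite addrC -sumrB -sumrN; apply: eq_bigr => a _; ring.
rewrite !E; apply: lerD.
  apply: ler_wpM2r => //; rewrite subr_ge0.
  rewrite (eq_bigr (fun a => c^-1 * (len a)^-1)); last by move=> a _; rewrite invfM.
  rewrite -mulr_sumr -(@ler_pM2l _ c)// mulrA divff ?gt_eqF// mul1r mulr1.
  by apply: le_trans (outc v) _; rewrite ler_pdivrMr// ler_pMr// ler1n.
rewrite big_seq [leRHS]big_seq; apply: ler_sum => a /outP[Da _].
by apply: ler_wpM2r => //; rewrite invr_ge0 mulr_ge0 ?ltW// len_gt0.
Qed.

Lemma top_cst (x : R) v : top (fun=> x) v = x.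
Proof. by rewrite /top big1 ?subr0// => a _; rewrite subrr mul0r. Qed.

Lemma ker_ge0 j w v : 0 <= ker j w v.
Proof.
elim: j v => [|j IH] v; first by rewrite /ker /dirac ler0n.
by rewrite /ker /= -{1}(top_cst 0 v); apply: le_top.
Qed.

Lemma top_sum (I : Type) (r : seq I) (F : I -> U -> R) v :
  top (fun w => \sum_(i <- r) F i w) v = \sum_(i <- r) top (F i) v.
Proof.
rewrite /top sumrB; congr (_ - _); rewrite exchange_big /=.
by apply: eq_bigr => a _; rewrite -sumrB mulr_suml.
Qed.

Lemma sum_ker_le1 j B v : uniq B -> \sum_(w <- B) ker j w v <= 1.
Proof.
move=> uB; elim: j v => [|j IH] v.
  rewrite /ker /= /dirac; case: (boolP (v \in B)) => vB.
    rewrite (bigD1_seq v)//= eqxx big1 ?addr0// => w.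
    by rewrite eq_sym => /negbTE->.
  rewrite big1_seq// => w /andP[_ wB]; case: eqP => // vw.
  by rewrite vw wB in vB.
by rewrite /ker /= -top_sum -[leRHS](top_cst 1 v); apply: le_top.
Qed.

(** The vertices joined to [v] by a walk, encoded as an induction principle. *)
Definition reach v : set U := [set w | forall S : set U, S v ->
  (forall a, D a -> S (src a) -> S (tgt a)) -> S w].

(** Along one edge the difference of the kernels of its ends, evaluated at [v], is the boundary of
    an orbit and tends to 0; hence the kernels of all reachable [w] at [v] become close to the
    return probability. If that stayed above [2 / N], then [N] reachable vertices would each carry
    mass above [1 / N], against a total of at most 1. *)
Lemma ker_vanish v : infinite_set (reach v) ->
  (fun k => ker k.*2 v v) @ \oo --> (0 : R).
Proof.
move=> inf.
have near_ w : reach v w ->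
    (fun k => ker k.*2 v v - ker k.*2 w v) @ \oo --> (0 : R).
  move=> /(_ [set w | (fun k => ker k.*2 v v - ker k.*2 w v) @ \oo --> (0 : R)]); apply.
    by rewrite /=; under eq_fun do rewrite subrr; exact: cvg_cst.
  move=> a Da /= h; have := cvgD h (bdry_orb_cvg Da v); rewrite addr0.
  rewrite (_ : _ + _ = fun k => ker k.*2 v v - ker k.*2 (tgt a) v).
    by move=> h'; apply: h'.
  by apply/funext => k; rewrite /= fctE bdry_orb//; ring.
apply/cvgrPdist_le => eps eps0.
pose N := (Num.truncn (2 / eps)).+1.
have N0 : (0 : R) < N%:R by rewrite ltr0n.
have Neps : 2 / N%:R <= eps.
  rewrite ler_pdivrMr// mulrC -ler_pdivrMr//.
  by rewrite ltW// /N; apply: truncnS_gt.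
have [B] := infinite_set_fset N inf.
move=> BV; rewrite /= => sB.
have uB := fset_uniq B.
have : \forall k \near \oo, forall w, w \in (B : seq U) ->
    ker k.*2 v v - ker k.*2 w v < N%:R^-1.
  apply: near_all_seq => w /BV /near_ /cvgrPdist_lt/(_ N%:R^-1).
  rewrite invr_gt0 => /(_ N0); apply: filterS => k.
  by rewrite sub0r normrN; apply: le_lt_trans; exact: ler_norm.
apply: filterS => k hk; rewrite sub0r normrN ger0_norm ?ker_ge0//.
apply: le_trans Neps.
have h1 := sum_ker_le1 k.*2 v uB.
have : \sum_(w <- B) (ker k.*2 v v - N%:R^-1) <= \sum_(w <- B) ker k.*2 w v.
  rewrite big_seq [leRHS]big_seq; apply: ler_sum => w /hk; lra.
move=> /le_trans/(_ h1); rewrite big_const_seq count_predT iter_addr_0.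
rewrite leNgt => /negP h2; rewrite leNgt; apply/negP => h3; apply: h2.
have h4 : N%:R^-1 < ker k.*2 v v - N%:R^-1 by lra.
apply: (@lt_le_trans _ _ ((ker k.*2 v v - N%:R^-1) *+ N)).
  by rewrite -[X in _ < X]mulr_natr -ltr_pdivrMr// div1r.
by apply: ler_wpMn2l => //; apply: ltW; apply: lt_trans h4; rewrite invr_gt0.
Qed.

End LocallyFiniteGraph.

Lemma uniq_map_inj_in (A B : eqType) (f : A -> B) (s : seq A) :
  uniq (map f s) -> {in s &, injective f}.
Proof.
elim: s => [//|z s IH] /= /andP[zs us] a b; rewrite !inE.
move=> /orP[/eqP->|as_] /orP[/eqP->|bs] // e; last exact: IH.
  by move: zs; rewrite e map_f.
by move: zs; rewrite -e map_f.
Qed.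

(** * Amplitudes in a normal cover *)

Section WalkKernel.
Context {R : realType} {T0 U0 : choiceType} (g0 : lfgraph R T0 U0).
Local Notation D0 := (gD g0).
Local Notation rv0 := (grv g0).
Local Notation src0 := (gsrc g0).
Local Notation len0 := (glen g0).
Local Notation out0 := (gout g0).
Local Notation tgt0 := (tgt g0).
Local Notation c := (gc g0).

Definition wend (u : U0) (p : seq T0) : U0 := last u (map tgt0 p).

Fixpoint wpath (u : U0) (p : seq T0) : bool :=
  if p is b :: q then (b \in out0 u) && wpath (tgt0 b) q else true.

Lemma wpath_rcons u p b :
  wpath u (rcons p b) = wpath u p && (b \in out0 (wend u p)).
Proof. by elim: p u => [|a p IH] u; rewrite /= ?andbT ?IH ?andbA. Qed.

Variables (R' : U0 -> seq T0 -> seq T0 -> bool).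

(* The entry of [iter j top] in a cover, at the ends of the lifts of the walks
   [p] and [q], where [R' u p q] tells when both ends agree. *)
Fixpoint wker (j : nat) (u : U0) (p q : seq T0) : R :=
  if j is i.+1 then
    wker i u p q - \sum_(b <- out0 (wend u p))
      (wker i u p q - wker i u (rcons p b) q) / (c * len0 b)
  else (R' u p q)%:R.

Definition wdiag j u := wker j u [::] [::].
Definition wstep j b := wker j (src0 b) [:: b] [::].
(** The right side of [amp_step] written on the base: [wstep j b] stands for the kernel between the
    ends of an edge above [b], and [wstep j (rv0 b)] for the same with the ends exchanged. *)
Definition wdiff j b := (wdiag j (src0 b) + wdiag j (tgt0 b)
   - wstep j b - wstep j (rv0 b)) / (c * len0 b).
Definition wamp j b := 1 - \sum_(i < j) wdiff i b.

Lemma wdiagS j u : wdiag j u - wdiag j.+1 u =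
  \sum_(b <- out0 u) (wdiag j u - wstep j b) / (c * len0 b).
Proof.
rewrite /wdiag /= opprB addrC subrK; apply: eq_big_seq => b /goutP[_ bu].
by rewrite /wstep bu.
Qed.

Lemma wampS j b : wamp j b - wamp j.+1 b = wdiff j b.
Proof. by rewrite /wamp big_ord_recr /=; ring. Qed.

Variable Vs : seq U0.
Hypothesis uVs : uniq Vs.
Hypothesis srcVs : forall b, D0 b -> src0 b \in Vs.
Local Notation E := (star_edges g0 Vs).

Lemma base_sum_rv (F : T0 -> R) : \sum_(b <- E) F (rv0 b) = \sum_(b <- E) F b.
Proof.
have s F' : supported g0 Vs F' by move=> b Db; rewrite srcVs.
by rewrite -!(fsum_star uVs)// fsum_rv.
Qed.

(** Each [wdiff] splits into a term [F b] for the source and [F (rv0 b)] for the target. Reversal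
    permutes the oriented edges, so both sum to the same total, and grouping the edges by source
    gives the decrease of the diagonal of the walk. *)
Lemma trace_step j : \sum_(b <- E) (wamp j b - wamp j.+1 b) =
  2 * \sum_(u <- Vs) (wdiag j u - wdiag j.+1 u).
Proof.
pose F b := (wdiag j (src0 b) - wstep j b) / (c * len0 b).
transitivity (\sum_(b <- E) (F b + F (rv0 b))).
  apply: eq_big_seq => b /star_edgesP[Db _]; rewrite wampS /wdiff /F glen_rv// -mulrDl.
  by congr (_ / _); rewrite /tgt; ring.
rewrite big_split /= (base_sum_rv F) -mulr2n -[LHS]mulr_natl; congr (_ * _).
rewrite big_star_edges; apply: eq_bigr => u _; rewrite wdiagS.
by apply: eq_big_seq => b /goutP[_ bu]; rewrite /F bu.
Qed.

Lemma trace_sum j m : (j <= m)%N -> \sum_(b <- E) (wamp j b - wamp m b) =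
  2 * \sum_(u <- Vs) (wdiag j u - wdiag m u).
Proof.
elim: m => [|m IH]; first by rewrite leqn0 => /eqP->; rewrite !big1 ?mulr0// => *; rewrite subrr.
rewrite leq_eqVlt => /orP[/eqP->|].
  by rewrite !big1 ?mulr0// => *; rewrite subrr.
rewrite ltnS => /IH h.
rewrite (eq_bigr (fun b => (wamp j b - wamp m b) + (wamp m b - wamp m.+1 b))); last by move=> *; ring.
rewrite big_split /= h trace_step -mulrDr -big_split /=.
by congr (_ * _); apply: eq_bigr => *; ring.
Qed.

End WalkKernel.

(** Each step of the recursion lengthens [p] by one edge, so [j] steps consult the relation only on
    walks of length at most [size p + j]. *)
Lemma wker_agree (R : realType) (T0 U0 : choiceType) (g0 : lfgraph R T0 U0)
    (R1 R2 : U0 -> seq T0 -> seq T0 -> bool) (u : U0) (L : nat) :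
  (forall p q, wpath g0 u p -> wpath g0 u q -> (size p <= L)%N -> (size q <= L)%N ->
     R1 u p q = R2 u p q) ->
  forall j p q, wpath g0 u p -> wpath g0 u q -> (size p + j <= L)%N ->
    (size q <= L)%N -> wker g0 R1 j u p q = wker g0 R2 j u p q.
Proof.
move=> h; elim=> [|j IH] p q wp wq sp sq /=; first by rewrite h// -[size p]addn0.
have sp' : (size p + j <= L)%N by rewrite (leq_trans _ sp)// leq_add2l.
rewrite IH//; congr (_ - _); apply: eq_big_seq => b bo.
by rewrite IH// ?wpath_rcons ?wp// size_rcons addSnnS.
Qed.

(** * Reading kernels and amplitudes of a cover on its base *)

Section CoverGraph.
Context {R : realType} {T0 U0 T U : choiceType}.
Variables (g0 : lfgraph R T0 U0) (g : lfgraph R T U) (pe : T -> T0) (pv : U -> U0).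
Hypothesis pe_rv : forall a, gD g a -> pe (grv g a) = grv g0 (pe a).
Hypothesis pe_src : forall a, gD g a -> gsrc g0 (pe a) = pv (gsrc g a).
Hypothesis pe_len : forall a, gD g a -> glen g0 (pe a) = glen g a.
Hypothesis pe_out : forall v, perm_eq (map pe (gout g v)) (gout g0 (pv v)).
Hypothesis pe_c : gc g = gc g0.
Local Notation out0 := (gout g0).
Local Notation out := (gout g).

(** The end of the lift of [b] starting at [v]. The default [v] occurs only when no edge above [b]
    leaves [v]. *)
Definition act (v : U) (b : T0) : U :=
  head v [seq tgt g a | a <- out v & pe a == b].

Lemma pe_D a : gD g a -> gD g0 (pe a).
Proof.
move=> Da; have : pe a \in out0 (pv (gsrc g a)).
  by rewrite -(perm_mem (pe_out _)) map_f//; apply/goutP.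
by move=> /goutP[].
Qed.

Lemma pe_tgt a : gD g a -> tgt g0 (pe a) = pv (tgt g a).
Proof. by move=> Da; rewrite /tgt -pe_rv// pe_src//; exact: gDrv. Qed.

Lemma pe_inj v : {in out v &, injective pe}.
Proof. by apply: uniq_map_inj_in; rewrite (perm_uniq (pe_out v)) gout_uniq. Qed.

Lemma act_pe v a : a \in out v -> act v (pe a) = tgt g a.
Proof.
move=> av; rewrite /act.
rewrite (@eq_in_filter _ _ (pred1 a)).
  by rewrite filter_pred1_uniq ?gout_uniq.
by move=> b bv /=; apply/eqP/eqP => [|->//]; exact: (pe_inj bv av).
Qed.

Lemma lift_out v b : b \in out0 (pv v) -> exists2 a, a \in out v & pe a = b.
Proof. by rewrite -(perm_mem (pe_out v)) => /mapP[a av ->]; exists a. Qed.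

Lemma pv_act v b : b \in out0 (pv v) -> pv (act v b) = tgt g0 b.
Proof.
move=> /lift_out[a av <-]; rewrite act_pe// pe_tgt//.
by move: av => /goutP[].
Qed.

Lemma sum_out v (F : T0 -> U -> R) :
  \sum_(a <- out v) F (pe a) (tgt g a) = \sum_(b <- out0 (pv v)) F b (act v b).
Proof.
rewrite -(perm_big _ (pe_out v)) big_map; apply: eq_big_seq => a av.
by rewrite act_pe.
Qed.

Definition walk (v : U) (p : seq T0) : U := foldl act v p.

Lemma pv_walk v p : wpath g0 (pv v) p -> pv (walk v p) = wend g0 (pv v) p.
Proof.
elim: p v => [//|b p IH] v /= /andP[bv wp].
have e := pv_act bv; rewrite -e in wp.
by rewrite IH// e.
Qed.

(** The edges leaving the end of the lifted walk correspond bijectively, with equal lengths, to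
    those leaving its image, so [top] upstairs and the recursion of [wker] are the same sum. *)
Lemma ker_walk (R' : U0 -> seq T0 -> seq T0 -> bool) v :
  (forall p q, wpath g0 (pv v) p -> wpath g0 (pv v) q ->
     R' (pv v) p q = (walk v p == walk v q)) ->
  forall j p q, wpath g0 (pv v) p -> wpath g0 (pv v) q ->
    ker g j (walk v q) (walk v p) = wker g0 R' j (pv v) p q.
Proof.
move=> hR; elim=> [|j IH] p q wp wq; first by rewrite /= hR.
rewrite [LHS]/ker [LHS]/= -[iter _ _ _]/(ker g j _) /top /= IH//; congr (_ - _).
rewrite (eq_big_seq (fun a => (fun b w => (wker g0 R' j (pv v) p q
    - ker g j (walk v q) w) / (gc g0 * glen g0 b)) (pe a) (tgt g a))); last first.
  by move=> a /goutP[Da _]; rewrite pe_c pe_len.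
rewrite (@sum_out _ (fun b w => (wker g0 R' j (pv v) p q
    - ker g j (walk v q) w) / (gc g0 * glen g0 b))) pv_walk//.
apply: eq_big_seq => b bo.
have wb : wpath g0 (pv v) (rcons p b) by rewrite wpath_rcons wp.
by rewrite -(IH _ _ wb wq) /walk foldl_rcons.
Qed.

(* In a normal cover, whether the lifts of two walks have the same end does
   not depend on the starting point above [u]. *)
Variable R' : U0 -> seq T0 -> seq T0 -> bool.
Hypothesis normalR : forall v p q, wpath g0 (pv v) p -> wpath g0 (pv v) q ->
  R' (pv v) p q = (walk v p == walk v q).

Lemma amp_wamp a j : gD g a -> amp g a j = wamp g0 R' j (pe a).
Proof.
move=> Da; elim: j => [|j IH].
  rewrite /amp /orb /= /edge_form eqxx eq_sym (negbTE (grv_neq Da)) subr0.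
  by rewrite /wamp big_ord0 subr0.
have -> : amp g a j.+1 = amp g a j - (amp g a j - amp g a j.+1) by ring.
rewrite amp_step// IH.
have -> : wamp g0 R' j.+1 (pe a) = wamp g0 R' j (pe a) - wdiff g0 R' j (pe a).
  by rewrite -wampS; ring.
congr (_ - _); rewrite /wdiff pe_c pe_len//; congr (_ / _).
have k (v : U) : ker g j v v = wdiag g0 R' j (pv v).
  by rewrite -[v in LHS]/(walk v [::]) (@ker_walk R')//; exact: normalR.
(* Applied to [a] and to its reversal: the fourth kernel entry is a walk starting at the target of
   [a], so the relation is used at both ends. *)
have st b : gD g b -> ker g j (gsrc g b) (tgt g b) = wstep g0 R' j (pe b).
  move=> Db; have bo : b \in out (gsrc g b) by apply/goutP.
  have bo' : pe b \in out0 (pv (gsrc g b)) by rewrite -(perm_mem (pe_out _)) map_f.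
  rewrite /wstep pe_src// -(@ker_walk R') ?andbT//; last first.
  - by rewrite /= bo'.
  - exact: normalR.
  by rewrite /= act_pe.
rewrite !k pe_tgt// -pe_src// -pe_tgt// st//.
have Db := gDrv Da.
by have := st _ Db; rewrite /tgt grvK// pe_rv// => ->.
Qed.


Variable Vs : seq U0.
Hypothesis uVs : uniq Vs.
Hypothesis srcVs : forall b, gD g0 b -> gsrc g0 b \in Vs.
Hypothesis liftE : forall b, gD g0 b -> exists2 a, gD g a & pe a = b.
Hypothesis liftV : forall u, u \in Vs -> exists v, pv v = u.

Lemma ker_wdiag j v : ker g j v v = wdiag g0 R' j (pv v).
Proof.
by rewrite -[v in LHS]/(walk v [::]) (@ker_walk R')//; exact: normalR.
Qed.

(* The deviation of one amplitude from its limit is dominated by the sum over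
   all edges, a difference of traces. *)
Lemma amp_lim_bracket a k : gD g a ->
  wamp g0 R' k.*2 (pe a) - 2 * (\sum_(u <- Vs) wdiag g0 R' k.*2 u)
    <= amp_lim g a <= wamp g0 R' k.*2 (pe a).
Proof.
move=> Da; apply/andP; split; last by rewrite -amp_wamp//; exact: amp_lim_le.
have Dpa := pe_D Da.
(* Every edge of the base has a lift, so each [wamp] is an amplitude of the cover and inherits its
   monotonicity; all terms of the sum over the base are then nonnegative. *)
have decr b m : gD g0 b -> (k <= m)%N -> wamp g0 R' m.*2 b <= wamp g0 R' k.*2 b.
  by move=> /liftE[a' Da' <-] km; rewrite -!amp_wamp//; exact: amp_nonincreasing.
have lim_ge m : (k <= m)%N ->
    wamp g0 R' k.*2 (pe a) - 2 * (\sum_(u <- Vs) wdiag g0 R' k.*2 u)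
    <= amp g a m.*2.
  move=> km; rewrite amp_wamp// lerBlDl -lerBlDr.
  have km2 : (k.*2 <= m.*2)%N by rewrite leq_double.
  apply: (@le_trans _ _ (\sum_(b <- star_edges g0 Vs)
      (wamp g0 R' k.*2 b - wamp g0 R' m.*2 b))).
    have ae : pe a \in star_edges g0 Vs by apply/star_edgesP; split=> //; exact: srcVs.
    rewrite (bigD1_seq (pe a)) ?star_edges_uniq//= lerDl big_seq_cond.
    apply: sumr_ge0 => b /andP[/star_edgesP[Db _] _].
    by rewrite subr_ge0 decr.
  rewrite trace_sum// ler_pM2l// big_seq [leRHS]big_seq; apply: ler_sum => u /liftV[v <-].
  by rewrite lerBlDr lerDl -ker_wdiag ker_ge0.
apply: (cvgr_to_ge (cvg_amp Da)); exists k => // m /=; exact: lim_ge.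
Qed.

End CoverGraph.

(** * Continuity on subsets and connectedness *)

Lemma within_continuousP (S T : topologicalType) (A : set S) (g : S -> T) :
  {within A, continuous g} <-> forall t, A t -> forall O, nbhs (g t) O ->
    \forall t' \near t, A t' -> O (g t').
Proof.
rewrite (@subspace_continuousP S A T g); split=> h t At O; first exact: h.
exact: (h t At O).
Qed.

Lemma within_continuous_eq (S T : topologicalType) (A : set S) (f g : S -> T) :
  (forall t, A t -> f t = g t) ->
  {within A, continuous f} -> {within A, continuous g}.
Proof. by move=> fg; apply: subspace_eq_continuous => t /set_mem /fg. Qed.

Lemma within_continuous_comp (S T W : topologicalType) (A : set S) (B : set T)
    (f : S -> T) (g : T -> W) : (forall t, A t -> B (f t)) ->
  {within A, continuous f} -> {within B, continuous g} ->
  {within A, continuous (fun t => g (f t))}.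
Proof.
move=> AB /within_continuousP cf /within_continuousP cg.
apply/within_continuousP => t At O gO.
have := cf t At _ (cg _ (AB _ At) _ gO); apply: filterS => t' h At'.
by apply: h => //; exact: AB.
Qed.

Lemma connected_ind (S : topologicalType) (A P : set S) (t0 : S) : connected A ->
  A t0 -> P t0 ->
  (forall t, A t -> P t -> \forall t' \near t, A t' -> P t') ->
  (forall t, A t -> ~ P t -> \forall t' \near t, A t' -> ~ P t') ->
  A `<=` P.
Proof.
move=> cA At0 Pt0 hP hN.
have intE (Q : set S) : (forall t, A t -> Q t -> \forall t' \near t, A t' -> Q t') ->
    A `&` Q = A `&` interior [set t | A t -> Q t].
  move=> hQ; apply/seteqP; split=> t [At].
    by move=> Qt; split=> //; exact: hQ.
  by move=> /interior_subset/(_ At).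
have : A `&` P = A.
  apply: cA; first by exists t0.
    by exists (interior [set t | A t -> P t]); [exact: open_interior|exact: intE].
  exists (~` (interior [set t | A t -> (~` P) t])).
    by apply: open_closedC; exact: open_interior.
  have := intE (~` P) hN => e; apply/seteqP; split=> t [At Pt]; split=> //.
    by move=> h; have [_ nP] : (A `&` ~` P) t; [rewrite e|exact: nP].
  by apply: contrapT => nPt; apply: Pt; have : (A `&` ~` P) t by []; rewrite e => -[].
by move=> e t; rewrite -{1}e => -[].
Qed.

Lemma pairr_continuous (S T : topologicalType) (b : T) :
  continuous (fun s : S => (s, b)).
Proof.
move=> s W [[P Q] /= [sP tQ] PQ]; apply: filterS sP => s' Ps'.
by apply: PQ; split=> //=; exact: nbhs_singleton.
Qed.

Lemma pairl_continuous (S T : topologicalType) (a : S) :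
  continuous (fun t : T => (a, t)).
Proof.
move=> t W [[P Q] /= [sP tQ] PQ]; apply: filterS tQ => t' Qt'.
by apply: PQ; split=> //=; exact: nbhs_singleton.
Qed.

(** * Path lifting *)

Section Covering.
Context {R : realType} {Y X : metricType R} (f : Y -> X).

Definition evenly (U : set X) : Prop := open U /\ exists W, sheets f U W.

(** The union [w'] of the other copies is kept as an open set: it makes [w] open and closed in the
    preimage of [U], so that a connected set above [U] cannot leave its copy. *)
Definition sheet (U : set X) (w : set Y) : Prop :=
  [/\ open w, f @` w = U, (exists2 w', open w' & w `|` w' = f @^-1` U /\ w `&` w' = set0)
    & forall a b, w a -> w b -> mdist (f a) (f b) = mdist a b].

Lemma sheet_at U z : evenly U -> U (f z) -> exists2 w, sheet U w & w z.
Proof.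
move=> [oU [W [tW WU hW]]] Uz.
have : (\bigcup_(w in W) w) z by rewrite WU.
move=> [w Ww wz]; exists w => //; have [ow fw iw] := hW _ Ww.
split=> //; exists (\bigcup_(w' in W `\ w) w').
  by apply: bigcup_open => w' [/hW[]].
split.
  rewrite -WU; apply/seteqP; split=> q.
    by move=> [wq|[w' [Ww' _] wq]]; [exists w|exists w'].
  move=> [w' Ww' wq]; have [e|ne] := pselect (w' = w); first by left; rewrite -e.
  by right; exists w'.
apply/seteqP; split=> // q [wq [w' [Ww' ne] w'q]].
by apply: ne; apply: tW => //; exists q.
Qed.

Lemma sheet_inj U w : sheet U w -> forall a b, w a -> w b -> f a = f b -> a = b.
Proof.
move=> [_ _ _ iw] a b wa wb e; apply: mdist_positivity.
by rewrite -iw// e mdistxx.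
Qed.

Lemma sheet_connected (S : topologicalType) (A : set S) (g : S -> Y) U w t0 :
  connected A -> {within A, continuous g} -> sheet U w ->
  (forall t, A t -> U (f (g t))) -> A t0 -> w (g t0) -> forall t, A t -> w (g t).
Proof.
move=> cA /within_continuousP cg [ow fw [w' ow' [ww' wI]] _] AU At0 wt0.
apply: (@connected_ind S A [set t | w (g t)] t0 cA At0 wt0) => t At h.
  exact: (cg t At w (open_nbhs_nbhs (conj ow h))).
have w'g : w' (g t) by have [] : (w `|` w') (g t) by rewrite ww'; exact: AU.
apply: filterS (cg t At w' (open_nbhs_nbhs (conj ow' w'g))) => t' /[swap] At'.
by move=> /(_ At') w'q /= wq; have : (w `&` w') (g t') by []; rewrite wI.
Qed.

Hypothesis covf : covering f.

Lemma covering_continuous : continuous f. Proof. by case: covf. Qed.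

Lemma evenly_at x : exists2 U, evenly U & U x.
Proof.
case: covf => _ /(_ x)[U [W [oU Ux sh]]]; exists U => //.
by split=> //; exists W.
Qed.

Lemma lift_unique (S : topologicalType) (A : set S) (g h : S -> Y) t0 :
  connected A -> {within A, continuous g} -> {within A, continuous h} ->
  (forall t, A t -> f (g t) = f (h t)) -> A t0 -> g t0 = h t0 ->
  forall t, A t -> g t = h t.
Proof.
move=> cA /within_continuousP cg /within_continuousP ch fgh At0 e0.
apply: (@connected_ind S A [set t | g t = h t] t0 cA At0 e0) => t At h0.
  have [U eU Uz] := evenly_at (f (g t)).
  have [w sw wz] := sheet_at eU Uz.
  have ow : open w by case: sw.
  have n1 := cg _ At _ (open_nbhs_nbhs (conj ow wz)).
  have n2 : \forall t' \near t, A t' -> w (h t').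
    by apply: ch => //; apply: open_nbhs_nbhs; split=> //; rewrite -h0.
  near=> t' => At'; apply: (sheet_inj sw); last exact: fgh.
    by move: At'; near: t'.
  by move: At'; near: t'.
have [U eU Uz] := evenly_at (f (g t)).
have [w sw wz] := sheet_at eU Uz.
have [ow _ [w' ow' [ww' wI]] _] := sw.
have n1 := cg _ At _ (open_nbhs_nbhs (conj ow wz)).
have w'h : w' (h t).
  have : (w `|` w') (h t) by rewrite ww' /= -fgh.
  by move=> [wh|//]; case: h0; apply: (sheet_inj sw) => //; exact: fgh.
have n2 := ch _ At _ (open_nbhs_nbhs (conj ow' w'h)).
near=> t' => At' e; have : (w `&` w') (h t').
  split; last by move: At'; near: t'.
  by rewrite -e; move: At'; near: t'.
by rewrite wI.
Unshelve. all: by end_near. Qed.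

(** On [B] the new lift is [g] followed by the inverse of [f] on one sheet, chosen at [t0]. The
    overlap is connected, so [L] stays in that sheet there and the two pieces agree. *)
Lemma lift_extend (S : topologicalType) (A B : set S) (g : S -> X) (L : S -> Y)
    U t0 : closed A -> closed B -> evenly U ->
  {within A `|` B, continuous g} -> {within A, continuous L} ->
  (forall t, A t -> f (L t) = g t) -> (forall t, B t -> U (g t)) ->
  connected (A `&` B) -> A t0 -> B t0 ->
  exists L', [/\ {within A `|` B, continuous L'},
    forall t, A t \/ B t -> f (L' t) = g t & forall t, A t -> L' t = L t].
Proof.
move=> cA cB eU cg cL Lg BU cAB At0 Bt0.
have Ut0 : U (f (L t0)) by rewrite Lg//; exact: BU.
have [w sw wt0] := sheet_at eU Ut0.
have [ow fw _ iw] := sw.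
have wAB t : A t -> B t -> w (L t).
  move=> At Bt; apply: (@sheet_connected S (A `&` B) L U w t0) => //.
    by apply: continuous_subspaceW cL => ? [].
  by move=> t' [At' Bt']; rewrite Lg//; exact: BU.
pose sg p : Y := xget (L t0) [set q | w q /\ f q = p].
have sgP p : U p -> w (sg p) /\ f (sg p) = p.
  rewrite -fw => -[q wq fq]; rewrite /sg.
  by case: xgetP => [r -> []//|/(_ q) h]; exfalso; apply: h.
pose L' t := if t \in A then L t else sg (g t).
have L'A t : A t -> L' t = L t by move=> At; rewrite /L' mem_set.
have L'B t : B t -> L' t = sg (g t).
  move=> Bt; rewrite /L'; case: ifPn => // /set_mem At.
  have [w1 f1] := sgP _ (BU _ Bt).
  by apply: (sheet_inj sw) => //; [exact: wAB|rewrite f1 Lg].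
exists L'; split=> //; last first.
  move=> t [At|Bt]; first by rewrite L'A// Lg.
  by rewrite L'B//; have [] := sgP _ (BU _ Bt).
apply: withinU_continuous => //.
  by apply: within_continuous_eq cL => t At; rewrite L'A.
apply: (@within_continuous_eq _ _ _ (fun t => sg (g t))) => [t Bt|].
  by rewrite L'B.
have {}cg : {within B, continuous g} by apply: continuous_subspaceW cg => ? ?; right.
apply: (within_continuous_comp BU cg).
apply/within_continuousP => p Up O.
move=> /nbhs_ballP[e /= e0 eO]; apply/nbhs_ballP; exists e => //= p' pp' Up'.
apply: eO; rewrite ballEmdist /=; rewrite ballEmdist /= in pp'.
have [w1 f1] := sgP _ Up; have [w2 f2] := sgP _ Up'.
by rewrite -iw// f1 f2.
Qed.

(** Serves path lifting, with [K] a point, and homotopy lifting, with [K] a short interval. The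
    slices of height [1 / N] are attached one by one, and two consecutive pieces meet in a copy of
    [K], which is connected. *)
Lemma lift_strip (S : topologicalType) (K : set S) (k0 : S) (H : S * R -> X)
    (N : nat) (z : Y) : closed K -> connected K -> K k0 -> (0 < N)%N ->
  {within K `*` `[0, 1], continuous H} ->
  (forall j, (j < N)%N -> exists2 U, evenly U & forall s (t : R), K s ->
     j%:R / N%:R <= t <= j.+1%:R / N%:R -> U (H (s, t))) ->
  (forall s, K s -> H (s, 0) = f z) ->
  exists L : S * R -> Y, [/\ {within K `*` `[0, 1], continuous L},
    forall s (t : R), K s -> 0 <= t <= 1 -> f (L (s, t)) = H (s, t) &
    forall s, K s -> L (s, 0) = z].
Proof.
move=> clK cK Kk0 N0 cH hU Hz.
have N0' : (0 : R) < N%:R by rewrite ltr0n.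
suff main j : (j <= N)%N -> exists L : S * R -> Y,
  [/\ {within K `*` `[0, j%:R / N%:R], continuous L},
    forall s (t : R), K s -> 0 <= t <= j%:R / N%:R -> f (L (s, t)) = H (s, t) &
    forall s, K s -> L (s, 0) = z].
  by have := main N (leqnn N); rewrite divff// gt_eqF.
elim: j => [|j IH] jN.
  exists (fun=> z); split=> //.
    by apply: continuous_subspaceT => ?; exact: cvg_cst.
  by move=> s t Ks; rewrite mul0r -eq_le => /eqP<-; rewrite Hz.
have [L [cL fL L0]] := IH (ltnW jN).
have [U eU UH] := hU j jN.
have jj : j%:R / N%:R <= j.+1%:R / N%:R :> R by rewrite ler_pM2r ?invr_gt0// ler_nat.
have j0 : 0 <= j%:R / N%:R :> R by rewrite divr_ge0.
have j1 : j.+1%:R / N%:R <= 1 :> R by rewrite ler_pdivrMr// mul1r ler_nat.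
have AB : K `*` `[0, j%:R / N%:R] `|` K `*` `[j%:R / N%:R, j.+1%:R / N%:R]
    = K `*` `[0, j.+1%:R / N%:R] :> set (S * R).
  apply/seteqP; split=> -[s t] /=; rewrite !in_itv /=.
    by move=> [[Ks /andP[h1 h2]]|[Ks /andP[h1 h2]]]; split=> //; apply/andP; split; lra.
  move=> [Ks /andP[h1 h2]]; have [h|h] := leP t (j%:R / N%:R); [left|right].
    by split=> //; rewrite h1.
  by split=> //; rewrite (ltW h).
have clX (a b : R) : closed (K `*` `[a, b] : set (S * R)).
  rewrite -[_ `*` _]/(fst @^-1` K `&` snd @^-1` `[a, b]).
  apply: closedI; apply: closed_comp => //.
  - by move=> ? _; exact: cvg_fst.
  - by move=> ? _; exact: cvg_snd.
  - exact: interval_closed.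
have [||||||||L' [cL' fL' L'L]] := @lift_extend (S * R)%type (K `*` `[0, j%:R / N%:R])
   (K `*` `[j%:R / N%:R, j.+1%:R / N%:R]) H L U (k0, j%:R / N%:R) _ _ eU _ cL.
- exact: clX.
- exact: clX.
- rewrite AB; apply: continuous_subspaceW cH => -[s t] /= [Ks].
  rewrite !in_itv /= => /andP[h1 h2]; split=> //; apply/andP; split=> //; lra.
- by move=> [s t] [/= Ks]; rewrite in_itv /=; exact: fL.
- by move=> [s t] [/= Ks]; rewrite in_itv /=; exact: UH.
- rewrite (_ : _ `&` _ = (fun s => (s, j%:R / N%:R)) @` K); last first.
    apply/seteqP; split=> [[s t] /=|_ [s Ks <-] /=]; rewrite !in_itv /=.
      by move=> [[Ks /andP[_ h1]] [_ /andP[h2 _]]]; exists s => //; congr pair; lra.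
    by rewrite !lexx j0 jj.
  apply: connected_continuous_connected => //; exact/continuous_subspaceT/pairr_continuous.
- by rewrite /= in_itv /= lexx j0.
- by rewrite /= in_itv /= lexx jj.
exists L'; rewrite AB in cL'; split=> //.
  move=> s t Ks tj; apply: fL'.
  have : (K `*` `[0, j.+1%:R / N%:R]) (s, t) by split=> //=; rewrite in_itv.
  by rewrite -AB.
by move=> s Ks; rewrite L'L ?L0//; split=> //=; rewrite in_itv /= lexx j0.
Qed.

(** Lebesgue number argument on the compact square: [1 / N] is taken below a radius at which every
    ball of the square maps into an evenly covered set. *)
Lemma even_grid (H : R * R -> X) : {within `[0, 1] `*` `[0, 1], continuous H} ->
  exists2 N, (0 < N)%N & forall i j, (i < N)%N -> (j < N)%N ->
  exists2 U, evenly U & forall s t : R, i%:R / N%:R <= s <= i.+1%:R / N%:R ->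
     j%:R / N%:R <= t <= j.+1%:R / N%:R -> U (H (s, t)).
Proof.
move=> /within_continuousP cH; pose C : set (R * R) := `[0, 1] `*` `[0, 1].
have cC : compact C by apply: compact_setX; exact: segment_compact.
have : \forall r \near (0 : R)^'+, C `<=` [set p | exists2 U, evenly U &
    forall q, C q -> ball p r q -> U (H q)].
  move/compact_near_coveringP : cC; apply => p Cp.
  have [U eU Up] := evenly_at (H p).
  have := cH p Cp U (open_nbhs_nbhs (conj eU.1 Up)).
  move=> /nbhs_ballP[d /= d0 dU].
  exists (ball p (d / 2), [set r | r < d / 2]).
    split; first by apply: nbhsx_ballx; rewrite divr_gt0.
    by apply: nbhs_right_lt; rewrite divr_gt0.
  move=> [p' r] [/= pp' rd]; exists U => // q Cq p'q; apply: dU => //.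
  have -> : d = d / 2 + d / 2 by rewrite -splitr.
  by apply: ball_triangle pp' _; apply: le_ball p'q; exact: ltW.
move=> h; near (0 : R)^'+ => r.
have r0 : 0 < r by [].
have hr : C `<=` [set p | exists2 U, evenly U &
    forall q, C q -> ball p r q -> U (H q)] by near: r.
pose N := (Num.truncn (r^-1)).+1.
have N0 : (0 : R) < N%:R by rewrite ltr0n.
have Nr : N%:R^-1 < r.
  by rewrite invf_plt ?posrE//; apply: truncnS_gt.
exists N => // i j iN jN.
have inC k : (k < N)%N -> 0 <= k%:R / N%:R :> R /\ k.+1%:R / N%:R <= 1 :> R.
  by move=> kN; rewrite divr_ge0// ler_pdivrMr// mul1r ler_nat.
have kk k : k.+1%:R / N%:R = k%:R / N%:R + N%:R^-1 :> R.
  by rewrite -natr1 mulrDl mul1r.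
have [i0 i1] := inC i iN; have [j0 j1] := inC j jN.
have Nn : 0 < N%:R^-1 :> R by rewrite invr_gt0.
have [|U eU hU] := hr (i%:R / N%:R, j%:R / N%:R).
  rewrite kk in i1; rewrite kk in j1.
  by split; rewrite /= in_itv /=; apply/andP; split; lra.
exists U => // s t; rewrite kk in i1 *; rewrite kk in j1 * => /andP[s0 s1] /andP[t0 t1].
apply: hU.
  by split; rewrite /= in_itv /=; apply/andP; split; lra.
by split; rewrite /= /ball /= ltr_norml; apply/andP; split; lra.
Unshelve. all: by end_near. Qed.

End Covering.

Section Clamp.
Context {R : realType}.

Definition contI (X : topologicalType) (g : R -> X) : Prop :=
  {within (`[0, 1]%classic : set R), continuous g}.

Lemma contI_eq (X : topologicalType) (g h : R -> X) :
  (forall t : R, 0 <= t <= 1 -> g t = h t) -> contI g -> contI h.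
Proof. by move=> e; apply: within_continuous_eq => t /=; rewrite in_itv; exact: e. Qed.

Lemma contI_sub (X : topologicalType) (g : R -> X) : continuous g -> contI g.
Proof. exact: continuous_subspaceT. Qed.

(** Retraction of the line onto [[0, 1]]; composing with it replaces continuity on the interval by
    plain continuity. *)
Definition clamp (t : R) : R := Num.max 0 (Num.min t 1).

Lemma clamp_in t : `[(0 : R), 1]%classic (clamp t).
Proof. by rewrite /= in_itv /= /clamp le_max lexx /= ge_max ler01 ge_min lexx orbT. Qed.

Lemma clamp_id t : `[(0 : R), 1]%classic t -> clamp t = t.
Proof.
by rewrite /= in_itv /= => /andP[t0 t1]; rewrite /clamp min_l// max_r.
Qed.

Lemma clamp_continuous : continuous clamp.
Proof.
move=> t; rewrite /clamp; apply: (@continuous_max _ _ (fun=> 0) (fun t : R => Num.min t 1)).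
  exact: cvg_cst.
apply: (@continuous_min _ _ id (fun=> 1)); first exact: cvg_id.
exact: cvg_cst.
Qed.

Lemma continuous_clamp (X : topologicalType) (g : R -> X) :
  contI g -> continuous (fun t : R => g (clamp t)).
Proof.
move=> cg; apply/continuous_subspace_setT.
apply: (within_continuous_comp _ _ cg); first by move=> t _; exact: clamp_in.
by apply: continuous_subspaceT; exact: clamp_continuous.
Qed.

Lemma within_clamp_comp (X : topologicalType) (g : R -> X) (h : R -> R) :
  contI g -> continuous h ->
  (forall t : R, 0 <= t <= 1 -> 0 <= h t <= 1) ->
  contI (fun t : R => g (h t)).
Proof.
move=> cg ch h01; apply: (@within_continuous_comp R R X _ `[0, 1]%classic h g) => //.
exact: continuous_subspaceT.
Qed.

Lemma loop_mul_continuous (X : metricType R) (g h : R -> X) :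
  contI g -> contI h ->
  g 1 = h 0 -> contI (loop_mul g h).
Proof.
move=> /continuous_clamp cg /continuous_clamp ch e.
rewrite /contI.
have -> : `[(0 : R), 1]%classic = `[0, 2^-1]%classic `|` `[2^-1, 1]%classic :> set R.
  apply/seteqP; split=> t /=; rewrite !in_itv /=.
    by move=> /andP[t0 t1]; have [h2|h2] := leP t 2^-1; [left|right]; apply/andP; split=> //; lra.
  by move=> [/andP[t0 t1]|/andP[t0 t1]]; apply/andP; split; lra.
have cl (a b : R) : continuous (fun t : R => a * t + b).
  by move=> t; apply: cvgD; [apply: cvgMr; exact: cvg_id|exact: cvg_cst].
apply: withinU_continuous; [exact: interval_closed..| |].
  apply: (@within_continuous_eq R X _ (fun t : R => g (clamp (2 * t + 0)))).
    move=> t /=; rewrite in_itv /= /loop_mul addr0 => /andP[t0 t1]; rewrite t1 clamp_id//=.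
    by rewrite in_itv /=; apply/andP; split; lra.
  apply: continuous_subspaceT => t.
  exact: (continuous_comp (cl 2 0 t) (cg _)).
apply: (@within_continuous_eq R X _ (fun t : R => h (clamp (2 * t + (-1))))).
  move=> t /=; rewrite in_itv /= /loop_mul => /andP[t0 t1]; rewrite clamp_id; last first.
    by rewrite /= in_itv /=; apply/andP; split; lra.
  case: ifPn => // t2; have -> : t = 2^-1 by lra.
  by rewrite mulfV// subrr -e.
apply: continuous_subspaceT => t.
exact: (continuous_comp (cl 2 (-1) t) (ch _)).
Qed.

End Clamp.

(** * Lifts of paths and the fundamental group *)

Section PathLifting.
Context {R : realType} {Y X : metricType R} (f : Y -> X).

Definition lifts (g : R -> X) (z z' : Y) : Prop := exists h : R -> Y,
  [/\ contI h, forall t : R, 0 <= t <= 1 -> f (h t) = g t,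
      h 0 = z & h 1 = z'].

Lemma lifts_eq g g' z z' : (forall t : R, 0 <= t <= 1 -> g t = g' t) ->
  lifts g z z' -> lifts g' z z'.
Proof.
by move=> e [h [ch fh h0 h1]]; exists h; split=> // t t01; rewrite fh// e.
Qed.

Lemma lifts_mul g h z z' z'' : lifts g z z' -> lifts h z' z'' ->
  lifts (loop_mul g h) z z''.
Proof.
move=> [a [ca fa a0 a1]] [b [cb fb b0 b1]]; exists (loop_mul a b); split.
- by apply: loop_mul_continuous => //; rewrite a1 b0.
- move=> t /andP[t0 t1]; rewrite /loop_mul; case: ifPn => t2.
    by rewrite fa//; apply/andP; split; lra.
  by rewrite fb//; apply/andP; split; lra.
- by rewrite /loop_mul invr_ge0 ler0n mulr0.
- rewrite /loop_mul ifF; last by apply/negbTE; rewrite -ltNge; lra.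
  by have -> : 2 * 1 - 1 = 1 :> R by ring.
Qed.

Lemma lifts_inv g z z' : lifts g z z' -> lifts (loop_inv g) z' z.
Proof.
move=> [a [ca fa a0 a1]]; exists (loop_inv a); rewrite /loop_inv; split.
- apply: within_clamp_comp => //.
    by move=> t; apply: cvgB; [exact: cvg_cst|exact: cvg_id].
  by move=> t /andP[t0 t1]; apply/andP; split; lra.
- by move=> t /andP[t0 t1]; rewrite fa//; apply/andP; split; lra.
- by rewrite subr0.
- by rewrite subrr.
Qed.

Hypothesis covf : covering f.

Lemma lifts_unique g z z1 z2 : lifts g z z1 -> lifts g z z2 -> z1 = z2.
Proof.
move=> [a [ca fa a0 <-]] [b [cb fb b0 <-]].
apply: (@lift_unique _ _ _ _ covf R `[0, 1]%classic a b 0) => //.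
- exact: segment_connected.
- by move=> t /=; rewrite in_itv => t01; rewrite fa// fb.
- by rewrite /= in_itv /= lexx ler01.
- by rewrite a0.
- by rewrite /= in_itv /= lexx ler01.
Qed.

Lemma lift_path g z : contI g -> f z = g 0 ->
  exists h, [/\ contI h, forall t : R, 0 <= t <= 1 -> f (h t) = g t & h 0 = z].
Proof.
move=> cg fz; pose H (p : R * R) := g p.2.
have cH : {within `[0, 1] `*` `[0, 1], continuous H}.
  apply: (@within_continuous_comp (R * R)%type R X _ `[0, 1]%classic snd g _ _ cg).
    by move=> [s t] [].
  by apply: continuous_subspaceT => p; exact: cvg_snd.
have [N N0 hN] := even_grid covf cH.
have cH0 : {within [set 0] `*` `[0, 1], continuous H}.
  apply: continuous_subspaceW cH => -[s t] [/= -> t01]; split=> //=.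
  by rewrite in_itv /= lexx ler01.
have K0 : [set (0 : R)] 0 by [].
have cl0 : closed [set (0 : R)] by exact: closed_eq.
have [||L [cL fL L0]] := @lift_strip _ _ _ f R [set 0] 0 H N z cl0
  (@connected1 _ _) K0 N0 cH0.
- move=> j jN; have [U eU hU] := hN 0%N j N0 jN; exists U => // s t -> tj.
  by apply: hU => //; rewrite mul0r lexx divr_ge0.
- by move=> s _; rewrite fz.
exists (fun t => L (0, t)); split.
- apply: (@within_continuous_comp R (R * R)%type Y _ ([set 0] `*` `[0, 1]) (fun t => (0, t)) L) => //.
  exact/continuous_subspaceT/pairl_continuous.
- by move=> t t01; rewrite fL.
- by rewrite L0.
Qed.

Lemma lifts_exists g z : contI g -> f z = g 0 -> exists z', lifts g z z'.
Proof. by move=> cg fz; have [h [ch fh h0]] := lift_path cg fz; exists (h 1), h. Qed.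

(** The homotopy is crossed in thin strips. Within a strip the end of the lift moves continuously
    above the fixed point [g 1], hence is constant by uniqueness of lifts. *)
Lemma lifts_homotopic g g' z z' : homotopic g g' -> lifts g z z' -> lifts g' z z'.
Proof.
move=> [H [cH Hg He]] lg.
have [N N0 hN] := even_grid covf cH.
have N0' : (0 : R) < N%:R by rewrite ltr0n.
have I0 : (0 : R) \in `[0, 1] by rewrite in_itv /= lexx ler01.
have I1 : (1 : R) \in `[0, 1] by rewrite in_itv /= lexx ler01.
have inI (t : R) : 0 <= t <= 1 -> t \in `[0, 1] by rewrite in_itv.
have lgz : f z = g 0 /\ f z' = g 1.
  by move: lg => [h [_ fh <- <-]]; rewrite !fh// ?lexx ?ler01.
suff main i : (i <= N)%N -> lifts (fun t => H (i%:R / N%:R, t)) z z'.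
  have := main N (leqnn N); rewrite divff ?gt_eqF//.
  by apply: lifts_eq => t /inI /Hg[].
elim: i => [|i IH] iN.
  by apply: lifts_eq lg => t /inI /Hg[]; rewrite mul0r.
have {IH} li := IH (ltnW iN).
set a := i%:R / N%:R in li *; set b := i.+1%:R / N%:R.
have ab : a <= b by rewrite ler_pM2r ?invr_gt0// ler_nat.
have a0 : 0 <= a by rewrite divr_ge0.
have b1 : b <= 1 by rewrite ler_pdivrMr// mul1r ler_nat.
have Ka : `[a, b]%classic a by rewrite /= in_itv /= lexx ab.
have Kb : `[a, b]%classic b by rewrite /= in_itv /= lexx ab.
have KI s : `[a, b]%classic s -> s \in `[0, 1].
  by rewrite /= !in_itv /= => /andP[s1 s2]; apply/andP; split; lra.
have cHK : {within `[a, b] `*` `[0, 1], continuous H}.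
  by apply: continuous_subspaceW cH => -[s t] [/= /KI].
have [||L [cL fL L0]] := @lift_strip _ _ _ f R `[a, b]%classic a H N z
  (@interval_closed R (BLeft a) (BRight b) isT isT) (@segment_connected R a b) Ka N0 cHK.
- move=> j jN; have [U eU hU] := hN i j iN jN.
  by exists U => // s t sK; apply: hU; move: sK; rewrite /= in_itv.
- by move=> s /KI /He[-> _]; have [] := lgz.
have cpt : {within `[a, b]%classic, continuous (fun s : R => L (s, 1))}.
  apply: (@within_continuous_comp R (R * R)%type Y _ (`[a, b] `*` `[0, 1]) (fun s => (s, 1)) L) => //.
  exact/continuous_subspaceT/pairr_continuous.
have cs s : `[a, b]%classic s -> lifts (fun t => H (s, t)) z (L (s, 1)).
  move=> sK; exists (fun t => L (s, t)); split=> //; last by rewrite L0.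
    apply: (@within_continuous_comp R (R * R)%type Y _ (`[a, b] `*` `[0, 1]) (fun t => (s, t)) L) => //.
    exact/continuous_subspaceT/pairl_continuous.
  by move=> t t01; rewrite fL.
have La : L (a, 1) = z' by apply: lifts_unique (cs a Ka) li.
have : L (b, 1) = z'.
  apply: (@lift_unique _ _ _ _ covf R `[a, b]%classic (fun s => L (s, 1)) (fun=> z') a) => //.
  - exact: segment_connected.
  - by apply: continuous_subspaceT => ?; exact: cvg_cst.
  - move=> s sK; rewrite fL ?lexx ?ler01//; have [_ ->] := He s (KI s sK).
    by have [_ ->] := lgz.
by move=> <-; exact: cs.
Qed.

Lemma homotopic_refl (g : R -> X) : contI g -> homotopic g g.
Proof.
move=> cg; exists (fun p => g p.2); split=> //.
apply: (@within_continuous_comp (R * R)%type R X _ `[0, 1]%classic snd g _ _ cg).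
  by move=> [s t] [].
by apply: continuous_subspaceT => p; exact: cvg_snd.
Qed.

Lemma homotopic_eq (g g' h : R -> X) : (forall t : R, 0 <= t <= 1 -> g t = g' t) ->
  homotopic g h -> homotopic g' h.
Proof.
move=> e [H [cH Hg He]]; exists H; split=> // t tI.
  by have [-> ->] := Hg t tI; rewrite e//; move: tI; rewrite in_itv.
by have [-> ->] := He t tI; rewrite !e// lexx ler01.
Qed.

Lemma pi1_image_lifts (g : R -> X) z : loops (f z) g ->
  pi1_image f z (pi1_class (f z) g) <-> lifts g z z.
Proof.
move=> [cg g0 g1 _]; split.
  move=> [k [ck k0 k1 _] e].
  have lk : lifts (f \o k) z z by exists k.
  apply: lifts_homotopic lk.
  have : pi1_class (f z) g g.
    by split; [split|exact: homotopic_refl].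
  by rewrite -e => -[].
move=> [k [ck fk k0 k1]]; exists k; first by split.
apply/seteqP; split=> h [lh hh]; split=> //; apply: homotopic_eq hh => t t01 /=.
  by rewrite fk.
by rewrite /= fk.
Qed.

Lemma lifts_start g z z' : lifts g z z' -> g 0 = f z.
Proof. by move=> [h [_ fh <- _]]; rewrite fh// lexx ler01. Qed.

Lemma lifts_end g z z' : lifts g z z' -> g 1 = f z'.
Proof. by move=> [h [_ fh _ <-]]; rewrite fh// lexx ler01. Qed.

Lemma lifts_contI g z z' : lifts g z z' -> contI g.
Proof.
move=> [h [ch fh _ _]]; apply: (@contI_eq _ _ (fun t => f (h t))) => //.
apply: (@within_continuous_comp R Y X _ setT h f) => //.
exact/continuous_subspaceT/covering_continuous.
Qed.

Lemma loops_lifts g z z' : lifts g z z' -> f z' = f z -> loops (f z) g.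
Proof.
move=> l e; split=> //; first exact: lifts_contI l.
  exact: lifts_start l.
by rewrite (lifts_end l).
Qed.

Hypothesis normf : forall y, pi1_normal (f y) (pi1_image f y).

(** The path [k] projects to a loop. By normality, conjugating [g] by it gives a loop which also
    lifts to a closed path at [z]; this lift runs along [k] to [z'], then along [g] to some [z1],
    then back along a lift of the reversed loop. Uniqueness of the lift of that loop forces
    [z1 = z']. *)
Lemma lifts_normal g z z' : (exists k : R -> Y, [/\ contI k, k 0 = z & k 1 = z']) ->
  f z = f z' -> lifts g z z -> lifts g z' z'.
Proof.
move=> [k [ck k0 k1]] e lg.
have lk : lifts (f \o k) z z' by exists k.
have lpg := loops_lifts lg erefl.
have lpk := loops_lifts lk (esym e).
have := normf lpg lpk; move/(_ ((pi1_image_lifts lpg).2 lg)).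
have [z1 l1] : exists z1, lifts g z' z1.
  by apply: lifts_exists; [exact: lifts_contI lg|rewrite -e (lifts_start lg)].
have fz1 : f z1 = f z by rewrite -(lifts_end l1) (lifts_end lg).
have [z2 l2] : exists z2, lifts (loop_inv (f \o k)) z1 z2.
  have li := lifts_inv lk.
  by apply: lifts_exists; [exact: lifts_contI li|rewrite (lifts_start li) fz1 -e].
have lm := lifts_mul (lifts_mul lk l1) l2.
have fz2 : f z2 = f z.
  by rewrite -(lifts_end l2) -(lifts_start lk) /loop_inv subrr.
have lpm := loops_lifts lm fz2.
move=> /(pi1_image_lifts lpm) lm'.
have e2 := lifts_unique lm lm'; subst z2.
have := lifts_inv l2; rewrite /loop_inv => l2'.
suff : z' = z1 by move=> {2}->.
apply: (lifts_unique lk); apply: lifts_eq l2' => t _.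
by rewrite opprB addrCA subrr addr0.
Qed.

End PathLifting.

(** * Path metric and oriented edges *)

Section PathMetric.
Context {R : realType} {X : metricType R}.

Lemma continuous_lipschitz (A : set R) (g : R -> X) :
  (forall s t : R, A s -> A t -> mdist (g s) (g t) <= `|s - t|) ->
  {within A, continuous g}.
Proof.
move=> h; apply/within_continuousP => t At O /nbhs_ballP[e /= e0 eO].
apply/nbhs_ballP; exists e => //= t' tt' At'; apply: eO; rewrite ballEmdist /=.
exact: le_lt_trans (h _ _ At At') tt'.
Qed.

Lemma mdist_path_dist (A : set X) (x y : X) : ((mdist x y)%:E <= path_dist A x y)%E.
Proof.
apply: le_ereal_inf_tmp => _ [g [_ g0 g1 _] <-].
apply: ereal_sup_ubound; exists [:: 1]; first by apply: itv_partition1; exact: ltr01.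
by rewrite /= big_nat1 /= g0 g1.
Qed.

Lemma path_length_le (g : R -> X) (k : R) : 
  (forall s t : R, 0 <= s <= 1 -> 0 <= t <= 1 -> mdist (g s) (g t) <= k * `|s - t|) ->
  (path_length g <= k%:E)%E.
Proof.
move=> h; apply: ge_ereal_sup => _ [s [ps /eqP ls] <-]; rewrite lee_fin.
suff main : forall (r : seq R) (a : R), 0 <= a -> path <%O a r -> last a r = 1 ->
    \sum_(0 <= i < size r) mdist (g (nth 1 (a :: r) i)) (g (nth 1 (a :: r) i.+1))
      <= k * (1 - a).
  by apply: le_trans (main s 0 (lexx _) ps ls) _; rewrite subr0 mulr1.
elim=> [|x r IH] a a0 /=; first by move=> _ ->; rewrite big_nil subrr mulr0.
move=> /andP[ax pr] lr; rewrite big_nat_recl//=.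
have x0 : 0 <= x by lra.
have x1 : x <= 1.
  have : itv_partition x 1 r by split=> //; apply/eqP.
  by move/itv_partition_le.
have -> : k * (1 - a) = k * (x - a) + k * (1 - x) by ring.
apply: lerD; last exact: IH.
have -> : x - a = `|a - x| by rewrite distrC ger0_norm// subr_ge0 ltW.
by apply: h; apply/andP; split; lra.
Qed.

(** Compactness of [[0, 1]] makes a property known near the diagonal hold at one uniform scale;
    regular subdivisions finer than this scale then globalize local metric estimates. *)
Lemma uniform_scale (P : R -> R -> Prop) :
  (forall t0 : R, 0 <= t0 <= 1 -> \forall p \near (t0, t0), 0 <= p.1 <= 1 ->
     0 <= p.2 <= 1 -> P p.1 p.2) ->
  exists2 r : R, 0 < r & forall t t', 0 <= t <= 1 -> 0 <= t' <= 1 -> `|t - t'| < r -> P t t'.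
Proof.
move=> h.
have : \forall r \near (0 : R)^'+, `[(0 : R), 1]%classic `<=` [set t | forall t' : R,
    0 <= t <= 1 -> 0 <= t' <= 1 -> `|t - t'| < r -> P t t'].
  have /compact_near_coveringP := @segment_compact R 0 1; apply => t0 /=.
  rewrite in_itv /= => t01.
  have /nbhs_ballP[d /= d0 dP] := h t0 t01.
  exists (ball t0 (d / 2), [set r | r < d / 2]).
    split; first by apply: nbhsx_ballx; rewrite divr_gt0.
    by apply: nbhs_right_lt; rewrite divr_gt0.
  move=> [t r] [/= tt rd] t' tI t'I ttr; apply: (dP (t, t')) => //; split=> /=.
    by apply: le_ball tt; rewrite ler_pdivrMr// ler_pMr// ler1n.
  have -> : d = d / 2 + d / 2 by rewrite -splitr.
  by apply: ball_triangle tt _; apply: lt_trans rd.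
move=> hr; have [r [{}hr /= r0]] := filter_ex (filterI hr (nbhs_right_gt 0)).
by exists r => // t t' tI; apply: hr => //=; rewrite in_itv.
Qed.

Lemma lipschitz_local (g : R -> X) (k : R) :
  (forall t0 : R, 0 <= t0 <= 1 -> \forall p \near (t0, t0), 0 <= p.1 <= 1 ->
     0 <= p.2 <= 1 -> mdist (g p.1) (g p.2) <= k * `|p.1 - p.2|) ->
  mdist (g 0) (g 1) <= k.
Proof.
move=> /(@uniform_scale (fun s t => mdist (g s) (g t) <= k * `|s - t|))[r r0 hr].
pose N := (Num.truncn (r^-1)).+1.
have N0 : (0 : R) < N%:R by rewrite ltr0n.
have Nr : N%:R^-1 < r by rewrite invf_plt ?posrE//; apply: truncnS_gt.
have inI n : (n <= N)%N -> 0 <= (n%:R / N%:R : R) <= 1.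
  by move=> nN; rewrite divr_ge0// ler_pdivrMr// mul1r ler_nat.
suff main n : (n <= N)%N -> mdist (g 0) (g (n%:R / N%:R)) <= k * (n%:R / N%:R).
  by have := main N (leqnn N); rewrite divff ?gt_eqF// mulr1.
elim: n => [|n IH] nN; first by rewrite mul0r mdistxx mulr0.
apply: le_trans (metric_triangle _ (g (n%:R / N%:R)) _) _.
have d : n.+1%:R / N%:R = n%:R / N%:R + N%:R^-1 :> R by rewrite -natr1 mulrDl mul1r.
rewrite {2}d mulrDr; apply: lerD; first exact/IH/ltnW.
have e : `|n%:R / N%:R - n.+1%:R / N%:R| = N%:R^-1 :> R.
  by rewrite d opprD addrA subrr sub0r normrN gtr0_norm// invr_gt0.
rewrite -[X in k * X]e; apply: hr; [exact/inI/ltnW|exact: inI|by rewrite e].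
Qed.

(* A path joins the coordinates of its ends, so at some scale the sum of the
   distances along a regular subdivision dominates their difference. *)
Lemma path_length_ge (g : R -> X) (th : R -> R) :
  (forall t0 : R, 0 <= t0 <= 1 -> \forall p \near (t0, t0), 0 <= p.1 <= 1 ->
     0 <= p.2 <= 1 -> `|th p.1 - th p.2| <= mdist (g p.1) (g p.2)) ->
  (`|th 0 - th 1|%:E <= path_length g)%E.
Proof.
move=> /(@uniform_scale (fun s t => `|th s - th t| <= mdist (g s) (g t)))[r r0 hr].
pose e (x y : R) := [&& x < y, y - x < r, 0 <= x & y <= 1].
pose N := (Num.truncn (r^-1)).+1.
have N0 : (0 : R) < N%:R by rewrite ltr0n.
have Nr : N%:R^-1 < r by rewrite invf_plt ?posrE//; apply: truncnS_gt.
have pe : forall n m, (m + n <= N)%N ->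
    path e (m%:R / N%:R) [seq i%:R / N%:R | i <- iota m.+1 n].
  elim=> [//|n IH] m; rewrite addnS -addSn => mn /=; rewrite IH// andbT /e.
  have -> : m.+1%:R / N%:R - m%:R / N%:R = N%:R^-1 :> R by rewrite -mulrBl -natrB// subSnn mul1r.
  rewrite Nr ltr_pM2r ?invr_gt0// ltr_nat ltnSn divr_ge0//= ler_pdivrMr// mul1r ler_nat.
  exact: leq_trans (leq_addr _ _) mn.
have {}pe := pe N 0%N (leqnn _); rewrite mul0r in pe.
set s := map _ _ in pe.
have ls : last 0 s = 1.
  have li : forall n m, last m (iota m.+1 n) = (m + n)%N.
    by elim=> [|n IH] m; rewrite ?addn0//= IH addSnnS.
  rewrite -[0](mul0r (N%:R^-1)) /s (last_map (fun i => i%:R / N%:R) _ 0%N) li.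
  by rewrite divff// gt_eqF.
have main : forall (s : seq R) (x : R), path e x s ->
    `|th x - th (last x s)| <=
    \sum_(0 <= i < size s) mdist (g (nth 1 (x :: s) i)) (g (nth 1 (x :: s) i.+1)).
  elim=> [|y s' IH] x /=; first by rewrite big_nil subrr normr0.
  move=> /andP[/and4P[xy xyr x0 y1] /IH h']; rewrite big_nat_recl//=.
  have -> : th x - th (last y s') = (th x - th y) + (th y - th (last y s')) by ring.
  apply: le_trans (ler_normD _ _) _; apply: lerD => //.
  have x01 : 0 <= x <= 1 by apply/andP; split; lra.
  apply: hr => //; first by apply/andP; split; lra.
  by rewrite distrC gtr0_norm ?subr_gt0.
apply: (@le_trans _ _ (\sum_(0 <= i < size s)
   mdist (g (nth 1 (0 :: s) i)) (g (nth 1 (0 :: s) i.+1)))%:E).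
  by rewrite lee_fin -{1}ls; exact: main.
apply: ereal_sup_ubound; exists s => //; split; last exact/eqP.
by apply: sub_path pe => x y /and4P[].
Qed.

Lemma itv_param_injE (e : set X) l (g : R -> X) : itv_param e l g ->
  forall s t, 0 < s < l -> 0 < t < l -> path_dist e (g s) (g t) = `|s - t|%:E.
Proof. by move=> [_ h] s t ss tt; apply: h; rewrite in_itv. Qed.

Lemma itv_param_inj (e : set X) l (g : R -> X) : itv_param e l g ->
  forall s t, 0 < s < l -> 0 < t < l -> g s = g t -> s = t.
Proof.
move=> ge s t sl tl st; have := itv_param_injE ge sl tl.
rewrite -st (itv_param_injE ge sl sl) subrr normr0 => -[/esym/eqP].
by rewrite normr_eq0 subr_eq0 => /eqP.
Qed.

Lemma itv_param_lip (e : set X) l (g : R -> X) : itv_param e l g ->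
  forall s t, 0 < s < l -> 0 < t < l -> mdist (g s) (g t) <= `|s - t|.
Proof.
move=> ge s t sl tl; rewrite -lee_fin -(itv_param_injE ge sl tl).
exact: mdist_path_dist.
Qed.

Lemma itv_param_in (e : set X) l (g : R -> X) : itv_param e l g ->
  forall s, 0 < s < l -> e (g s).
Proof. by move=> [<- _] s sl; exists s => //=; rewrite in_itv. Qed.

Lemma itv_param_ex (e : set X) l (g : R -> X) : itv_param e l g ->
  forall p, e p -> exists2 s, 0 < s < l & g s = p.
Proof. by move=> [<- _] p [s /=]; rewrite in_itv /= => sl <-; exists s. Qed.

(** Every difference is preserved up to sign. Comparison with the two points [l / 2] and [l / 4]
    forces a single sign, and the range condition together with surjectivity then excludes any
    translation. *)
Lemma itv_isometry (l l' : R) (phi : R -> R) : 0 < l -> 0 < l' ->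
  (forall s, 0 < s < l -> 0 < phi s < l') ->
  (forall s t, 0 < s < l -> 0 < t < l -> `|phi s - phi t| = `|s - t|) ->
  (forall u, 0 < u < l' -> exists2 s, 0 < s < l & phi s = u) ->
  l = l' /\ ((forall s, 0 < s < l -> phi s = s) \/ (forall s, 0 < s < l -> phi s = l - s)).
Proof.
move=> l0 l0' hr hi hs.
have D s t : 0 < s < l -> 0 < t < l -> phi s - phi t = s - t \/ phi s - phi t = t - s.
  move=> hs' ht; have := hi s t hs' ht.
  case: (lerP 0 (phi s - phi t)) => a; case: (lerP 0 (s - t)) => b.
  - by rewrite (ger0_norm a) (ger0_norm b) => ->; left.
  - by rewrite (ger0_norm a) (ltr0_norm b) => ->; right; ring.
  - by rewrite (ltr0_norm a) (ger0_norm b) => h; right; lra.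
  - by rewrite (ltr0_norm a) (ltr0_norm b) => h; left; lra.
have m0 : 0 < l / 2 < l by apply/andP; split; lra.
have orient : (forall s, 0 < s < l -> phi s = phi (l / 2) + (s - l / 2)) \/
    (forall s, 0 < s < l -> phi s = phi (l / 2) - (s - l / 2)).
  have q0 : 0 < l / 4 < l by apply/andP; split; lra.
  have [hq|hq] := D _ _ q0 m0; [left|right] => s sl.
    by have [h1|h1] := D _ _ sl m0; have [h2|h2] := D _ _ sl q0; lra.
  by have [h1|h1] := D _ _ sl m0; have [h2|h2] := D _ _ sl q0; lra.
case: orient => [h|h].
  set b := phi (l / 2) - l / 2.
  have {}h s : 0 < s < l -> phi s = s + b by move=> /h ->; rewrite /b; ring.
  have b0 : b = 0.
    apply/eqP; rewrite eq_le; apply/andP; split; rewrite leNgt; apply/negP => bb.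
      have [c|c] := ltP b l'.
        by have [|s /[dup] sl /h ->] := hs b; [rewrite bb|move: sl => /andP[]; lra].
      have [|s /[dup] sl /h ->] := hs (l' / 2); first by apply/andP; split; lra.
      by move: sl => /andP[]; lra.
    have [c|c] := ltP (- b) l.
      have sl : 0 < - b < l by apply/andP; split; lra.
      by have := hr _ sl; rewrite h// => /andP[]; lra.
    by have := hr _ m0; rewrite h// => /andP[]; lra.
  split; last by left => s sl; rewrite h// b0 addr0.
  apply/eqP; rewrite eq_le; apply/andP; split; rewrite leNgt; apply/negP => c.
    have sl : 0 < l' < l by rewrite l0'.
    by have := hr _ sl; rewrite h// => /andP[]; lra.
  have [|s /[dup] sl /h ->] := hs l; first by rewrite l0.
  by move: sl => /andP[]; lra.
set b := phi (l / 2) + l / 2.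
have {}h s : 0 < s < l -> phi s = b - s by move=> /h ->; rewrite /b; ring.
have b0 : b = l.
  apply/eqP; rewrite eq_le; apply/andP; split; rewrite leNgt; apply/negP => bb.
    have [c|c] := ltP (b - l) l'.
      have [|s /[dup] sl /h ->] := hs (b - l); first by apply/andP; split; lra.
      by move: sl => /andP[]; lra.
    have [|s /[dup] sl /h ->] := hs (l' / 2); first by apply/andP; split; lra.
    by move: sl => /andP[]; lra.
  have [c|c] := ltP 0 b.
    have sl : 0 < b < l by apply/andP; split; lra.
    by have := hr _ sl; rewrite h// => /andP[]; lra.
  by have := hr _ m0; rewrite h// => /andP[]; lra.
split; last by right => s sl; rewrite h// b0.
apply/eqP; rewrite eq_le; apply/andP; split; rewrite leNgt; apply/negP => c.
  have sl : 0 < l - l' < l by apply/andP; split; lra.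
  by have := hr _ sl; rewrite h// => /andP[]; lra.
have [|s /[dup] sl /h ->] := hs l; first by rewrite l0.
by move: sl => /andP[]; lra.
Qed.

End PathMetric.

Section OrientedArcs.
Context {R : realType} {X : metricType R}.
Implicit Types (V : set X) (a b : oarc X).

Lemma oarc_eq a b : len a = len b -> (forall t, arc a t = arc b t) -> a = b.
Proof. by case: a b => [l g] [l' g'] /= -> e; congr Oarc; exact/funext. Qed.

Lemma revK a : rev (rev a) = a.
Proof. by apply: oarc_eq => //= t; rewrite opprB addrCA subrr addr0. Qed.

Lemma source_rev a : source (rev a) = target a.
Proof. by rewrite /source /target /= subr0. Qed.

Lemma target_rev a : target (rev a) = source a.
Proof. by rewrite -{2}(revK a) source_rev. Qed.

Lemma supportP a p : support a p <-> exists2 t, 0 < t < len a & arc a t = p.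
Proof.
by split=> [[t /=]|[t tl <-]]; [rewrite in_itv /= => tl <-; exists t|exists t => //=; rewrite in_itv].
Qed.

Lemma support_rev a : support (rev a) = support a.
Proof.
apply/seteqP; split=> p /supportP[t /andP[t0 tl] <-]; apply/supportP.
  by exists (len a - t) => //; apply/andP; move: tl; rewrite /=; split; lra.
exists (len a - t); first by apply/andP; split=> /=; lra.
by rewrite /= opprB addrCA subrr addr0.
Qed.

Section OE.
Variables (V : set X) (a : oarc X).
Hypothesis OEa : oriented_edges V a.

Lemma oe_edge : edges V (support a). Proof. by case: OEa. Qed.
Lemma oe_len : 0 < len a. Proof. by case: OEa. Qed.
Lemma oe_param : itv_param (support a) (len a) (arc a). Proof. by case: OEa. Qed.
Lemma oe_cont : continuous (arc a). Proof. by case: OEa. Qed.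
Lemma oe_le0 t : t <= 0 -> arc a t = source a.
Proof. by case: OEa => _ _ _ _ [h _]; exact: h. Qed.
Lemma oe_gel t : len a <= t -> arc a t = target a.
Proof. by case: OEa => _ _ _ _ [_ h]; exact: h. Qed.

Lemma oe_rev : oriented_edges V (rev a).
Proof.
split.
- by rewrite support_rev; exact: oe_edge.
- exact: oe_len.
- rewrite support_rev; split; first by rewrite -(support_rev a).
  move=> s t; rewrite !in_itv /= => /andP[s0 sl] /andP[t0 tl].
  rewrite (itv_param_injE oe_param); try by apply/andP; split; lra.
  by congr (_%:E); rewrite distrC; congr (`| _ |); ring.
- move=> t; apply: (@continuous_comp _ _ _ (fun t => len a - t) (arc a)).
    by apply: cvgB; [exact: cvg_cst|exact: cvg_id].
  exact: oe_cont.
- rewrite source_rev target_rev; split=> t ht /=.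
    by apply: oe_gel; lra.
  by apply: oe_le0; move: ht => /=; lra.
Qed.

Lemma oe_rev_neq : rev a != a.
Proof.
have l0 := oe_len; apply/eqP => e.
have h1 : 0 < len a / 3 < len a by apply/andP; split; lra.
have h2 : 0 < len a - len a / 3 < len a by apply/andP; split; lra.
have : arc (rev a) (len a / 3) = arc a (len a / 3) by rewrite e.
by move=> /= /(itv_param_inj oe_param h2 h1); lra.
Qed.

Lemma oe_inj s t : 0 < s < len a -> 0 < t < len a -> arc a s = arc a t -> s = t.
Proof. exact: itv_param_inj oe_param s t. Qed.

Lemma oe_notV t : 0 < t < len a -> ~ V (arc a t).
Proof.
move=> tl; have [p Vp e] := oe_edge.
have : support a (arc a t) by apply/supportP; exists t.
by rewrite -e => /connected_component_sub.
Qed.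

End OE.

Lemma continuous_itv_ext (l : R) (h1 h2 : R -> X) : 0 < l ->
  continuous h1 -> continuous h2 ->
  (forall t, 0 < t < l -> h1 t = h2 t) -> h1 0 = h2 0 /\ h1 l = h2 l.
Proof.
move=> l0 c1 c2 e; split.
  have f1 : h1 @ 0^'+ --> h1 0 by apply: cvg_at_right_filter; exact: c1.
  have f2 : h2 @ 0^'+ --> h2 0 by apply: cvg_at_right_filter; exact: c2.
  apply: (cvg_unique _ f1); first exact: metric_hausdorff.
  apply: cvg_trans f2; apply: near_eq_cvg; near=> t.
  by rewrite e//; apply/andP; split; near: t; [exact: nbhs_right_gt|exact: nbhs_right_lt].
have f1 : h1 @ l^'- --> h1 l by apply: cvg_at_left_filter; exact: c1.
have f2 : h2 @ l^'- --> h2 l by apply: cvg_at_left_filter; exact: c2.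
apply: (cvg_unique _ f1); first exact: metric_hausdorff.
apply: cvg_trans f2; apply: near_eq_cvg; near=> t.
by rewrite e//; apply/andP; split; near: t; [exact: nbhs_left_gt|exact: nbhs_left_lt].
Unshelve. all: by end_near. Qed.

Lemma oe_ext V a b : oriented_edges V a -> oriented_edges V b ->
  len a = len b -> (forall t, 0 < t < len a -> arc a t = arc b t) -> a = b.
Proof.
move=> OEa OEb ll e; apply: oarc_eq => // t.
have [e0 el] := continuous_itv_ext (oe_len OEa) (oe_cont OEa) (oe_cont OEb) e.
have [t0|t0] := leP t 0; first by rewrite (oe_le0 OEa)// (oe_le0 OEb).
have [tl|tl] := leP (len a) t.
  by rewrite (oe_gel OEa)// (oe_gel OEb) -?ll// /target el ll.
by apply: e; rewrite t0.
Qed.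

Lemma oe_unique V a b : oriented_edges V a -> oriented_edges V b ->
  support a = support b -> a = b \/ a = rev b.
Proof.
move=> OEa OEb sab.
pose phi s := xget 0 [set u | 0 < u < len b /\ arc b u = arc a s].
have phiP s : 0 < s < len a -> 0 < phi s < len b /\ arc b (phi s) = arc a s.
  move=> sl; rewrite /phi; case: xgetP => [u -> []//|h].
  have : support b (arc a s) by rewrite -sab; apply/supportP; exists s.
  by move=> /supportP[u ul e]; exfalso; apply: (h u).
have [|||||ll [h|h]] := @itv_isometry R (len a) (len b) phi.
- exact: oe_len OEa.
- exact: oe_len OEb.
- by move=> s /phiP[].
- move=> s t sl tl; have [h1 e1] := phiP s sl; have [h2 e2] := phiP t tl.
  have := itv_param_injE (oe_param OEb) h1 h2.
  by rewrite e1 e2 -sab (itv_param_injE (oe_param OEa) sl tl) => -[].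
- move=> u ul; have : support a (arc b u) by rewrite sab; apply/supportP; exists u.
  move=> /supportP[s sl e]; exists s => //; have [h1 e1] := phiP s sl.
  by apply: (oe_inj OEb h1 ul); rewrite e1.
- left; apply: (oe_ext OEa OEb ll) => t tl; have [_ <-] := phiP t tl.
  by rewrite h.
right; apply: (oe_ext OEa (oe_rev OEb) ll) => t tl; have [_ <-] := phiP t tl.
by rewrite h// ll.
Qed.

Lemma edges_disjoint V e e' p : edges V e -> edges V e' -> e p -> e' p -> e = e'.
Proof.
move=> [q Vq <-] [q' Vq' <-] h h'.
by rewrite (same_connected_component h) (same_connected_component h').
Qed.

Lemma edges_component V e p : edges V e -> e p -> e = connected_component (~` V) p.
Proof. by move=> [q Vq <-]; exact: same_connected_component. Qed.

End OrientedArcs.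

(** * Vertices and edges of a metric graph *)

Section StarCharts.
Context {R : realType} {X : metricType R}.
Implicit Types (p q : X) (V : set X).

Definition locally_geodesic : Prop := forall p : X, exists2 r : R, 0 < r &
  forall q, mdist p q < r -> exists g : R -> X, [/\ g 0 = p, g (mdist p q) = q &
    forall s t, 0 <= s <= mdist p q -> 0 <= t <= mdist p q ->
      mdist (g s) (g t) = `|s - t|].

Hypothesis graphX : metric_graph X.

Lemma metric_graph_geodesic : locally_geodesic.
Proof.
move=> p; have [_ [eps e0 /(_ p)[n [r [U [c [n0 er nU [dc Uc]]]]]]]] := graphX.
have /nbhs_ballP[d /= d0 dU] := nU.
exists d => // q pq.
have Up : U p by apply: dU; exact: ballxx.
have Uq : U q by apply: dU; rewrite ballEmdist.
move: Up Uq; rewrite Uc => -[[i s] /= s0r cp] [[j t] /= t0r cq].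
have dpq : mdist p q = star_dist (i, s) (j, t) by rewrite -cp -cq dc.
have /andP[s0 sr] := s0r; have /andP[t0 tr] := t0r.
rewrite dpq /star_dist /=; case: eqP => [ij|nij].
  rewrite -ij in cq.
  have [st|ts] := leP s t.
    have -> : `|s - t| = t - s by rewrite distrC ger0_norm// subr_ge0.
    exists (fun u => c i (s + u)); split; first by rewrite addr0.
      by rewrite addrCA subrr addr0.
    move=> u v /andP[u0 u1] /andP[v0 v1]; rewrite dc; try by apply/andP; split; lra.
    by rewrite /star_dist eqxx /=; congr (`|_|); ring.
  have -> : `|s - t| = s - t by rewrite gtr0_norm// subr_gt0.
  exists (fun u => c i (s - u)); split; first by rewrite subr0.
    by rewrite opprB addrCA subrr addr0.
  move=> u v /andP[u0 u1] /andP[v0 v1]; rewrite dc; try by apply/andP; split; lra.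
  by rewrite /star_dist eqxx /= distrC; congr (`|_|); ring.
have c00 : c i 0 = c j 0.
  apply: mdist_positivity; rewrite dc ?lexx/= ?(le_lt_trans s0)//.
  by rewrite /star_dist /=; case: ifP; rewrite ?subrr ?normr0 ?addr0.
exists (fun u => if u <= s then c i (s - u) else c j (u - s)); split.
- by rewrite s0 subr0.
- case: ifPn => [|_]; last by rewrite addrAC subrr add0r.
  move=> h; have -> : t = 0 by lra.
  by rewrite addr0 subrr c00 -cq; congr (c j _); lra.
- have main u v : 0 <= u <= s + t -> 0 <= v <= s + t -> u <= v ->
    mdist (if u <= s then c i (s - u) else c j (u - s))
          (if v <= s then c i (s - v) else c j (v - s)) = `|u - v|.
    move=> /andP[u0 u1] /andP[v0 v1] uv.
    have [us|us] := leP u s; have [vs|vs] := leP v s.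
    + rewrite dc; try by apply/andP; split; lra.
      by rewrite /star_dist eqxx /= distrC; congr (`|_|); ring.
    + rewrite dc; try by apply/andP; split; lra.
      rewrite /star_dist ifF; last exact/eqP.
      by rewrite /= distrC ger0_norm ?subr_ge0//; ring.
    + lra.
    + rewrite dc; try by apply/andP; split; lra.
      by rewrite /star_dist eqxx /=; congr (`|_|); ring.
  move=> u v uI vI; have [uv|vu] := leP u v; first exact: main.
  by rewrite metric_sym distrC main// ltW.
Qed.

(* The directions around [p] in a star chart: two points with the same label
   are joined by a segment of the chart avoiding [p]. *)
Lemma metric_graph_directions p : exists2 d : R, 0 < d & exists (I : finType) (lab : X -> I),
  forall rho, 0 < rho <= d -> forall q q', q != p -> q' != p -> mdist p q < rho -> mdist p q' < rho ->
    lab q = lab q' -> exists C : set X, [/\ connected C, C q, C q' &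
       forall z, C z -> z != p /\ mdist p z < rho].
Proof.
have [_ [eps e0 /(_ p)[n [r [U [c [n0 er nU [dc Uc]]]]]]]] := graphX.
have /nbhs_ballP[d /= d0 dU] := nU.
have Up : U p by apply: dU; exact: ballxx.
exists d => //; move: Up; rewrite Uc => -[[i s] /= s0r cp].
have /andP[s0 sr] := s0r.
pose co q : 'I_n * R := xget (i, s) [set x | 0 <= x.2 < r /\ c x.1 x.2 = q].
have coP q : mdist p q < d -> 0 <= (co q).2 < r /\ c (co q).1 (co q).2 = q.
  move=> pq; have : U q by apply: dU; rewrite ballEmdist.
  rewrite Uc => -[[j t] /= t0r cq]; rewrite /co; case: xgetP => [x -> []//|h].
  by exfalso; apply: (h (j, t)).
(* The point [p] need not be the centre of the chart: it lies on ray [i] at distance [s], and the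
   boolean separates the two sides of [p] on that ray. *)
pose lab q : 'I_n * bool := ((co q).1, s < (co q).2).
exists ('I_n * bool)%type, lab => rho /andP[rho0 rhod] q q' qp q'p pq pq'.
have pqd : mdist p q < d by lra. have pqd' : mdist p q' < d by lra.
have [h1 h2] := coP q pqd; have [h1' h2'] := coP q' pqd'.
rewrite /lab; move: (co q) (co q') h1 h2 h1' h2' => [j t] [j' t'] /= h1 h2 h1' h2'.
move=> [jj]; subst j'; wlog tt : q q' qp q'p pq pq' pqd pqd' t t' h1 h2 h1' h2' / t <= t'.
  move=> H b; have [tt|tt] := leP t t'; first exact: (H q q' _ _ _ _ _ _ t t').
  by have [C [c1 c2 c3 c4]] := H q' q q'p qp pq' pq pqd' pqd t' t h1' h2' h1 h2 (ltW tt) (esym b); exists C.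
move=> b; have /andP[t0 tr] := h1; have /andP[t0' tr'] := h1'.
exists (c j @` `[t, t']); split.
- apply: connected_continuous_connected; first exact: segment_connected.
  apply: continuous_lipschitz => u v /=; rewrite !in_itv /= => /andP[u0 u1] /andP[v0 v1].
  rewrite dc; try by apply/andP; split; lra.
  by rewrite /star_dist eqxx.
- by exists t; rewrite //= in_itv /= lexx.
- by exists t'; rewrite //= in_itv /= lexx tt.
move=> z [u /=]; rewrite in_itv /= => /andP[u0 u1] <-.
have u0r : 0 <= u < r by apply/andP; split; lra.
have t0r : 0 <= t < r by []. have t0r' : 0 <= t' < r by [].
have dp v : 0 <= v < r -> mdist p (c j v) = star_dist (i, s) (j, v).
  by move=> vr; rewrite -cp dc.
have dq : star_dist (i, s) (j, t) < rho by rewrite -dp// h2.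
have dq' : star_dist (i, s) (j, t') < rho by rewrite -dp// h2'.
have nz w v : w != p -> c j v = w -> 0 <= v < r -> star_dist (i, s) (j, v) != 0.
  move=> wp cw vr; rewrite -dp// cw; apply: contra wp => /eqP/mdist_positivity->.
  exact: eqxx.
have nq := nz _ _ qp h2 t0r; have nq' := nz _ _ q'p h2' t0r'.
suff : star_dist (i, s) (j, u) != 0 /\ star_dist (i, s) (j, u) < rho.
  move=> [e1 e2]; rewrite dp//; split=> //; apply: contra e1 => /eqP e.
  by rewrite -dp// e mdistxx.
move: dq dq' nq nq'; rewrite /star_dist /=; case: ifP => [ij|nij] dq dq' nq nq'.
  move: nq nq'; rewrite !normr_eq0 !subr_eq0 => nq nq'.
  move: dq dq'; rewrite !ltr_norml => /andP[a1 a2] /andP[a3 a4].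
  split; last by apply/andP; split; lra.
  apply/eqP => su; subst u; move: b.
  have -> : s < t = false by apply/negbTE; rewrite -leNgt.
  by rewrite lt_neqAle nq' u1.
split; last by lra.
apply/eqP => e; move/eqP: nq; apply; lra.
Qed.

End StarCharts.

(** * Path connectedness *)

Section Joins.
Context {R : realType} {X : metricType R}.

Definition joined (z z' : X) : Prop :=
  exists k : R -> X, [/\ contI k, k 0 = z & k 1 = z'].

Lemma joined_refl z : joined z z.
Proof. by exists (fun=> z); split=> //; apply: contI_sub => ?; exact: cvg_cst. Qed.

Lemma joined_sym z z' : joined z z' -> joined z' z.
Proof.
move=> [k [ck k0 k1]]; exists (loop_inv k); rewrite /loop_inv; split.
- apply: within_clamp_comp => //.
    by move=> t; apply: cvgB; [exact: cvg_cst|exact: cvg_id].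
  by move=> t /andP[t0 t1]; apply/andP; split; lra.
- by rewrite subr0.
- by rewrite subrr.
Qed.

Lemma joined_trans z' z z'' : joined z z' -> joined z' z'' -> joined z z''.
Proof.
move=> [k [ck k0 k1]] [h [ch h0 h1]]; exists (loop_mul k h); split.
- by apply: loop_mul_continuous => //; rewrite k1 h0.
- by rewrite /loop_mul invr_ge0 ler0n mulr0.
- rewrite /loop_mul ifF; last by apply/negbTE; rewrite -ltNge; lra.
  by have -> : 2 * 1 - 1 = 1 :> R by ring.
Qed.

Lemma geodesic_joined (g : R -> X) (D : R) : 0 <= D ->
  (forall s t, 0 <= s <= D -> 0 <= t <= D -> mdist (g s) (g t) = `|s - t|) ->
  joined (g 0) (g D).
Proof.
move=> D0 h; exists (fun t => g (D * t)); split; rewrite ?mulr0 ?mulr1//.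
apply: (@within_continuous_comp R R X _ `[0, D]%classic (fun t => D * t) g).
- move=> t /=; rewrite !in_itv /= => /andP[t0 t1].
  by rewrite mulr_ge0//= ler_piMr.
- by apply: continuous_subspaceT => t; apply: cvgMr; exact: cvg_id.
apply: continuous_lipschitz => s t /=; rewrite !in_itv /= => sD tD.
by rewrite h.
Qed.

Lemma path_connected : connected [set: X] -> @locally_geodesic R X ->
  forall z z', joined z z'.
Proof.
move=> cX geo z z'.
have near_ p : \forall q \near p, joined p q.
  have [r r0 hr] := geo p; apply/nbhs_ballP; exists r => // q.
  rewrite ballEmdist /= => /hr[g [g0 gD gi]].
  by rewrite -{1}g0 -{1}gD; apply: geodesic_joined => //; exact: mdist_ge0.
apply: (@connected_ind X setT [set q | joined z q] z cX I (joined_refl z)) => // t _ /= h.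
  by apply: filterS (near_ t) => q jq _; exact: joined_trans jq.
apply: filterS (near_ t) => q jq _ zq; apply: h.
exact: joined_trans zq (joined_sym jq).
Qed.

End Joins.

(** * Edges as arcs between vertices, and their finiteness *)

Section Edges.
Context {R : realType} {X : metricType R}.
Implicit Types (p q : X) (V : set X).

Lemma valence2_line p : has_valence p 2 -> exists2 r : R, 0 < r &
  exists lam : R -> X, [/\ lam 0 = p,
    forall u v, `|u| < r -> `|v| < r -> mdist (lam u) (lam v) = `|u - v| &
    forall q, mdist p q < r -> exists2 u, `|u| < r & lam u = q].
Proof.
move=> [_ [r0 [U [c [r00 nU [dc Uc] c0]]]]].
have /nbhs_ballP[d /= d0 dU] := nU.
pose lam u := if 0 <= u then c ord0 u else c ord_max (- u).
have lamd u v : `|u| < r0 -> `|v| < r0 -> mdist (lam u) (lam v) = `|u - v|.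
  rewrite !ltr_norml => /andP[u0 u1] /andP[v0 v1]; rewrite /lam.
  have [h1|h1] := leP 0 u; have [h2|h2] := leP 0 v;
    (rewrite dc; try by apply/andP; split; lra); rewrite /star_dist /=.
  - by [].
  - by rewrite ger0_norm//; lra.
  - by rewrite ltr0_norm; lra.
  - by rewrite distrC; congr (`|_|); ring.
have lam0 : lam 0 = p by rewrite /lam lexx.
exists (Num.min r0 d); first by rewrite lt_min r00.
exists lam; split=> //.
  by move=> u v; rewrite !lt_min => /andP[? _] /andP[? _]; exact: lamd.
move=> q; rewrite lt_min => /andP[pr pd].
have : U q by apply: dU; rewrite ballEmdist.
rewrite Uc => -[[i t] /= /andP[t0 tr] cq].
have main u : `|u| < r0 -> lam u = q -> exists2 u, `|u| < Num.min r0 d & lam u = q.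
  move=> ur lq; exists u => //; rewrite lt_min ur /=.
  have z : `|0 : R| < r0 by rewrite normr0.
  by have := lamd 0 u z ur; rewrite lam0 lq sub0r normrN => <-.
have [i0|i1] : i = ord0 \/ i = ord_max.
  by case: i cq => -[|[|//]] hi cq; [left|right]; exact: val_inj.
- apply: (main t); first by rewrite ger0_norm.
  by rewrite /lam t0 -i0.
apply: (main (- t)); first by rewrite normrN ger0_norm.
rewrite /lam oppr_ge0; case: ifPn => h; last by rewrite opprK -i1.
have t00 : t = 0 by lra.
by rewrite t00 oppr0 (c0 ord0) -(c0 i) -cq t00.
Qed.

Variable V : set X.
Hypothesis modelV : vertex_set V.

(* A point outside [V] is interior to its edge, since the parameter of the
   edge is injective and continuous into a line through the point. *)
Lemma edge_nbhs p : ~ V p -> exists2 r : R, 0 < r &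
  (forall q, mdist p q < r -> connected_component (~` V) p q) /\
  forall q q', mdist p q < r -> mdist p q' < r ->
    path_dist (connected_component (~` V) p) q q' = (mdist q q')%:E.
Proof.
move=> Vp; have [_ hV he] := modelV.
have val2 : has_valence p 2 by apply: contrapT => /hV.
set e := connected_component _ p.
have [|l [g [l0 ge]]] := he e; first by exists p.
have [r r0 [lam [lam0 lami lamq]]] := valence2_line val2.
have ep : e p by exact: connected_component_refl.
have [s0 s0l gs0] := itv_param_ex ge ep; have /andP[s00 s01] := s0l.
pose d := Num.min (r / 2) (Num.min (s0 / 2) ((l - s0) / 2)).
have d0 : 0 < d by rewrite !lt_min !divr_gt0// subr_gt0.
have [dr ds dl] : [/\ d <= r / 2, d <= s0 / 2 & d <= (l - s0) / 2].
  by split; rewrite /d !ge_min lexx ?orbT.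
have sI s : `[s0 - d, s0 + d]%classic s -> 0 < s < l /\ mdist p (g s) < r.
  rewrite /= in_itv /= => /andP[h1 h2].
  have sl : 0 < s < l by apply/andP; split; lra.
  split=> //; rewrite -gs0; apply: le_lt_trans (itv_param_lip ge s0l sl) _.
  by rewrite ltr_norml; apply/andP; split; lra.
pose th s := xget 0 [set u | `|u| < r /\ lam u = g s].
have thP s : `[s0 - d, s0 + d]%classic s -> `|th s| < r /\ lam (th s) = g s.
  move=> /sI[_ /lamq[u ur lu]]; rewrite /th; case: xgetP => [v -> []//|h].
  by exfalso; apply: (h u).
have thd s t : `[s0 - d, s0 + d]%classic s -> `[s0 - d, s0 + d]%classic t ->
    `|th s - th t| = mdist (g s) (g t).
  by move=> /thP[s1 <-] /thP[t1 <-]; rewrite lami.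
have s0I : `[s0 - d, s0 + d]%classic s0 by rewrite /= in_itv /=; apply/andP; split; lra.
have th0 : th s0 = 0.
  have [a1 a2] := thP _ s0I; apply/eqP; rewrite -normr_eq0.
  have z : `|0 : R| < r by rewrite normr0.
  by have := lami _ _ a1 z; rewrite a2 lam0 gs0 mdistxx subr0 => <-.
have thc : {within `[s0 - d, s0 + d], continuous th}.
  apply/within_continuousP => s sI' O /nbhs_ballP[eps /= eps0 epsO].
  apply/nbhs_ballP; exists eps => //= t st tI'; apply: epsO.
  rewrite /ball /= thd//; apply: le_lt_trans st.
  by apply: (itv_param_lip ge); [exact: (sI _ sI').1|exact: (sI _ tI').1].
have thi : {in `[s0 - d, s0 + d] &, injective th}.
  move=> s t sI' tI' est; have := thd s t sI' tI'.
  rewrite est subrr normr0 => /esym/mdist_positivity.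
  by apply: (itv_param_inj ge); [exact: (sI _ sI').1|exact: (sI _ tI').1].
(* The coordinate [th] has opposite signs at the two ends of the parameter interval, so by the
   intermediate value theorem it takes every value of size below [eta]: a whole piece of the line
   around [p] lies in the edge. *)
pose eta := Num.min `|th (s0 - d)| `|th (s0 + d)|.
have aI : `[s0 - d, s0 + d]%classic (s0 - d) by rewrite /= in_itv /=; apply/andP; split; lra.
have bI : `[s0 - d, s0 + d]%classic (s0 + d) by rewrite /= in_itv /=; apply/andP; split; lra.
have [eta0 hu] : 0 < eta /\ forall u, `|u| < eta ->
    Num.min (th (s0 - d)) (th (s0 + d)) <= u <= Num.max (th (s0 - d)) (th (s0 + d)).
  have [m|m] := itv_continuous_inj_mono thc thi.
    have h1 : th (s0 - d) < 0 by rewrite -th0; apply: m => //; lra.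
    have h2 : 0 < th (s0 + d) by rewrite -th0; apply: m => //; lra.
    rewrite /eta (ltr0_norm h1) (gtr0_norm h2); split; first by rewrite lt_min oppr_gt0 h1.
    move=> u; rewrite lt_min !ltr_norml => /andP[/andP[? ?] /andP[? ?]].
    by rewrite ge_min le_max; apply/andP; split; apply/orP; [left|right]; lra.
  have h1 : 0 < th (s0 - d) by rewrite -th0; apply: m => //; lra.
  have h2 : th (s0 + d) < 0 by rewrite -th0; apply: m => //; lra.
  rewrite /eta (gtr0_norm h1) (ltr0_norm h2); split; first by rewrite lt_min oppr_gt0 h1.
  move=> u; rewrite lt_min !ltr_norml => /andP[/andP[? ?] /andP[? ?]].
  by rewrite ge_min le_max; apply/andP; split; apply/orP; [right|left]; lra.
have lam_e u : `|u| < eta -> e (lam u) /\ `|u| < r.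
  move=> /hu uI; have ab : s0 - d <= s0 + d by lra.
  have [s sI' us] := IVT ab thc uI; have [h1 h2] := thP s sI'.
  rewrite -us; split=> //; rewrite h2; exact: (itv_param_in ge (sI s sI').1).
have inball q : mdist p q < Num.min r eta -> exists2 u, `|u| < eta & lam u = q.
  rewrite lt_min => /andP[/lamq[u ur <-]].
  have z : `|0 : R| < r by rewrite normr0.
  by rewrite -lam0 lami// sub0r normrN => h; exists u.
exists (Num.min r eta); first by rewrite lt_min r0.
split; first by move=> q /inball[u ue <-]; have [] := lam_e u ue.
move=> _ _ /inball[u ue <-] /inball[v ve <-].
apply/eqP; rewrite eq_le; apply/andP; split; last exact: mdist_path_dist.
(* The straight segment from [u] to [v] stays in this piece and is a path of length [|u - v|] inside
   the edge. *)
have seg (t : R) : 0 <= t <= 1 -> `|u + (v - u) * t| < eta.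
  move=> /andP[t0 t1]; move: ue ve; rewrite !ltr_norml => /andP[u0 u1] /andP[v0 v1].
  have -> : u + (v - u) * t = u * (1 - t) + v * t by ring.
  have [h|h] := leP u v; apply/andP; split; nra.
have lamI (s t : R) : 0 <= s <= 1 -> 0 <= t <= 1 ->
    mdist (lam (u + (v - u) * s)) (lam (u + (v - u) * t)) = `|u - v| * `|s - t|.
  move=> sI' tI'; rewrite lami; last 2 first.
  - by have [] := lam_e _ (seg _ sI').
  - by have [] := lam_e _ (seg _ tI').
  by rewrite -normrM -normrN; congr (`|_|); ring.
apply: (@le_trans _ _ (path_length (fun t => lam (u + (v - u) * t)))); last first.
  rewrite lami; [|by have [] := lam_e u ue|by have [] := lam_e v ve].
  by apply: path_length_le => s t sI' tI'; rewrite lamI.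
apply: ereal_inf_lbound; exists (fun t => lam (u + (v - u) * t)) => //; split.
- apply: (@within_continuous_comp R R X _ [set w | `|w| < eta] (fun t => u + (v - u) * t) lam).
  + by move=> t /=; rewrite in_itv; exact: seg.
  + apply: continuous_subspaceT => t; apply: cvgD; first exact: cvg_cst.
    by apply: cvgMr; exact: cvg_id.
  + apply: continuous_lipschitz => s t /= se te.
    by rewrite lami//; [have [] := lam_e s se|have [] := lam_e t te].
- by rewrite mulr0 addr0.
- by rewrite mulr1 addrCA subrr addr0.
by move=> z [t /=]; rewrite in_itv /= => tI <-; have [] := lam_e _ (seg t tI).
Qed.

Lemma edge_nbhs_in e p : edges V e -> e p -> exists2 r : R, 0 < r &
  (forall q, mdist p q < r -> e q) /\ forall q q', mdist p q < r -> mdist p q' < r ->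
    path_dist e q q' = (mdist q q')%:E.
Proof.
move=> Ve ep; have Vp : ~ V p.
  by move: ep Ve => /[swap] -[q Vq <-] /connected_component_sub.
by rewrite (edges_component Ve ep); exact: edge_nbhs.
Qed.

(** Close to an interior point of an edge the ambient distance is the difference of parameters. As
    covers preserve small distances, this transports unit speed parametrizations to them. *)
Lemma oe_local_coord a t0 : oriented_edges V a -> 0 < t0 < len a ->
  exists2 r : R, 0 < r & forall t q, 0 < t < len a -> `|t0 - t| < r ->
    mdist (arc a t0) q < r -> exists2 s, 0 < s < len a /\ arc a s = q &
      mdist (arc a t) q = `|t - s|.
Proof.
move=> OEa t0l; have ge := oe_param OEa.
have [r r0 [h1 h2]] := edge_nbhs_in (oe_edge OEa) (itv_param_in ge t0l).
exists r => // t q tl ttr qr.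
have /supportP[s sl sq] := h1 q qr; exists s => //.
have tr : mdist (arc a t0) (arc a t) < r.
  exact: le_lt_trans (itv_param_lip ge t0l tl) ttr.
have := h2 _ _ tr qr; rewrite -sq (itv_param_injE ge tl sl) => -[] ->.
by rewrite sq.
Qed.

(** A source outside [V] would be an interior point [arc a s] of the same edge. For small [x] the
    points [arc a x] tend to it, while their distance to it is [|x - s|], which stays away from
    0. *)
Lemma oe_source_V a : oriented_edges V a -> V (source a).
Proof.
move=> OEa; apply: contrapT => Vp.
have ge := oe_param OEa; have l0 := oe_len OEa.
have [r r0 [h1 h2]] := edge_nbhs Vp.
have /metricType_numDomainType.cvgrPdist_lt/(_ _ r0)[d /= d0 dP] := @oe_cont _ _ _ _ OEa 0.
have near0 t : 0 < t < d -> mdist (source a) (arc a t) < r.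
  by move=> /andP[t0 td]; apply: dP => //=; rewrite sub0r normrN gtr0_norm.
pose u := Num.min (d / 2) (len a / 2).
have [u0 ud ul] : [/\ 0 < u, u <= d / 2 & u <= len a / 2].
  by rewrite lt_min !divr_gt0//; split=> //; rewrite ge_min lexx ?orbT.
have ul' : 0 < u < len a by apply/andP; split; lra.
have ud' : 0 < u < d by apply/andP; split; lra.
have eE : support a = connected_component (~` V) (source a).
  rewrite (same_connected_component (h1 _ (near0 u ud'))).
  exact: (edges_component (oe_edge OEa) (itv_param_in ge ul')).
have : support a (source a) by rewrite eE; exact: connected_component_refl.
move=> /supportP[s sl es]; have /andP[s0 s1] := sl.
rewrite -eE in h2.
pose w := Num.min (s / 3) u.
have [w0 ws wu] : [/\ 0 < w, w <= s / 3 & w <= u].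
  by rewrite lt_min u0 divr_gt0//; split=> //; rewrite ge_min lexx ?orbT.
have wl : 0 < w < len a by apply/andP; split; lra.
have sr : mdist (source a) (source a) < r by rewrite mdistxx.
have /metricType_numDomainType.cvgrPdist_lt/(_ _ w0)[d' /= d'0 dP'] := @oe_cont _ _ _ _ OEa 0.
pose x := Num.min (d' / 2) w.
have [x0 xd xw] : [/\ 0 < x, x <= d' / 2 & x <= w].
  by rewrite lt_min w0 divr_gt0//; split=> //; rewrite ge_min lexx ?orbT.
have xl : 0 < x < len a by apply/andP; split; lra.
have xd' : 0 < x < d by apply/andP; split; lra.
have := h2 _ _ (near0 x xd') sr; rewrite -es (itv_param_injE ge xl sl) => -[].
have : mdist (source a) (arc a x) < w.
  by apply: dP' => //=; rewrite sub0r normrN gtr0_norm//; lra.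
rewrite es metric_sym => h3 h4; move: h3; rewrite -h4 distrC gtr0_norm; lra.
Qed.

Lemma oe_target_V a : oriented_edges V a -> V (target a).
Proof. by move=> /oe_rev /oe_source_V; rewrite source_rev. Qed.

Hypothesis compactX : compact [set: X].

(** Compactness gives a cluster point at the open end, and the Lipschitz bound makes it a limit with
    an explicit rate. *)
Lemma end_limit (l : R) (g : R -> X) : 0 < l ->
  (forall s t, 0 < s < l -> 0 < t < l -> mdist (g s) (g t) <= `|s - t|) ->
  exists p, forall t, 0 < t < l -> mdist p (g t) <= t.
Proof.
move=> l0 gl; have [|p [_ clp]] := compactX (F := g @ 0^'+); first exact: filterT.
exists p => t /[dup] tl /andP[t0 tl'].
apply/ler_addgt0Pr => eps eps0.
have [||q [[u uF uq] pq]] := clp [set q | exists2 u, 0 < u < t & g u = q] (ball p eps).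
- have h : \forall u \near (0 : R)^'+, 0 < u < t.
    near=> u; apply/andP; split; near: u; [exact: nbhs_right_gt|exact: nbhs_right_lt].
  by apply: filterS h => u h /=; exists u.
- exact: nbhsx_ballx.
rewrite ballEmdist /= -uq in pq; have /andP[u0 ut] := uF.
apply: le_trans (metric_triangle p (g u) (g t)) _.
have ul : 0 < u < l by rewrite u0; lra.
have := gl u t ul tl; rewrite ltr0_norm; lra.
Unshelve. all: by end_near. Qed.

(** The two end limits complete the open parametrization to a Lipschitz map of the line, constant
    beyond the ends. *)
Lemma oe_exists e : edges V e -> exists2 a, oriented_edges V a & support a = e.
Proof.
move=> Ve; have [_ _ he] := modelV; have [l [g [l0 ge]]] := he e Ve.
have gl := itv_param_lip ge.
have [p0 hp0] := end_limit l0 gl.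
have [|p1 hp1] := @end_limit l (fun t => g (l - t)) l0.
  move=> s t /andP[? ?] /andP[? ?]; have h : l - s - (l - t) = t - s by ring.
  rewrite distrC -h; apply: gl; apply/andP; split; lra.
have {}hp1 t : 0 < t < l -> mdist (g t) p1 <= l - t.
  move=> /andP[? ?]; have tl : 0 < l - t < l by apply/andP; split; lra.
  by have := hp1 _ tl; rewrite opprB addrCA subrr addr0 metric_sym.
pose A t := if t <= 0 then p0 else if l <= t then p1 else g t.
have A0 t : t <= 0 -> A t = p0 by rewrite /A => ->.
have Al t : l <= t -> A t = p1 by move=> lt; rewrite /A lt ifF//; apply/negbTE; rewrite -ltNge; lra.
have Ag t : 0 < t < l -> A t = g t.
  by move=> /andP[? ?]; rewrite /A ifF ?ifF//; apply/negbTE; rewrite -ltNge.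
have p01 : mdist p0 p1 <= l.
  have m : 0 < l / 2 < l by apply/andP; split; lra.
  apply: le_trans (metric_triangle p0 (g (l / 2)) p1) _.
  have := hp0 _ m; have := hp1 _ m; lra.
have Alip s t : s <= t -> mdist (A s) (A t) <= `|s - t|.
  move=> st; have -> : `|s - t| = t - s by rewrite distrC ger0_norm// subr_ge0.
  have [s0|s0] := leP s 0; have [tl|tl] := leP l t.
  - by rewrite A0// Al//; lra.
  - have [t0|t0] := leP t 0; first by rewrite !A0// mdistxx; lra.
    have tl' : 0 < t < l by rewrite t0.
    by rewrite A0// Ag//; have := hp0 _ tl'; lra.
  - have [sl|sl] := leP l s; first by rewrite !Al// mdistxx; lra.
    have sl' : 0 < s < l by rewrite s0.
    by rewrite (Al _ tl) Ag//; have := hp1 _ sl'; lra.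
  have sl' : 0 < s < l by rewrite s0/=; lra.
  have tl' : 0 < t < l by rewrite tl andbT; lra.
  rewrite !Ag//; have := gl s t sl' tl'; rewrite distrC ger0_norm//; lra.
have Acont : continuous A.
  apply/continuous_subspace_setT; apply: continuous_lipschitz => s t _ _.
  have [st|st] := leP s t; first exact: Alip.
  by rewrite metric_sym distrC; apply/Alip/ltW.
have supp : A @` `]0, l[ = e.
  have [<- _] := ge; apply/seteqP; split=> q [t /= tl <-]; exists t => //;
  by rewrite Ag//; move: tl; rewrite in_itv.
exists (Oarc l A) => //; rewrite /oriented_edges /= /support /= supp; split=> //.
  split=> // s t sl tl; rewrite !Ag; [|by move: tl; rewrite in_itv|by move: sl; rewrite in_itv].
  by have [_] := ge; apply.
by split=> t ht; rewrite /source /target /= ?(A0 _ ht) ?(A0 _ (lexx _)) ?(Al _ ht) ?(Al _ (lexx _)).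
Qed.

Hypothesis graphX : metric_graph X.

Lemma edges_locally_finite p : exists2 r : R, 0 < r &
  finite_set [set e | edges V e /\ exists2 q, e q & mdist p q < r].
Proof.
have [Vp|Vp] := pselect (V p); last first.
  have [r r0 [h _]] := edge_nbhs Vp; exists r => //.
  apply: (@sub_finite_set _ _ [set connected_component (~` V) p]); last exact: finite_set1.
  move=> e [Ve [q eq /h pq]] /=.
  by rewrite (same_connected_component pq); exact: edges_component.
have [hV _ _] := modelV; have [U /nbhs_ballP[d1 /= d10 dU] UV] := hV p Vp.
have [d d0 [I [lab hlab]]] := metric_graph_directions graphX p.
pose r := Num.min d d1; have r0 : 0 < r by rewrite lt_min d0.
exists r => //.
(* Points near [p] with equal labels are joined outside [V], hence lie in one edge. One edge chosen
   per label therefore lists all edges that reach the ball. *)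
pose E i := xget set0 [set e | edges V e /\ exists q, [/\ e q, mdist p q < r & lab q = i]].
apply: (@sub_finite_set _ _ (E @` setT)); last exact/finite_image/finite_finset.
move=> e [Ve [q eq pq]]; exists (lab q) => //; rewrite /E; case: xgetP => [e' _ [Ve' [q' [eq' pq' ll]]]|h].
  have nV z e1 : edges V e1 -> e1 z -> z != p.
    by move=> [x Vx <-] /connected_component_sub nVz; apply/eqP => zp; rewrite zp in nVz.
  have rr : 0 < r <= d by rewrite r0 ge_min lexx.
  have [C [cC Cq Cq' hC]] := hlab r rr q q' (nV _ _ Ve eq) (nV _ _ Ve' eq') pq pq' (esym ll).
  have CV : C `<=` ~` V.
    move=> z /hC[zp]; rewrite lt_min => /andP[_ zd] Vz.
    have : (U `&` V) z by split=> //; apply: dU; rewrite ballEmdist.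
    by rewrite UV => /= e1; rewrite e1 eqxx in zp.
  rewrite (edges_component Ve eq) (edges_component Ve' eq').
  apply/esym/same_connected_component.
  by exists C.
by exfalso; apply: (h e); split=> //; exists q.
Qed.

Lemma edges_finite : finite_set (edges V).
Proof.
(* Properties of a collection of edges that hold as soon as it contains some fixed finite
   collection. With this filter, compactness glues the local finite lists into a global one. *)
pose F : set_system (set (set X)) := [set P | exists2 A0, finite_set A0 &
  forall A, A0 `<=` A -> P A].
have FF : Filter F.
  split; first by exists set0.
    move=> P Q [A fA hA] [B fB hB]; exists (A `|` B); first by rewrite finite_setU.
    by move=> C; rewrite subUset => -[/hA ? /hB ?].
  by move=> P Q PQ [A fA hA]; exists A => // B /hA /PQ.
move/compact_near_coveringP: compactX => /(_ _ F (fun A p => forall e, edges V e -> e p -> A e) FF).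
case.
  move=> p _; have [r r0 fr] := edges_locally_finite p.
  exists (ball p r, [set A | [set e | edges V e /\ exists2 q, e q & mdist p q < r] `<=` A]).
    split; first exact: nbhsx_ballx.
    by exists [set e | edges V e /\ exists2 q, e q & mdist p q < r].
  move=> [p' A] [/= pp' hA] e Ve ep'; apply: hA; split=> //; exists p' => //.
  by rewrite ballEmdist in pp'.
move=> A fA /(_ A (fun _ => id)) h; apply: sub_finite_set fA => e /[dup] Ve [q Vq eq].
by apply: (h q I) => //; rewrite -eq; exact: connected_component_refl.
Qed.

Lemma oe_finite : finite_set (oriented_edges V).
Proof.
apply: (@sub_finite_set _ _ (\bigcup_(e in edges V) [set a | oriented_edges V a /\ support a = e])).
  by move=> a OEa; exists (support a) => //; exact: oe_edge OEa.
apply: bigcup_finite; first exact: edges_finite.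
move=> e Ve; have [a OEa sa] := oe_exists Ve.
apply: (@sub_finite_set _ _ [set a; rev a]); last by rewrite finite_setU; split; exact: finite_set1.
move=> b [OEb sb]; have [->|->] := oe_unique OEb OEa (etrans sb (esym sa)); [by left|by right].
Qed.

End Edges.

(** * Oriented edges of a cover *)

Lemma clamp_le0 (R : realType) (t : R) : t <= 0 -> clamp t = 0.
Proof. by move=> t0; rewrite /clamp max_l// ge_min t0. Qed.

Lemma clamp_ge1 (R : realType) (t : R) : 1 <= t -> clamp t = 1.
Proof. by move=> t1; rewrite /clamp min_r// max_r. Qed.

Lemma convex_itv (R : realType) (l s t x : R) : 0 < s < l -> 0 < t < l ->
  0 <= x <= 1 -> 0 < s + (t - s) * x < l.
Proof.
move=> /andP[s0 sl] /andP[t0 tl] /andP[x0 x1].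
have [st|ts] := leP s t.
  have h1 : 0 <= (t - s) * x by rewrite mulr_ge0// subr_ge0.
  have h2 : (t - s) * x <= t - s by rewrite ler_piMr// subr_ge0.
  by apply/andP; split; lra.
have h1 : 0 <= (s - t) * x by rewrite mulr_ge0// subr_ge0 ltW.
have h2 : (s - t) * x <= s - t by rewrite ler_piMr// subr_ge0 ltW.
have -> : (t - s) * x = - ((s - t) * x) by ring.
by apply/andP; split; lra.
Qed.

Section CoverArcs.
Context {R : realType} {Y G : metricType R} (f : Y -> G) (V : set G).
Hypothesis covf : covering f.
Hypothesis modelV : vertex_set V.
Hypothesis compactG : compact [set: G].
Local Notation V' := (f @^-1` V).
Implicit Types (a b : oarc G) (h : R -> Y) (z : Y).

Definition is_lift a h : Prop := [/\ continuous h, forall t : R, f (h t) = arc a t,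
  forall t : R, t <= 0 -> h t = h 0 & forall t : R, len a <= t -> h t = h (len a)].

Lemma lift_from_source a z : oriented_edges V a -> f z = source a ->
  exists2 h, is_lift a h & h 0 = z.
Proof.
move=> OEa fz; have l0 := oe_len OEa.
have ck : contI (fun t : R => arc a (len a * t)).
  apply: contI_sub => t; apply: (@continuous_comp R R G (fun t : R => len a * t) (arc a)).
    by apply: cvgMr; exact: cvg_id.
  exact: (oe_cont OEa).
have [|k [kc fk k0]] := lift_path covf ck (z := z); first by rewrite mulr0.
exists (fun t : R => k (clamp (t / len a))); last by rewrite mul0r clamp_id//= in_itv /= lexx ler01.
split.
- move=> t; apply: (@continuous_comp R R Y (fun t : R => t / len a) (fun t : R => k (clamp t))).
    by apply: cvgMl; exact: cvg_id.
  exact: (continuous_clamp kc).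
- move=> t; have := clamp_in (t / len a); rewrite /= in_itv /= => cI.
  rewrite fk//; have [t0|t0] := leP t 0.
    by rewrite clamp_le0 ?mulr0 ?(oe_le0 OEa t0)// ler_pdivrMr// mul0r.
  have [tl|tl] := leP (len a) t.
    by rewrite clamp_ge1 ?mulr1 ?(oe_gel OEa tl)// ler_pdivlMr// mul1r.
  rewrite clamp_id; first by congr (arc a _); rewrite mulrC divfK// gt_eqF.
  rewrite /= in_itv /=; apply/andP; split; first by apply: divr_ge0; apply: ltW.
  by rewrite ler_pdivrMr// mul1r ltW.
- by move=> t t0; rewrite !clamp_le0 ?mul0r// ler_pdivrMr// mul0r.
- by move=> t tl; rewrite !clamp_ge1 ?divff ?gt_eqF// ler_pdivlMr// mul1r.
Qed.

Lemma is_lift_eq a h h' t0 : is_lift a h -> is_lift a h' -> h t0 = h' t0 -> h = h'.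
Proof.
move=> [ch fh _ _] [ch' fh' _ _] e; apply/funext => t.
have cR : connected [set: R] by apply/connected_intervalP.
apply: (@lift_unique _ _ _ _ covf R setT h h' t0) => //.
- exact: continuous_subspaceT.
- exact: continuous_subspaceT.
- by move=> s _; rewrite fh fh'.
Qed.

(** The arc is first lifted backwards from [t0] to its source; the lift starting from the source so
    reached agrees with it by uniqueness. *)
Lemma lift_at a z t0 : oriented_edges V a -> 0 <= t0 <= len a -> f z = arc a t0 ->
  exists2 h, is_lift a h & h t0 = z.
Proof.
move=> OEa t0l fz; have [k [kc fk k0]] : exists k : R -> Y, [/\ contI k,
    forall t : R, 0 <= t <= 1 -> f (k t) = arc a (t0 * (1 - t)) & k 0 = z].
  apply: (lift_path covf); last by rewrite subr0 mulr1.
  apply: contI_sub => t; apply: (@continuous_comp R R G (fun t : R => t0 * (1 - t)) (arc a)).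
    by apply: cvgMr; apply: cvgB; [exact: cvg_cst|exact: cvg_id].
  exact: (oe_cont OEa).
have I1 : 0 <= (1 : R) <= 1 by rewrite ler01 lexx.
have I0 : 0 <= (0 : R) <= 1 by rewrite ler01 lexx.
have [|h lh h0] := @lift_from_source a (k 1) OEa.
  by rewrite fk// subrr mulr0.
exists h => //; have [ch fh _ _] := lh; rewrite -k0.
rewrite -[t0 in LHS](mulr1 t0) -[1 in LHS](subr0 1).
apply: (@lift_unique _ _ _ _ covf R `[0, 1]%classic (fun t => h (t0 * (1 - t))) k 1) => //.
- exact: segment_connected.
- apply: continuous_subspaceT => t; apply: (@continuous_comp R R Y (fun t : R => t0 * (1 - t)) h).
    by apply: cvgMr; apply: cvgB; [exact: cvg_cst|exact: cvg_id].
  exact: ch.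
- by move=> t /=; rewrite in_itv /= => tI; rewrite fh fk.
- by rewrite subrr mulr0.
Qed.

Lemma is_lift_inj a h : oriented_edges V a -> is_lift a h -> forall s t,
  0 < s < len a -> 0 < t < len a -> h s = h t -> s = t.
Proof.
by move=> OEa [_ fh _ _] s t sl tl e; apply: (oe_inj OEa sl tl); rewrite -!fh e.
Qed.

Lemma is_lift_open a h u : oriented_edges V a -> is_lift a h -> 0 < u < len a ->
  \forall q \near h u, exists2 s, 0 < s < len a & h s = q.
Proof.
move=> OEa [ch fh _ _] ul; have [U eU Uz] := evenly_at covf (f (h u)).
have [w sw wz] := sheet_at eU Uz; have [ow _ _ iw] := sw.
have [r r0 hr] := oe_local_coord modelV OEa ul.
have /nbhs_ballP[d /= d0 dP] := ch u w (open_nbhs_nbhs (conj ow wz)).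
have nw : \forall q \near h u, w q by apply: open_nbhs_nbhs.
have nb : \forall q \near h u, mdist (h u) q < Num.min r d.
  by apply/nbhs_ballP; exists (Num.min r d); [rewrite /= lt_min r0|move=> q; rewrite ballEmdist].
apply: filterS2 nw nb => q wq; rewrite lt_min => /andP[qr qd].
have fd : mdist (arc a u) (f q) = mdist (h u) q by rewrite -fh iw.
have [||s [sl sq] us] := hr u (f q) ul.
- by rewrite subrr normr0.
- by rewrite fd.
exists s => //; apply: (sheet_inj sw) => //; last by rewrite fh.
by apply: dP; rewrite /ball /= -us fd.
Qed.

Lemma is_lift_support_open a h : oriented_edges V a -> is_lift a h ->
  open (h @` `]0, len a[).
Proof.
move=> OEa lh; rewrite openE => _ [u /= + <-]; rewrite in_itv /= => ul.
apply: filterS (is_lift_open OEa lh ul) => q [s sl <-].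
by exists s => //=; rewrite in_itv.
Qed.

(** The lifted open arc is connected and open. It is also closed in its component: a point outside
    it lies on another lift of [a] or of the same parametrized edge, which is open too, and two
    lifts that meet coincide. *)
Lemma is_lift_component a h u : oriented_edges V a -> is_lift a h -> 0 < u < len a ->
  connected_component (~` V') (h u) = h @` `]0, len a[.
Proof.
move=> OEa lh ul; have [ch fh _ _] := lh.
apply/seteqP; split; last first.
  apply: connected_component_max.
  - by exists u => //=; rewrite in_itv.
  - move=> _ [t /= + <-]; rewrite in_itv /= => tl; rewrite /setC /= fh.
    exact: (oe_notV OEa).
  - apply: connected_continuous_connected; last exact: continuous_subspaceT.
    exact/connected_intervalP/interval_is_interval.
have Cu : connected_component (~` V') (h u) (h u).
  by apply: connected_component_refl; rewrite /setC /= fh; exact: (oe_notV OEa).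
have fC q : connected_component (~` V') (h u) q -> support a (f q).
  rewrite (edges_component (oe_edge OEa) (itv_param_in (oe_param OEa) ul)).
  move: q; change (connected_component (~` V') (h u) `<=`
    f @^-1` connected_component (~` V) (arc a u)).
  rewrite -image_sub; apply: connected_component_max.
  - by exists (h u).
  - by move=> _ [q /connected_component_sub + <-].
  - apply: connected_continuous_connected; first exact: component_connected.
    exact/continuous_subspaceT/covering_continuous.
apply: (@connected_ind Y _ (h @` `]0, len a[) (h u)) => //.
- exact: component_connected.
- by move=> q _ hq; apply: filterS (open_nbhs_nbhs (conj (is_lift_support_open OEa lh) hq)).
move=> q Cq nq; have /supportP[v vl fv] := fC q Cq.
have [|h' lh' h'v] := @lift_at a q v OEa _ (esym fv).
  by move: vl => /andP[/ltW-> /ltW->].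
have : \forall q' \near q, exists2 s, 0 < s < len a & h' s = q'.
  by rewrite -h'v; exact: is_lift_open.
apply: filterS => _ [s sl <-] _ [t /= + ht]; rewrite in_itv /= => tl.
have st : t = s by apply: (oe_inj OEa tl sl); have [_ fh' _ _] := lh'; rewrite -fh -fh' ht.
subst t; apply: nq; rewrite -h'v -(is_lift_eq lh lh' ht).
by exists v => //=; rewrite in_itv.
Qed.

Lemma is_lift_lip a h : oriented_edges V a -> is_lift a h -> forall s t,
  0 < s < len a -> 0 < t < len a -> mdist (h s) (h t) <= `|s - t|.
Proof.
move=> OEa [ch fh _ _] s t sl tl.
have inl (x : R) : 0 <= x <= 1 -> 0 < s + (t - s) * x < len a.
  by move=> xI; exact: convex_itv.
have := @lipschitz_local R Y (fun x => h (s + (t - s) * x)) `|s - t|.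
rewrite mulr0 addr0 mulr1 addrCA subrr addr0; apply => x0 x0I.
have [U eU Uz] := evenly_at covf (f (h (s + (t - s) * x0))).
have [w sw wz] := sheet_at eU Uz; have [ow _ _ iw] := sw.
have cx : {for x0, continuous (fun x : R => h (s + (t - s) * x))}.
  apply: (@continuous_comp R R Y (fun x : R => s + (t - s) * x) h); last exact: ch.
  by apply: cvgD; [exact: cvg_cst|apply: cvgMr; exact: cvg_id].
have nw : \forall x \near x0, w (h (s + (t - s) * x)).
  exact: (cx w (open_nbhs_nbhs (conj ow wz))).
exists ([set x | w (h (s + (t - s) * x))], [set x | w (h (s + (t - s) * x))]) => //.
move=> [x y] [/= wx wy] xI yI; rewrite -iw// !fh.
apply: le_trans (itv_param_lip (oe_param OEa) (inl x xI) (inl y yI)) _.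
rewrite -normrM le_eqVlt; apply/orP; left; apply/eqP.
by rewrite -normrN; congr (`|_|); ring.
Qed.

(** The lifted segment bounds the path distance from above. Conversely, a path inside the lifted arc
    has a coordinate on it, whose small variations are distances in [Y] because [f] is isometric on
    sheets. *)
Lemma is_lift_oe a h : oriented_edges V a -> is_lift a h ->
  oriented_edges V' (Oarc (len a) h).
Proof.
move=> OEa lh; have [ch fh h0 hl] := lh; have l0 := oe_len OEa.
have m0 : 0 < len a / 2 < len a by apply/andP; split; lra.
split => //=.
- exists (h (len a / 2)); last exact: is_lift_component.
  by rewrite /= /setC /= fh; exact: (oe_notV OEa).
rewrite /support /=; split=> // s t; rewrite !in_itv /= => sl tl.
set e := h @` _.
have inl (x : R) : 0 <= x <= 1 -> 0 < s + (t - s) * x < len a.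
  by move=> xI; exact: convex_itv.
apply/eqP; rewrite eq_le; apply/andP; split.
  apply: (@le_trans _ _ (path_length (fun x => h (s + (t - s) * x)))).
    apply: ereal_inf_lbound; exists (fun x => h (s + (t - s) * x)) => //; split.
    + apply: contI_sub => x; apply: (@continuous_comp R R Y (fun x : R => s + (t - s) * x) h); last exact: ch.
      by apply: cvgD; [exact: cvg_cst|apply: cvgMr; exact: cvg_id].
    + by rewrite mulr0 addr0.
    + by rewrite mulr1 addrCA subrr addr0.
    + by move=> z [x /=]; rewrite in_itv /= => xI <-; exists (s + (t - s) * x) => //=; rewrite in_itv; exact: inl.
  apply: path_length_le => x y xI yI.
  apply: le_trans (is_lift_lip OEa lh (inl x xI) (inl y yI)) _.
  rewrite -normrM le_eqVlt; apply/orP; left; apply/eqP.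
  by rewrite -normrN; congr (`|_|); ring.
apply: le_ereal_inf_tmp => _ [k [kc k0 k1 ke] <-].
(* The parameter on the lifted arc of the point reached at time [x]. *)
pose th x := xget 0 [set u | 0 < u < len a /\ h u = k x].
have thP (x : R) : 0 <= x <= 1 -> 0 < th x < len a /\ h (th x) = k x.
  move=> xI; have [|u /= ul hu] := ke (k x); first by exists x => //=; rewrite in_itv.
  rewrite in_itv /= in ul; rewrite /th; case: xgetP => [v -> //|H].
  by exfalso; apply: (H u).
have I1 : 0 <= (1 : R) <= 1 by rewrite ler01 lexx.
have I0 : 0 <= (0 : R) <= 1 by rewrite ler01 lexx.
have -> : s = th 0.
  by have [? e0] := thP 0 I0; apply: (is_lift_inj OEa lh) => //; rewrite e0.
have -> : t = th 1.
  by have [? e0] := thP 1 I1; apply: (is_lift_inj OEa lh) => //; rewrite e0.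
apply: path_length_ge => x0 x0I; have [th0l hth0] := thP x0 x0I.
have [U eU Uz] := evenly_at covf (f (k x0)).
have [w sw wz] := sheet_at eU Uz; have [ow _ _ iw] := sw.
have [r r0 hr] := oe_local_coord modelV OEa th0l.
pose O := w `&` [set q | mdist (arc a (th x0)) (f q) < r].
have nO : nbhs (k x0) O.
  apply: filterI; first exact: open_nbhs_nbhs.
  have /metricType_numDomainType.cvgrPdist_lt/(_ _ r0) := @covering_continuous _ _ _ _ covf (k x0).
  by rewrite -hth0 fh.
have /within_continuousP/(_ x0) := kc; rewrite /= in_itv /= => /(_ x0I O nO) nk.
exists ([set x | `[0, 1]%classic x -> O (k x)], [set x | `[0, 1]%classic x -> O (k x)]) => //.
move=> [x y] /= [hx hy] xI yI.
have [|wx xr] := hx; first by rewrite in_itv.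
have [|wy yr] := hy; first by rewrite in_itv.
have [thx ex] := thP x xI; have [thy ey] := thP y yI.
rewrite -iw// -ex -ey !fh.
have xr' : `|th x0 - th x| < r.
  have [|v [vl av] dv] := hr (th x0) (f (k x)) th0l _ xr; first by rewrite subrr normr0.
  suff <- : v = th x by rewrite -dv.
  by apply: (oe_inj OEa vl thx); rewrite av -ex fh.
have [v [vl av] dv] := hr (th x) (f (k y)) thx xr' yr.
have vy : v = th y by apply: (oe_inj OEa vl thy); rewrite av -ey fh.
by rewrite -vy -dv -av.
Qed.

Definition proj_arc (a : oarc Y) : oarc G := Oarc (len a) (fun t => f (arc a t)).

Lemma proj_arc_rev (a : oarc Y) : proj_arc (rev a) = rev (proj_arc a).
Proof. by []. Qed.

Lemma oe_is_lift (a : oarc Y) : oriented_edges V' a -> is_lift (proj_arc a) (arc a).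
Proof.
move=> OEa; split=> //; first exact: oe_cont OEa.
  by move=> t /(oe_le0 OEa).
by move=> t /(oe_gel OEa).
Qed.

(** As [Y] may be noncompact, its oriented edges are obtained by lifting those of the compact base,
    not by completing ends in [Y]. *)
Lemma cover_edge q : ~ V' q -> exists2 a, oriented_edges V' a & support a q /\
  oriented_edges V (proj_arc a).
Proof.
move=> Vq; have [|b OEb sb] := @oe_exists _ _ _ modelV compactG
    (connected_component (~` V) (f q)); first by exists (f q).
have : support b (f q) by rewrite sb; exact: connected_component_refl.
move=> /supportP[u ul fu].
have [|h lh hu] := @lift_at b q u OEb _ (esym fu); first by case/andP: ul => /ltW-> /ltW.
have [_ fh _ _] := lh.
exists (Oarc (len b) h); first exact: is_lift_oe.
split; first by apply/supportP; exists u.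
by rewrite (_ : proj_arc _ = b)//; apply: oarc_eq => //= t; rewrite fh.
Qed.

Lemma oe_proj (a : oarc Y) : oriented_edges V' a -> oriented_edges V (proj_arc a).
Proof.
move=> OEa; have l0 := oe_len OEa.
have m0 : 0 < len a / 2 < len a by apply/andP; split; lra.
have [b OEb [sb OEpb]] := cover_edge (oe_notV OEa m0).
have sab : support a = support b.
  have sa : support a (arc a (len a / 2)) by apply/supportP; exists (len a / 2).
  exact: edges_disjoint (oe_edge OEa) (oe_edge OEb) sa sb.
have [->//|->] := oe_unique OEa OEb sab.
by rewrite proj_arc_rev; exact: oe_rev.
Qed.

Lemma oe_lift_ex b v : oriented_edges V b -> f v = source b ->
  exists2 a, oriented_edges V' a & source a = v /\ proj_arc a = b.
Proof.
move=> OEb fv; have [h lh h0] := lift_from_source OEb fv; have [_ fh _ _] := lh.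
exists (Oarc (len b) h); first exact: is_lift_oe.
by split=> //; apply: oarc_eq => //= t; rewrite fh.
Qed.

Lemma oe_lift_eq (a a' : oarc Y) : oriented_edges V' a -> oriented_edges V' a' ->
  source a = source a' -> proj_arc a = proj_arc a' -> a = a'.
Proof.
move=> OEa OEa' s p; have l := oe_is_lift OEa; have l' := oe_is_lift OEa'.
rewrite -p in l'; have e := is_lift_eq l l' s.
by apply: oarc_eq => [|t]; [move: p => -[]|rewrite e].
Qed.

Lemma cover_source (a : oarc Y) : oriented_edges V' a -> V' (source a).
Proof. by move=> /oe_proj /(oe_source_V modelV). Qed.

Lemma cover_target (a : oarc Y) : oriented_edges V' a -> V' (target a).
Proof. by move=> /oe_proj /(oe_target_V modelV). Qed.

Lemma closed_arc (a : oarc Y) : oriented_edges V' a -> closed (arc a @` `[0, len a]).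
Proof.
move=> OEa; apply: compact_closed; first exact: metric_hausdorff.
apply: continuous_compact; last exact: segment_compact.
exact/continuous_subspaceT/(oe_cont OEa).
Qed.

Lemma cover_out_finite v : finite_set (oriented_edges V) ->
  finite_set [set a | oriented_edges V' a /\ source a = v].
Proof.
move=> finOE; have inj : {in [set a | oriented_edges V' a /\ source a = v] &, injective proj_arc}.
  move=> a b /set_mem[OEa sa] /set_mem[OEb sb]; apply: oe_lift_eq => //.
  by rewrite sa sb.
rewrite -(eq_finite_set (inj_card_eq inj)).
by apply: sub_finite_set finOE => _ [a [OEa _] <-]; exact: oe_proj.
Qed.

Lemma cover_vertex_discrete v : V' v -> \forall q \near v, V' q -> q = v.
Proof.
move=> Vv; have [hV _ _] := modelV; have [N nN NV] := hV (f v) Vv.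
have [U eU Uz] := evenly_at covf (f v).
have [w sw wz] := sheet_at eU Uz; have [ow _ _ _] := sw.
have nf : \forall q \near v, N (f q) by exact: (@covering_continuous _ _ _ _ covf v).
apply: filterS2 (open_nbhs_nbhs (conj ow wz)) nf => q wq Nq Vq.
apply: (sheet_inj sw) => //.
by have : (N `&` V) (f q) by []; rewrite NV.
Qed.

Hypothesis graphY : metric_graph Y.

(** A geodesic from [v] shorter than the distance to the other vertices lies in a single edge once
    [v] is removed. The closed arc of that edge is closed in [Y], so it contains [v], which must be
    one of its ends. *)
Lemma cover_star v : V' v -> \forall q \near v, q = v \/
  exists2 a, oriented_edges V' a & source a = v /\ support a q.
Proof.
move=> Vv; have /nbhs_ballP[d /= d0 dP] := cover_vertex_discrete Vv.
have [r r0 hr] := metric_graph_geodesic graphY v.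
apply/nbhs_ballP; exists (Num.min d r); first by rewrite /= lt_min d0.
move=> q; rewrite ballEmdist /= lt_min => /andP[qd /hr[g [g0 gD gi]]].
have [->|/eqP qv] := pselect (q = v); [by left|right].
have D0 : 0 < mdist v q by rewrite mdist_gt0 eq_sym.
pose C := g @` `]0, mdist v q].
have dg t : 0 <= t <= mdist v q -> mdist v (g t) = t.
  move=> tD; rewrite -{1}g0 gi//; last by rewrite lexx ltW.
  by rewrite sub0r normrN ger0_norm//; case/andP: tD.
have CV : C `<=` ~` V'.
  move=> z [t /= + <-]; rewrite in_itv /= => /andP[t0 tD] Vt.
  have tD' : 0 <= t <= mdist v q by rewrite ltW.
  have e : g t = v by apply: dP => //; rewrite ballEmdist /= dg//; exact: le_lt_trans qd.
  by have := dg t tD'; rewrite e mdistxx => t00; rewrite -t00 ltxx in t0.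
have cC : connected C.
  apply: connected_continuous_connected; first exact/connected_intervalP/interval_is_interval.
  apply: continuous_lipschitz => s t /=; rewrite !in_itv /= => /andP[s0 sD] /andP[t0 tD].
  by rewrite gi// ltW.
have Cq : C q by exists (mdist v q) => //=; rewrite in_itv /= D0 lexx.
have [a OEa [aq _]] := cover_edge (CV _ Cq).
have Ca : C `<=` support a.
  by rewrite (edges_component (oe_edge OEa) aq); exact: connected_component_max.
have : (arc a @` `[0, len a]) v.
  apply: contrapT => nv; have oA := closed_openC (closed_arc OEa).
  have /nbhs_ballP[x /= x0 xP] := open_nbhs_nbhs (conj oA nv).
  pose t := Num.min (x / 2) (mdist v q).
  have [t0 tx tD] : [/\ 0 < t, t <= x / 2 & t <= mdist v q].
    by rewrite lt_min D0 divr_gt0//; split=> //; rewrite ge_min lexx ?orbT.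
  have /xP : ball v x (g t).
    by rewrite ballEmdist /= dg; [lra|rewrite tD ltW].
  apply; have /Ca/supportP[u /andP[u0 ul] <-] : C (g t).
    by exists t => //=; rewrite in_itv /= t0.
  by exists u => //=; rewrite in_itv /= !ltW.
move=> [u /=]; rewrite in_itv /= => /andP[u0 ul] av.
have [u0'|u0'] := leP u 0.
  by exists a => //; split=> //; rewrite -av (oe_le0 OEa).
have [ul'|ul'] := leP (len a) u.
  exists (rev a); first exact: oe_rev.
  by rewrite support_rev source_rev -av (oe_gel OEa).
by have := oe_notV OEa (t := u); rewrite u0' ul' av => /(_ isT).
Qed.

(* If only finitely many vertices were reachable, the compact union of the
   closed edges starting there would be open and closed. *)
Lemma reachable_infinite v (S : set Y) : finite_set (oriented_edges V) ->
  infinite_degree f -> S v -> S `<=` V' ->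
  (forall a : oarc Y, oriented_edges V' a -> S (source a) -> S (target a)) -> infinite_set S.
Proof.
move=> finOE infdeg Sv SV Sstep finS.
pose E := [set a | oriented_edges V' a /\ S (source a)].
have finE : finite_set E.
  apply: (@sub_finite_set _ _ (\bigcup_(w in S) [set a | oriented_edges V' a /\ source a = w])).
    by move=> a [OEa Sa]; exists (source a).
  by apply: bigcup_finite => // w _; exact: cover_out_finite.
pose Z := S `|` \bigcup_(a in E) (arc a @` `[0, len a]).
have cZ : closed Z.
  apply: closedU; first exact: (compact_closed (@metric_hausdorff _ _) (finite_compact finS)).
  by apply: closed_bigcup => // a [OEa _]; exact: closed_arc.
have star w : S w -> \forall q \near w, Z q.
  move=> Sw; apply: filterS (cover_star (SV _ Sw)) => z [->|[a OEa [sa /supportP[t /andP[t0 tl] <-]]]]; first by left.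
  by right; exists a; [split=> //; rewrite sa|exists t => //=; rewrite in_itv /= !ltW].
have ends (a : oarc Y) t : E a -> 0 <= t <= len a -> \forall q \near arc a t, Z q.
  move=> [OEa Sa] /andP[t0 tl].
  have [t0'|t0'] := leP t 0; first by rewrite (oe_le0 OEa)//; exact: star.
  have [tl'|tl'] := leP (len a) t.
    by rewrite (oe_gel OEa)//; apply: star; exact: Sstep.
  have lt : 0 < t < len (proj_arc a) by rewrite t0'.
  apply: filterS (is_lift_open (oe_proj OEa) (oe_is_lift OEa) lt) => z [s /andP[s0 sl] <-].
  by right; exists a => //; exists s => //=; rewrite in_itv /= !ltW.
have ZT : [set: Y] `<=` Z.
  have [cY _] := graphY.
  apply: (@connected_ind Y setT Z v cY I); first by left.
  - move=> q _ [Sq|[a Ea [t /= + <-]]]; first by apply: filterS (star q Sq) => z.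
    by rewrite in_itv /= => tl; apply: filterS (ends a t Ea tl) => z.
  - move=> q _ nq; have oZ : open (~` Z) by exact: closed_openC.
    by apply: filterS (open_nbhs_nbhs (conj oZ nq)) => z.
have finV : finite_set V'.
  apply: sub_finite_set finS => w Vw; have [//|[a [OEa Sa] [t /= + at_]]] := ZT w I.
  rewrite in_itv /= => /andP[t0 tl].
  have [t0'|t0'] := leP t 0; first by rewrite -at_ (oe_le0 OEa).
  have [tl'|tl'] := leP (len a) t; first by rewrite -at_ (oe_gel OEa)//; exact: Sstep.
  by have := oe_notV OEa (t := t); rewrite t0' tl' at_ => /(_ isT).
(* The fibre of [f v] is contained in the preimage of [V], now finite, but has one point in each of
   infinitely many sheets. *)
have [_ hc] := covf; have [U [W [oU Uv sW]]] := hc (f v).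
have Un : U !=set0 by exists (f v).
apply: (infdeg U W oU Un sW); have [tW _ hW] := sW.
pose c w := xget v [set z | w z /\ f z = f v].
have cP w : W w -> w (c w) /\ f (c w) = f v.
  move=> Ww; have [_ e _] := hW w Ww; have : (f @` w) (f v) by rewrite e.
  by move=> [z wz fz]; rewrite /c; case: xgetP => [x -> //|/(_ z)]; case.
have inj : {in W &, injective c}.
  move=> w w' /set_mem Ww /set_mem Ww' e; apply: (tW w w') => //.
  by exists (c w); split; [case: (cP w Ww)|rewrite e; case: (cP w' Ww')].
rewrite -(eq_finite_set (inj_card_eq inj)).
by apply: sub_finite_set finV => _ [w Ww <-]; rewrite /= (proj2 (cP w Ww)); exact: SV.
Qed.

End CoverArcs.

(** * Towers of Galois covers *)

Lemma mem_fset_set (T : choiceType) (A : set T) (a : T) : finite_set A ->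
  (a \in (fset_set A : seq T)) = (a \in A).
Proof. by move=> fA; rewrite -(in_fset_set fA). Qed.

Section ModelGraph.
Context {R : realType} {X : metricType R} (V : set X).

Definition outs (v : X) : seq (oarc X) :=
  fset_set [set a | oriented_edges V a /\ source a = v].

Hypothesis finout : forall v : X, finite_set [set a | oriented_edges V a /\ source a = v].
Lemma outsP v a : a \in outs v <-> oriented_edges V a /\ source a = v.
Proof.
by rewrite mem_fset_set; [split=> [/set_mem//|h]; apply/mem_set|exact: finout].
Qed.

Variable c : R.
Hypothesis c_gt0 : 0 < c.
Hypothesis outc : forall v, \sum_(a <- outs v) (len a)^-1 <= c / 2.

Definition model_graph : lfgraph R (oarc X) X :=
  @LFGraph R (oarc X) X (oriented_edges V) (@rev R X) source (@len R X) outs c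
    (fun a => @oe_rev R X V a) (fun a _ => revK a) (fun a => @oe_rev_neq R X V a)
    (fun a => @oe_len R X V a) (fun a _ => erefl) outsP (fun v => fset_uniq _) c_gt0 outc.

Lemma tgt_model a : tgt model_graph a = target a.
Proof. exact: source_rev. Qed.

End ModelGraph.

(** * Words of edges as paths, and coincidence of ends as membership in the subgroup *)

Section LoopProducts.
Context {R : realType} {X : metricType R}.

Lemma loop_mul0 (g h : R -> X) : loop_mul g h 0 = g 0.
Proof. by rewrite /loop_mul invr_ge0 ler0n mulr0. Qed.

Lemma loop_mul1 (g h : R -> X) : loop_mul g h 1 = h 1.
Proof.
have h2 : (1 <= 2^-1 :> R) = false by apply/negbTE; rewrite -ltNge invf_lt1 ?ltr1n.
by rewrite /loop_mul h2; congr (h _); ring.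
Qed.

End LoopProducts.

Section WordPaths.
Context {R : realType} {X : metricType R}.

Definition seg (b : oarc X) : R -> X := fun t => arc b (len b * t).

Fixpoint word_path (u : X) (p : seq (oarc X)) : R -> X :=
  if p is b :: q then loop_mul (seg b) (word_path (target b) q) else fun=> u.

End WordPaths.

Section SameEnd.
Context {R : realType} {Y X : metricType R} (f : Y -> X).

(** All starting points are quantified over, so the relation lives on the base; in a Galois cover a
    single starting point decides it, by [same_end_lift]. *)
Definition same_end (g h : R -> X) : Prop :=
  forall v z, lifts f g v z -> lifts f h v z.

Hypothesis covf : covering f.

Lemma contI_inv (g : R -> X) : contI g -> contI (loop_inv g).
Proof.
move=> cg; apply: within_clamp_comp => //.
  by move=> t; apply: cvgB; [exact: cvg_cst|exact: cvg_id].
by move=> t /andP[t0 t1]; apply/andP; split; lra.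
Qed.

Lemma lifts_mul_invP (g h : R -> X) y : contI g -> contI h -> g 0 = f y ->
  h 0 = f y -> g 1 = h 1 ->
  lifts f (loop_mul g (loop_inv h)) y y <-> exists2 z, lifts f g y z & lifts f h y z.
Proof.
move=> cg ch g0 h0 gh; split=> [l|[z lg lh]]; last exact: lifts_mul lg (lifts_inv lh).
have [z lg] := lifts_exists covf cg (esym g0); exists z => //.
have [||z' lh] := @lifts_exists _ _ _ f covf (loop_inv h) z; first exact: contI_inv.
  by rewrite /loop_inv subr0 -gh (lifts_end lg).
have e := lifts_unique covf l (lifts_mul lg lh); rewrite -e in lh.
have := lifts_inv lh; apply: lifts_eq => t _.
by rewrite /loop_inv opprB addrCA subrr addr0.
Qed.

Lemma loops_mul_inv (g h : R -> X) y : contI g -> contI h -> g 0 = f y ->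
  h 0 = f y -> g 1 = h 1 -> loops (f y) (loop_mul g (loop_inv h)).
Proof.
move=> cg ch g0 h0 gh; split=> //.
- by apply: loop_mul_continuous => //; [exact: contI_inv|rewrite /loop_inv subr0].
- by rewrite loop_mul0.
- by rewrite loop_mul1 /loop_inv subrr.
Qed.

Hypothesis normf : forall y, pi1_normal (f y) (pi1_image f y).
Hypothesis joinY : forall z z' : Y, joined z z'.

Lemma same_end_lift (g h : R -> X) v z : lifts f g v z -> lifts f h v z -> same_end g h.
Proof.
move=> lg lh v' z' lg'.
have g0 : g 0 = f v' := lifts_start lg'.
have h0 : h 0 = f v' by rewrite (lifts_start lh) -(lifts_start lg).
have gh : g 1 = h 1 by rewrite (lifts_end lg) (lifts_end lh).
have l : lifts f (loop_mul g (loop_inv h)) v v by exact: lifts_mul lg (lifts_inv lh).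
have e : f v = f v' by rewrite -g0 (lifts_start lg).
have := lifts_normal covf normf (joinY v v') e l.
move=> /(lifts_mul_invP (lifts_contI covf lg) (lifts_contI covf lh) g0 h0 gh)[z2 l1 l2].
by rewrite (lifts_unique covf lg' l1).
Qed.

(** The path [d] carries the comparison to the base point. Coincidence of ends becomes membership of
    one loop class in the subgroup, the form to which the convergence of the tower applies. *)
Lemma same_end_pi1 (d g h : R -> X) y : contI d -> contI g -> contI h -> d 0 = f y ->
  d 1 = g 0 -> d 1 = h 0 -> g 1 = h 1 ->
  same_end g h <->
  pi1_image f y (pi1_class (f y) (loop_mul (loop_mul d g) (loop_inv (loop_mul d h)))).
Proof.
move=> cd cg ch d0 dg dh gh.
have cdg : contI (loop_mul d g) by exact: loop_mul_continuous.
have cdh : contI (loop_mul d h) by exact: loop_mul_continuous.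
rewrite pi1_image_lifts//; last by apply: loops_mul_inv; rewrite ?loop_mul0 ?loop_mul1.
rewrite lifts_mul_invP ?loop_mul0 ?loop_mul1//.
have [v ld] := lifts_exists covf cd (esym d0).
have dv := lifts_end ld.
split=> [se|[z l1 l2]].
  have [||z lg] := @lifts_exists _ _ _ f covf g v => //; first by rewrite -dv.
  by exists z; apply: lifts_mul ld _ => //; exact: se.
have [||z1 lg] := @lifts_exists _ _ _ f covf g v => //; first by rewrite -dv.
have [||z2 lh] := @lifts_exists _ _ _ f covf h v => //; first by rewrite -dv.
apply: (same_end_lift lg); rewrite (lifts_unique covf (lifts_mul ld lg) l1).
by rewrite -(lifts_unique covf (lifts_mul ld lh) l2).
Qed.

End SameEnd.

(** * Stabilization along the tower *)

Section Tower.
Context {R : realType} {G G' : metricType R} {Gn : nat -> metricType R}.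
Variables (phi : G' -> G) (phin : forall n, Gn n -> G) (y : G') (yn : forall n, Gn n).
Arguments phin : clear implicits.
Hypothesis phi_galois : galois_cover phi.
Hypothesis phin_galois : forall n, galois_cover (phin n).
Hypothesis ascending : forall n, exists2 psi : Gn n.+1 -> Gn n,
  continuous psi & forall z, phin n.+1 z = phin n (psi z).
Hypothesis phin_yn : forall n, phin n (yn n) = phi y.
Hypothesis converging : \bigcap_n pi1_image (phin n) (yn n) = pi1_image phi y.
Hypothesis joinG : forall z z' : G, joined z z'.
Hypothesis joinG' : forall z z' : G', joined z z'.
Hypothesis joinGn : forall n (z z' : Gn n), joined z z'.

(** The map [psi] need not send [yn n.+1] to [yn n]; normality of the lower cover moves the closed
    lift to the right point of the fibre. *)
Lemma lifts_descend n g : lifts (phin n.+1) g (yn n.+1) (yn n.+1) ->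
  lifts (phin n) g (yn n) (yn n).
Proof.
move=> [h [ch fh h0 h1]]; have [psi cpsi e] := ascending n.
have [covn normn] := phin_galois n.
apply: (lifts_normal covn normn (z := psi (yn n.+1))); first exact: joinGn.
  by rewrite -e !phin_yn.
exists (psi \o h); split=> /=; rewrite ?h0 ?h1//.
  apply: (@within_continuous_comp R _ _ _ setT h psi) => //; exact: continuous_subspaceT.
by move=> t tI; rewrite -e fh.
Qed.

(** The subgroups decrease by [lifts_descend]: a class outside the intersection is missing from some
    level, and hence from all later ones. *)
Lemma pi1_image_near g : loops (phi y) g ->
  \forall n \near \oo, pi1_image (phin n) (yn n) (pi1_class (phi y) g) <->
    pi1_image phi y (pi1_class (phi y) g).
Proof.
move=> lg; have E n : pi1_image (phin n) (yn n) (pi1_class (phi y) g) <->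
    lifts (phin n) g (yn n) (yn n).
  rewrite -(phin_yn n); apply: pi1_image_lifts; last by rewrite phin_yn.
  by case: (phin_galois n).
have [h|h] := pselect (pi1_image phi y (pi1_class (phi y) g)).
  by apply: nearW => n; split=> // _; move: h; rewrite -converging => /(_ n I).
have [n0 hn0] : exists n0, ~ pi1_image (phin n0) (yn n0) (pi1_class (phi y) g).
  by apply/existsNP => hn; apply: h; rewrite -converging => n _; exact: hn.
exists n0 => // n /= n0n; split=> // /E hn; exfalso; apply: hn0; apply/E.
rewrite -(subnK n0n) in hn; elim: (n - n0)%N hn => [//|k IH hk]; apply: IH.
exact: lifts_descend.
Qed.

Lemma same_end_near (g h : R -> G) : contI g -> contI h -> g 0 = h 0 -> g 1 = h 1 ->
  \forall n \near \oo, same_end (phin n) g h <-> same_end phi g h.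
Proof.
move=> cg ch gh0 gh1; have [d [cd d0 d1]] := joinG (phi y) (g 0).
have [covp normp] := phi_galois.
have d1h : d 1 = h 0 by rewrite d1.
have cdg : contI (loop_mul d g) by apply: loop_mul_continuous.
have cdh : contI (loop_mul d h) by apply: loop_mul_continuous.
have := @pi1_image_near (loop_mul (loop_mul d g) (loop_inv (loop_mul d h))).
move=> [|n0 _ hn]; first by apply: loops_mul_inv; rewrite ?loop_mul0 ?loop_mul1.
exists n0 => // n /hn; have [covn normn] := phin_galois n.
rewrite -(same_end_pi1 covp)// => <-; rewrite -(phin_yn n).
by apply: same_end_pi1 => //; rewrite phin_yn.
Qed.


(** The first clause concerns the base only. When it holds, the two word paths bound a loop, and the
    second clause is a condition on the subgroup of the cover. *)
Definition end_rel {Y X : metricType R} (f : Y -> X) (u : X) (p q : seq (oarc X)) : bool :=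
  `[< last u (map target p) = last u (map target q) >] &&
  `[< same_end f (word_path u p) (word_path u q) >].

End Tower.

(** * The weighted graphs of the base and of a cover *)

Section CoverModel.
Context {R : realType} {Y G : metricType R} (f : Y -> G) (V : set G).
Hypothesis galf : galois_cover f.
Hypothesis modelV : vertex_set V.
Hypothesis graphG : metric_graph G.
Hypothesis compactG : compact [set: G].
Hypothesis graphY : metric_graph Y.
Local Notation V' := (f @^-1` V).

Let covf : covering f. Proof. by case: galf. Qed.
Let normf : forall y, pi1_normal (f y) (pi1_image f y). Proof. by case: galf. Qed.
Let finOE : finite_set (oriented_edges V). Proof. exact: oe_finite. Qed.

Lemma metric_graph_joined (X : metricType R) : metric_graph X ->
  forall z z' : X, joined z z'.
Proof.
move=> gX; apply: path_connected; first by case: gX.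
exact: metric_graph_geodesic.
Qed.

Let joinY : forall z z' : Y, joined z z'. Proof. exact: metric_graph_joined. Qed.

Lemma base_out_finite u : finite_set [set a | oriented_edges V a /\ source a = u].
Proof. by apply: sub_finite_set finOE => a []. Qed.

Let cover_outs_finite v : finite_set [set a | oriented_edges V' a /\ source a = v].
Proof. exact: (cover_out_finite covf modelV compactG). Qed.

(** Depends on the base alone. Stars of a cover map bijectively to stars of the base, so the same
    constant is admissible for all covers, whose operators can then be compared. The [+ 1] makes it
    positive even without edges. *)
Definition base_cst : R := 2 * \sum_(b <- fset_set (oriented_edges V)) (len b)^-1 + 1.

Lemma base_cst_gt0 : 0 < base_cst.
Proof.
rewrite ltr_wpDl// mulr_ge0// big_seq sumr_ge0// => b.
by rewrite mem_fset_set// => /set_mem/oe_len/ltW; rewrite invr_ge0.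
Qed.

Lemma outs_base u : \sum_(b <- outs V u) (len b)^-1 <= base_cst / 2.
Proof.
apply: (@le_trans _ _ (\sum_(b <- fset_set (oriented_edges V)) (len b)^-1)); last first.
  by rewrite /base_cst; lra.
apply: ler_sum_subset; [exact: fset_uniq|exact: fset_uniq| |].
- move=> b /(outsP base_out_finite)[OEb _]; rewrite mem_fset_set//; exact/mem_set.
- by move=> b; rewrite mem_fset_set// => /set_mem/oe_len/ltW; rewrite invr_ge0.
Qed.

Lemma outs_proj v : perm_eq (map (proj_arc f) (outs V' v)) (outs V (f v)).
Proof.
apply: uniq_perm; last 1 first.
- move=> b; apply/mapP/idP => [[a av ->]|].
    have [OEa <-] := (outsP cover_outs_finite v a).1 av.
    apply/(outsP base_out_finite); split=> //.
    exact: (oe_proj covf modelV compactG).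
  move=> /(outsP base_out_finite)[OEb sb].
  have [a OEa [sa pa]] := oe_lift_ex covf modelV OEb (esym sb).
  by exists a => //; apply/(outsP cover_outs_finite).
- rewrite map_inj_in_uniq ?fset_uniq// => a a'.
  move=> /(outsP cover_outs_finite)[OEa sa] /(outsP cover_outs_finite)[OEa' sa'].
  by apply: (oe_lift_eq covf OEa OEa'); rewrite sa sa'.
- exact: fset_uniq.
Qed.

Lemma outs_cover v : \sum_(a <- outs V' v) (len a)^-1 <= base_cst / 2.
Proof.
apply: le_trans (outs_base (f v)).
by rewrite -(perm_big _ (outs_proj v)) big_map.
Qed.

Definition base_graph := model_graph base_out_finite base_cst_gt0 outs_base.
Definition cover_graph := model_graph cover_outs_finite base_cst_gt0 outs_cover.

Lemma walk_lifts v p : wpath base_graph (f v) p ->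
  lifts f (word_path (f v) p) v (walk cover_graph (proj_arc f) v p).
Proof.
elim: p v => [|b p IH] v /=.
  by move=> _; exists (fun=> v); split=> //; exact/continuous_subspaceT/cst_continuous.
move=> /andP[bo wp]; have {}wp : wpath base_graph (target b) p by rewrite -source_rev.
have bo' := bo; rewrite -(perm_mem (outs_proj v)) in bo'.
have /mapP[a av ba] := bo'.
have av' : a \in gout cover_graph v by [].
have [OEa sa] := (outsP cover_outs_finite v a).1 av.
have ea : act cover_graph (proj_arc f) v b = target a.
  rewrite ba (@act_pe _ _ _ _ _ base_graph cover_graph (proj_arc f) f)//; last exact: outs_proj.
  exact: tgt_model.
rewrite ea; apply: (@lifts_mul _ _ _ _ _ _ _ (target a)).
  rewrite ba; exists (fun t => arc a (len a * t)); split=> //; last first.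
  - by rewrite mulr1.
  - by rewrite mulr0.
  apply: contI_sub => t; apply: (@continuous_comp R R Y (fun t : R => len a * t) (arc a)).
    by apply: cvgMr; exact: cvg_id.
  exact: (oe_cont OEa).
have fe : f (target a) = target b by rewrite ba.
by rewrite -fe; apply: IH; rewrite fe.
Qed.

Lemma wend_last u p : wend base_graph u p = last u (map target p).
Proof.
by rewrite /wend; congr last; apply: eq_map => b; exact: tgt_model.
Qed.

(** This provides [normalR] in the comparison of graphs. The left side depends only on [f v]; that
    the right side does too is the Galois condition. *)
Lemma end_rel_walk v p q : wpath base_graph (f v) p -> wpath base_graph (f v) q ->
  end_rel f (f v) p q =
    (walk cover_graph (proj_arc f) v p == walk cover_graph (proj_arc f) v q).
Proof.
move=> wp wq; have lp := walk_lifts wp; have lq := walk_lifts wq.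
have end_ r : wpath base_graph (f v) r -> f (walk cover_graph (proj_arc f) v r) =
    last (f v) (map target r).
  move=> wr; rewrite -wend_last.
  by apply: (@pv_walk _ _ _ _ _ base_graph cover_graph (proj_arc f) f) => //; exact: outs_proj.
apply/andP/eqP => [[_ /asboolP se]|e].
  exact: (lifts_unique covf (se _ _ lp) lq).
split; apply/asboolP; first by rewrite -!end_// e.
by apply: (same_end_lift covf normf joinY lp); rewrite e.
Qed.

End CoverModel.

Fixpoint words (T : Type) (E : seq T) (n : nat) : seq (seq T) :=
  if n is m.+1 then [::] :: [seq b :: p | b <- E, p <- words E m] else [:: [::]].

Lemma mem_words (T : eqType) (E : seq T) n p :
  {subset p <= E} -> (size p <= n)%N -> p \in words E n.
Proof.
elim: n p => [|n IH] [|b p] //= sp sz; rewrite inE /=; apply/allpairsP.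
exists (b, p); split=> //=; first by apply: sp; rewrite mem_head.
by apply: IH => // a ap; apply: sp; rewrite inE ap orbT.
Qed.

Lemma wpath_sub (R : realType) (T U : choiceType) (g : lfgraph R T U) (u : U) p :
  wpath g u p -> forall b, b \in p -> gD g b.
Proof.
elim: p u => [//|b p IH] u /= /andP[/goutP[Db _] wp] a.
by rewrite inE => /orP[/eqP->|/(IH _ wp)].
Qed.

Section AmpRv.
Context {R : realType} {T U : choiceType} (g : lfgraph R T U).

Lemma amp_rv e j : gD g e -> amp g (grv g e) j = amp g e j.
Proof.
move=> De; have De' := gDrv De; elim: j => [|j IH].
  by rewrite /amp /= /edge_form !eqxx (grvK De) eq_sym.
have h := amp_step De j; have h' := amp_step De' j.
rewrite /tgt grvK// glen_rv// -/(tgt g e) in h'.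
have e1 : amp g (grv g e) j - amp g (grv g e) j.+1 = amp g e j - amp g e j.+1.
  by rewrite h' h /tgt; congr (_ / _); ring.
by move: e1; rewrite IH => /addrI/oppr_inj.
Qed.

Lemma amp_lim_rv e : gD g e -> amp_lim g (grv g e) = amp_lim g e.
Proof. by move=> De; rewrite /amp_lim; under eq_fun do rewrite amp_rv//. Qed.

End AmpRv.

Section Agreement.
Context {R : realType} {T0 U0 : choiceType} (g0 : lfgraph R T0 U0).
Variables (R1 R2 : U0 -> seq T0 -> seq T0 -> bool) (Vs : seq U0) (L : nat).
Hypothesis srcVs : forall b, gD g0 b -> gsrc g0 b \in Vs.
Hypothesis agree : forall u p q, u \in Vs -> wpath g0 u p -> wpath g0 u q ->
  (size p <= L)%N -> (size q <= L)%N -> R1 u p q = R2 u p q.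

Lemma wdiag_agree j u : u \in Vs -> (j <= L)%N -> wdiag g0 R1 j u = wdiag g0 R2 j u.
Proof. by move=> uV jL; apply: (@wker_agree _ _ _ _ _ _ _ L) => // p q; exact: agree. Qed.

Lemma wstep_agree j b : gD g0 b -> (j < L)%N -> wstep g0 R1 j b = wstep g0 R2 j b.
Proof.
move=> Db jL; apply: (@wker_agree _ _ _ _ _ _ _ L) => // [p q|].
  by apply: agree; exact: srcVs.
by rewrite /= andbT; apply/goutP.
Qed.

Lemma wamp_agree j b : gD g0 b -> (j <= L)%N -> wamp g0 R1 j b = wamp g0 R2 j b.
Proof.
move=> Db jL; rewrite /wamp; congr (1 - _); apply: eq_bigr => i _.
have iL : (i < L)%N by exact: leq_trans jL.
have Db' := gDrv Db; rewrite /wdiff !wstep_agree//.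
rewrite !wdiag_agree//; try exact: ltnW; exact: srcVs.
Qed.

End Agreement.

Section Bracket.
Context {R : realType} {Y G : metricType R} (f : Y -> G) (V : set G).
Hypothesis galf : galois_cover f.
Hypothesis modelV : vertex_set V.
Hypothesis graphG : metric_graph G.
Hypothesis compactG : compact [set: G].
Hypothesis graphY : metric_graph Y.
Variable y : Y.
Local Notation V' := (f @^-1` V).
Local Notation g0 := (base_graph modelV graphG compactG).
Local Notation g := (cover_graph galf modelV graphG compactG).

Definition base_vertices : seq G := undup (map source (fset_set (oriented_edges V))).

Let finOE : finite_set (oriented_edges V). Proof. exact: oe_finite. Qed.
Let covf : covering f. Proof. by case: galf. Qed.

Lemma base_verticesP u : u \in base_vertices <->
  exists2 b, oriented_edges V b & source b = u.
Proof.
rewrite mem_undup; split=> [/mapP[b]|[b OEb <-]].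
  by rewrite mem_fset_set// => /set_mem ? ->; exists b.
by apply: map_f; rewrite mem_fset_set//; apply/mem_set.
Qed.

Lemma cover_surj u : exists v, f v = u.
Proof.
have [d [cd d0 d1]] := metric_graph_joined graphG (f y) u.
have [v lv] := lifts_exists covf cd (esym d0); exists v.
by rewrite -d1 (lifts_end lv).
Qed.

Lemma oe_lift b : oriented_edges V b -> exists2 a, oriented_edges V' a & proj_arc f a = b.
Proof.
move=> OEb; have [v fv] := cover_surj (source b).
by have [a OEa [_ pa]] := oe_lift_ex covf modelV OEb fv; exists a.
Qed.

Let pe_src (a : oarc Y) : gD g a -> gsrc g0 (proj_arc f a) = f (gsrc g a).
Proof. by []. Qed.

Let norm_end v p q : wpath g0 (f v) p -> wpath g0 (f v) q ->
  end_rel f (f v) p q = (walk g (proj_arc f) v p == walk g (proj_arc f) v q).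
Proof. exact: end_rel_walk. Qed.

Let po v : perm_eq (map (proj_arc f) (gout g v)) (gout g0 (f v)).
Proof. exact: outs_proj. Qed.

Lemma cover_bracket (a : oarc Y) k : oriented_edges V' a ->
  wamp g0 (end_rel f) k.*2 (proj_arc f a)
    - 2 * \sum_(u <- base_vertices) wdiag g0 (end_rel f) k.*2 u <= amp_lim g a
    <= wamp g0 (end_rel f) k.*2 (proj_arc f a).
Proof.
move=> OEa; apply: (amp_lim_bracket (g0 := g0) (g := g) (pe := proj_arc f) (pv := f)) => //.
- exact: undup_uniq.
- by move=> b Db; apply/base_verticesP; exists b.
- exact: oe_lift.
- by move=> u _; exact: cover_surj.
Qed.

Lemma cover_wdiag j v : ker g j v v = wdiag g0 (end_rel f) j (f v).
Proof. exact: (ker_wdiag (g0 := g0) (g := g) (pe := proj_arc f) (pv := f)). Qed.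

Lemma cover_wdiag_vanish : infinite_degree f ->
  (fun k => \sum_(u <- base_vertices) wdiag g0 (end_rel f) k.*2 u) @ \oo --> (0 : R).
Proof.
move=> inff.
have z : \sum_(u <- base_vertices) (0 : R) = 0 by rewrite big1.
rewrite -{2}z [in X in _ --> X]big_seq; under eq_fun do rewrite big_seq.
apply: cvg_big => [|u]; [exact: add_continuous|] => /base_verticesP[b OEb bu].
have [v fv] := cover_surj u; rewrite -fv.
under eq_fun do rewrite -cover_wdiag.
apply: ker_vanish.
have Vv : V' v by rewrite /= fv -bu; exact: (oe_source_V modelV).
apply: (reachable_infinite covf modelV compactG graphY (v := v) finOE inff).
- by move=> S Sv _.
- move=> w; apply => // a OEa _; rewrite tgt_model.
  exact: (cover_target covf modelV compactG).
- move=> a OEa Sa S Sv hS; rewrite -(tgt_model (cover_out_finite covf modelV compactG ^~ finOE)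
    (base_cst_gt0 modelV graphG compactG) (outs_cover galf modelV graphG compactG)).
  by apply: (hS a OEa); exact: (Sa S Sv hS).
Qed.

End Bracket.

(** * Comparison of the covers of the tower with the infinite cover *)

Section Limit.
Context {R : realType} {G G' : metricType R} {Gn : nat -> metricType R}.
Variables (phi : G' -> G) (phin : forall n, Gn n -> G) (y : G') (yn : forall n, Gn n).
Arguments phin : clear implicits.
Variable V : set G.
Hypothesis graphG : metric_graph G.
Hypothesis compactG : compact [set: G].
Hypothesis graphG' : metric_graph G'.
Hypothesis graphGn : forall n, metric_graph (Gn n).
Hypothesis phi_galois : galois_cover phi.
Hypothesis phi_infinite : infinite_degree phi.
Hypothesis phin_galois : forall n, galois_cover (phin n).
Hypothesis ascending : forall n, exists2 psi : Gn n.+1 -> Gn n,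
  continuous psi & forall z, phin n.+1 z = phin n (psi z).
Hypothesis phin_yn : forall n, phin n (yn n) = phi y.
Hypothesis converging : \bigcap_n pi1_image (phin n) (yn n) = pi1_image phi y.
Hypothesis modelV : vertex_set V.
Local Notation g0 := (base_graph modelV graphG compactG).
Local Notation g' := (cover_graph phi_galois modelV graphG compactG).
Local Notation gn n := (cover_graph (phin_galois n) modelV graphG compactG).

Lemma end_rel_near u p q : wpath g0 u p -> wpath g0 u q ->
  \forall n \near \oo, end_rel (phin n) u p q = end_rel phi u p q.
Proof.
move=> wp wq; have [v fv] := cover_surj phi_galois graphG y u; subst u.
have lp := walk_lifts phi_galois wp; have lq := walk_lifts phi_galois wq.
have [covp _] := phi_galois.
rewrite /end_rel; case: (asboolP (last _ _ = _)) => [e|_]; last by apply: nearW.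
have e0 : word_path (phi v) p 0 = word_path (phi v) q 0.
  by rewrite (lifts_start lp) (lifts_start lq).
have end_ r : wpath g0 (phi v) r -> word_path (phi v) r 1 = last (phi v) (map target r).
  move=> wr; rewrite (lifts_end (walk_lifts phi_galois wr)) -(wend_last modelV graphG compactG).
  apply: (@pv_walk _ _ _ _ _ g0 g' (proj_arc phi) phi) => //.
  exact: outs_proj.
have e1 : word_path (phi v) p 1 = word_path (phi v) q 1 by rewrite !end_.
have := same_end_near phi_galois phin_galois ascending phin_yn converging
  (metric_graph_joined graphG) (metric_graph_joined graphG')
  (fun n => metric_graph_joined (graphGn n)) (lifts_contI covp lp) (lifts_contI covp lq) e0 e1.
apply: filterS => n h; congr (_ && _).
by apply/asboolP/asboolP => /h.
Qed.

(** There are finitely many words of bounded length in the finitely many edges, so the eventual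
    agreements for single pairs hold simultaneously. *)
Lemma end_rel_agree L : \forall n \near \oo, forall u p q, u \in base_vertices V ->
  wpath g0 u p -> wpath g0 u q -> (size p <= L)%N -> (size q <= L)%N ->
  end_rel (phin n) u p q = end_rel phi u p q.
Proof.
have finOE : finite_set (oriented_edges V) by exact: oe_finite.
pose W := words (fset_set (oriented_edges V)) L.
have memW u p : wpath g0 u p -> (size p <= L)%N -> p \in W.
  move=> wp sp; apply: mem_words => // b /(wpath_sub wp) OEb.
  by rewrite mem_fset_set//; apply/mem_set.
have h : \forall n \near \oo, forall u, u \in base_vertices V -> forall p, p \in W ->
    forall q, q \in W -> wpath g0 u p -> wpath g0 u q ->
    end_rel (phin n) u p q = end_rel phi u p q.
  apply: near_all_seq => u _; apply: near_all_seq => p _; apply: near_all_seq => q _.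
  case: (boolP (wpath g0 u p)) => wp; last by apply: nearW.
  case: (boolP (wpath g0 u q)) => wq; last by apply: nearW.
  by apply: filterS (end_rel_near wp wq).
apply: filterS h => n h u p q uV wp wq sp sq; apply: h => //.
  exact: memW wp sp.
exact: memW wq sq.
Qed.

Lemma amp_lim_near eps : 0 < eps -> \forall n \near \oo, forall a a',
  oriented_edges (phin n @^-1` V) a -> oriented_edges (phi @^-1` V) a' ->
  proj_arc (phin n) a = proj_arc phi a' -> `|amp_lim (gn n) a - amp_lim g' a'| <= eps.
Proof.
move=> e0.
(* The time [k] is fixed on the infinite cover alone, with [2 s < eps]. For large [n] the diagonal
   sum at that finite cover is the same number [s], so both limits lie in one interval of length
   [2 s]. *)
have /cvgrPdist_lt/(_ (eps / 2)) := cover_wdiag_vanish phi_galois modelV graphG compactG graphG' y phi_infinite.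
rewrite divr_gt0// => /(_ isT)[k _ /(_ k (leqnn k))] /=.
set s := \sum_(u <- _) _; rewrite sub0r normrN => /(le_lt_trans (ler_norm _)) hs.
apply: filterS (end_rel_agree k.*2) => n ag a a' OEa OEa' paa'.
have /andP[h1 h2] := cover_bracket (phin_galois n) modelV graphG compactG (graphGn n) (yn n) k OEa.
have /andP[h3 h4] := cover_bracket phi_galois modelV graphG compactG graphG' y k OEa'.
have srcV b : gD g0 b -> gsrc g0 b \in base_vertices V.
  by move=> Db; apply/(base_verticesP modelV graphG compactG); exists b.
have OEb : oriented_edges V (proj_arc phi a').
  by have [c _] := phi_galois; exact: (oe_proj c modelV compactG).
have es : \sum_(u <- base_vertices V) wdiag g0 (end_rel (phin n)) k.*2 u = s.
  by apply: eq_big_seq => u uV; exact: (wdiag_agree ag uV).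
have ew : wamp g0 (end_rel (phin n)) k.*2 (proj_arc (phin n) a) =
    wamp g0 (end_rel phi) k.*2 (proj_arc phi a').
  by rewrite paa'; exact: (wamp_agree srcV ag OEb).
rewrite es ew in h1 h2; rewrite -/s in h3.
rewrite ler_norml; apply/andP; split; lra.
Qed.

End Limit.

(** * Harmonic forms of a model *)

Section AbsoluteSums.
Context {R : realType} {T : choiceType} (D : set T).
Implicit Types (s B : seq T) (F : T -> R).

Definition seq_in s : Prop := uniq s /\ {in s, forall a, D a}.

Lemma esum_seq_ge F s : (forall i, D i -> 0 <= F i) -> seq_in s ->
  ((\sum_(i <- s) F i)%:E <= \esum_(i in D) (F i)%:E)%E.
Proof.
move=> F0 [us sD]; apply: esum_ge; exists [set` s].
  by split; [exact: finite_seq|move=> i /= /sD].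
by rewrite -fsbig_seq// sumEFin.
Qed.

Lemma esum_seq_le F (M : R) : (forall s, seq_in s -> \sum_(i <- s) F i <= M) ->
  (\esum_(i in D) (F i)%:E <= M%:E)%E.
Proof.
move=> h; apply: ge_ereal_sup => _ [X [fX XD] <-].
rewrite fsbig_finite//= sumEFin lee_fin; apply: h; split; first exact: fset_uniq.
by move=> i; rewrite mem_fset_set// => /set_mem/XD.
Qed.

Lemma esum_approx F (M delta : R) : (forall i, D i -> 0 <= F i) ->
  (forall s, seq_in s -> \sum_(i <- s) F i <= M) -> 0 < delta ->
  exists2 B, seq_in B & forall s, seq_in s -> {subset B <= s} ->
    `|\sum_(i <- s) F i - fine (\esum_(i in D) (F i)%:E)| <= delta.
Proof.
move=> F0 FM d0; set S := esum _ _.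
have S0 : (0 <= S)%E by apply: esum_ge0 => i Di; rewrite lee_fin F0.
have SM : (S <= M%:E)%E := esum_seq_le FM.
have Sfin : S \is a fin_num by rewrite ge0_fin_numE// (le_lt_trans SM)// ltry.
have [_ [X [fX XD] <-]] := ub_ereal_sup_adherent d0 Sfin.
rewrite -/(esum D _) -/S -{1}(fineK Sfin) -EFinB fsbig_finite//= sumEFin lte_fin => hX.
have XB : seq_in (fset_set X).
  by split; [exact: fset_uniq|move=> i; rewrite mem_fset_set// => /set_mem/XD].
exists (fset_set X) => // s [us sD] Bs.
have h1 : \sum_(i <- s) F i <= fine S.
  by rewrite -lee_fin fineK// esum_seq_ge.
have h2 : \sum_(i <- fset_set X) F i <= \sum_(i <- s) F i.
  by apply: ler_sum_subset => //; move=> i /sD/F0.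
by rewrite ler_norml; apply/andP; split; lra.
Qed.

(** Gives access to the pairing through finite sums over large sets; the positive and the negative
    part are each approximated within [delta / 2]. *)
Lemma abs_sum_approx F (M delta : R) :
  (forall s, seq_in s -> \sum_(i <- s) `|F i| <= M) -> 0 < delta ->
  exists2 B, seq_in B & forall s, seq_in s -> {subset B <= s} ->
    `|\sum_(i <- s) F i - abs_sum D F| <= delta.
Proof.
move=> FM d0.
have d2 : 0 < delta / 2 by rewrite divr_gt0.
have [||B1 [uB1 DB1] h1] := @esum_approx (fun i => Num.max (F i) 0) M _ _ _ d2.
- by move=> i _; rewrite le_max lexx orbT.
- move=> s ss; apply: le_trans (FM s ss); apply: ler_sum => i _.
  by rewrite ge_max normr_ge0 ler_norm.
have [||B2 [uB2 DB2] h2] := @esum_approx (fun i => Num.max (- F i) 0) M _ _ _ d2.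
- by move=> i _; rewrite le_max lexx orbT.
- move=> s ss; apply: le_trans (FM s ss); apply: ler_sum => i _.
  by rewrite ge_max normr_ge0 -normrN ler_norm.
exists (undup (B1 ++ B2)).
  split; first exact: undup_uniq.
  by move=> i; rewrite mem_undup mem_cat => /orP[/DB1|/DB2].
move=> s ss Bs; rewrite /abs_sum.
have {}h1 := h1 s ss (fun i iB => Bs i (etrans (mem_undup _ _) (etrans (mem_cat _ _ _) (introT orP (or_introl iB))))).
have {}h2 := h2 s ss (fun i iB => Bs i (etrans (mem_undup _ _) (etrans (mem_cat _ _ _) (introT orP (or_intror iB))))).
have -> : \sum_(i <- s) F i = \sum_(i <- s) Num.max (F i) 0 - \sum_(i <- s) Num.max (- F i) 0.
  rewrite -sumrB; apply: eq_bigr => i _.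
  have [F0|F0] := leP (F i) 0.
    by rewrite [Num.max (- _) _]max_l ?oppr_ge0// opprK add0r.
  by rewrite max_r ?subr0// oppr_le0 ltW.
move: h1 h2; rewrite !ler_norml => /andP[h1 h1'] /andP[h2 h2'].
by apply/andP; split; lra.
Qed.

End AbsoluteSums.

Section Orientation.
Context {R : realType} {X : metricType R} (V : set X).
Local Notation OE := (oriented_edges V).
Local Notation orn := (orientation V).

(** Choosing one arc for each support gives an orientation, so the choice in [orientation] returns a
    genuine one. *)
Lemma orientationP : is_orientation V orn.
Proof.
suff h : exists P, is_orientation V P by exact: (xgetPex set0 h).
have [[a0 _]|none] := pselect (exists a : oarc X, OE a); last first.
  by exists set0; split=> // a OEa; exfalso; apply: none; exists a.
pose r e := xget a0 [set b | OE b /\ support b = e].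
exists [set a | OE a /\ a = r (support a)]; split=> [a []//|a OEa].
have [OEr sr] : OE (r (support a)) /\ support (r (support a)) = support a.
  by apply: (xgetPex a0 (P := [set b | OE b /\ support b = support a])); exists a.
have nra := oe_rev_neq OEa.
rewrite /= support_rev; split=> [[_ e] [_ e']|nO].
  by move: nra; rewrite e -e' eqxx.
split; first exact: oe_rev.
have [e|->//] := oe_unique OEr OEa sr.
by exfalso; apply: nO.
Qed.

Lemma orn_oe a : orn a -> OE a. Proof. by case: orientationP => + _; apply. Qed.

Lemma orn_rev a : OE a -> orn (rev a) <-> ~ orn a.
Proof. by case: orientationP => _; apply. Qed.

Lemma orn_total a : OE a -> orn a \/ orn (rev a).
Proof.
move=> OEa; have [|n] := pselect (orn a); first by left.
by right; apply/orn_rev.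
Qed.

End Orientation.

(** * The projection of an edge form in a model *)

Section HarmonicForms.
Context {R : realType} {X : metricType R} (V : set X).
Local Notation OE := (oriented_edges V).
Local Notation orn := (orientation V).
Hypothesis srcV : forall a : oarc X, OE a -> V (source a).
Hypothesis finout : forall v : X, finite_set [set a | OE a /\ source a = v].
Variable c : R.
Hypothesis c_gt0 : 0 < c.
Hypothesis outc : forall v : X, \sum_(a <- outs V v) (len a)^-1 <= c / 2.
Local Notation g := (model_graph finout c_gt0 outc).
Implicit Types (w h k : oarc X -> R) (s : seq (oarc X)).

Lemma coef_anti w : C1 V w -> antisym g (coef w).
Proof. by move=> cw a OEa; rewrite /coef /= cw// mulNr. Qed.

(** The edges of the orientation that end at [v] are the reversals of the outgoing edges at [v]
    which the orientation omits. *)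
Lemma sum_ends (z : oarc X -> R) v : antisym g z ->
  \sum_(a \in [set a | orn a /\ target a = v]) z a -
  \sum_(a \in [set a | orn a /\ source a = v]) z a = - bdry g z v.
Proof.
move=> az; rewrite /bdry /= [in RHS](bigID (fun a => `[< orn a >])) /=.
have -> : \sum_(a \in [set a | orn a /\ source a = v]) z a =
    \sum_(a <- outs V v | `[< orn a >]) z a.
  rewrite -[RHS]big_filter; apply/esym; rewrite [RHS](fsbigE [seq a <- outs V v | `[< orn a >]])//.
  - rewrite [RHS]big_mkcond big_seq [RHS]big_seq; apply: eq_bigr => a.
    rewrite mem_filter => /andP[/asboolP oa /(outsP finout)[_ sa]].
    by rewrite mem_set.
  - by rewrite filter_uniq// fset_uniq.
  - by move=> a /=; rewrite mem_filter => /andP[/asboolP oa /(outsP finout)[_ sa]].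
  - move=> a [oa sa] /negP na; exfalso; apply: na; rewrite mem_filter; apply/andP.
    by split; [exact/asboolP|apply/(outsP finout); split=> //; exact: orn_oe].
have -> : \sum_(a \in [set a | orn a /\ target a = v]) z a =
    - \sum_(a <- outs V v | ~~ `[< orn a >]) z a.
  rewrite -[in RHS]big_filter -sumrN.
  rewrite (fsbigE (map (@rev R X) [seq a <- outs V v | ~~ `[< orn a >]])); last first.
  - move=> a [oa ta] /negP na; exfalso; apply: na; apply/mapP; exists (rev a); last by rewrite revK.
    have OEa := orn_oe oa; rewrite mem_filter; apply/andP; split.
      by apply/negP => /asboolP/(orn_rev OEa); exact.
    by apply/(outsP finout); split; [exact: oe_rev|rewrite source_rev].
  - move=> _ /= /mapP[a + ->]; rewrite mem_filter => /andP[/asboolP oa /(outsP finout)[OEa sa]].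
    by rewrite target_rev; split=> //; apply/orn_rev.
  - rewrite map_inj_uniq; first by rewrite filter_uniq// fset_uniq.
    by move=> a b e; rewrite -(revK a) e revK.
  rewrite big_map big_mkcond big_seq [RHS]big_seq; apply: eq_bigr => a.
  rewrite mem_filter => /andP[/asboolP oa /(outsP finout)[OEa sa]].
  rewrite mem_set; first exact: az.
  by split; [exact/orn_rev|rewrite target_rev].
by rewrite opprD addrC.
Qed.

Lemma harmonic_bdry w : C1 V w -> harmonic V w <-> forall v, bdry g (coef w) v = 0.
Proof.
move=> cw; have az := coef_anti cw; split=> [hw v|b0 v _]; last first.
  by rewrite sum_ends// b0 oppr0.
have [Vv|nVv] := pselect (V v).
  by apply/eqP; rewrite -oppr_eq0 -sum_ends//; apply/eqP/hw.
(* No edge starts at a point outside [V], so the boundary there is an empty sum. *)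
rewrite /bdry big_seq big1// => a /(outsP finout)[OEa sa].
by exfalso; apply: nVv; rewrite -sa; exact: srcV.
Qed.

Lemma L2_bound w : L2 V w <-> C1 V w /\ exists M : R, forall s, seq_in orn s ->
  \sum_(a <- s) coef w a ^+ 2 * len a <= M.
Proof.
have F0 (a : oarc X) : orn a -> 0 <= coef w a ^+ 2 * len a.
  by move=> /orn_oe/oe_len/ltW l0; rewrite mulr_ge0// sqr_ge0.
split=> [[cw lw]|[cw [M hM]]]; split=> //.
  have S0 : (0 <= \esum_(a in orn) (coef w a ^+ 2 * len a)%:E)%E.
    by apply: esum_ge0 => a oa; rewrite lee_fin F0.
  exists (fine (\esum_(a in orn) (coef w a ^+ 2 * len a)%:E)) => s ss.
  by rewrite -lee_fin fineK ?ge0_fin_numE// esum_seq_ge.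
by apply: le_lt_trans (esum_seq_le hM) _; rewrite ltry.
Qed.

Lemma L2_sub w h : L2 V w -> L2 V h -> L2 V (fun a => w a - h a).
Proof.
move=> /L2_bound[cw [M hM]] /L2_bound[ch [N hN]]; apply/L2_bound; split.
  by move=> a OEa; rewrite cw// ch//; ring.
exists (2 * M + 2 * N) => s ss.
apply: (@le_trans _ _ (2 * \sum_(a <- s) coef w a ^+ 2 * len a
    + 2 * \sum_(a <- s) coef h a ^+ 2 * len a)); last first.
  have := hM s ss; have := hN s ss; lra.
rewrite !mulr_sumr -big_split /=; rewrite big_seq [leRHS]big_seq.
apply: ler_sum => a as_; have l0 := ltW (oe_len (orn_oe (ss.2 a as_))).
rewrite /coef mulrBl -subr_ge0.
set x := w a / len a; set y := h a / len a.
have -> : 2 * (x ^+ 2 * len a) + 2 * (y ^+ 2 * len a) - (x - y) ^+ 2 * len a =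
  (x + y) ^+ 2 * len a by ring.
by rewrite mulr_ge0// sqr_ge0.
Qed.

Lemma harmonic_L2_sub w h : harmonic_L2 V w -> harmonic_L2 V h ->
  harmonic_L2 V (fun a => w a - h a).
Proof.
move=> [lw hw] [lh hh]; split; first exact: L2_sub.
have [cw _] := lw; have [ch _] := lh.
have cwh : C1 V (fun a => w a - h a) by case: (L2_sub lw lh).
apply/(harmonic_bdry cwh) => v.
have bw := (harmonic_bdry cw).1 hw v; have bh := (harmonic_bdry ch).1 hh v.
rewrite -[RHS](subrr 0) -{1}bw -bh /bdry -sumrB; apply: eq_bigr => a _.
by rewrite /coef mulrBl.
Qed.

Lemma pairing_approx w h delta : L2 V w -> L2 V h -> 0 < delta ->
  exists2 B, seq_in orn B & forall s, seq_in orn s -> {subset B <= s} ->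
    `|\sum_(a <- s) coef w a * coef h a * len a - pairing V w h| <= delta.
Proof.
move=> /L2_bound[cw [M hM]] /L2_bound[ch [N hN]] d0.
apply: (@abs_sum_approx _ _ _ _ (M + N)) => // s ss.
apply: (@le_trans _ _ (\sum_(a <- s) coef w a ^+ 2 * len a
    + \sum_(a <- s) coef h a ^+ 2 * len a)); last by apply: lerD; [exact: hM|exact: hN].
rewrite -big_split /=; rewrite big_seq [leRHS]big_seq.
apply: ler_sum => a as_; have l0 := ltW (oe_len (orn_oe (ss.2 a as_))).
rewrite normrM (ger0_norm l0) -mulrDl ler_wpM2r// normrM.
rewrite -[coef w a ^+ 2]real_normK ?num_real// -[coef h a ^+ 2]real_normK ?num_real//.
set x := `|coef w a|; set y := `|coef h a|.
have : 0 <= (x - y) ^+ 2 by exact: sqr_ge0.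
have x0 : 0 <= x by exact: normr_ge0. have y0 : 0 <= y by exact: normr_ge0.
have := mulr_ge0 x0 y0; rewrite !expr2; nra.
Qed.

Lemma sum_double (F : oarc X -> R) s : (forall a, OE a -> F (rev a) = F a) ->
  {in s, forall a, OE a} ->
  \sum_(a <- s ++ map (@rev R X) s) F a = 2 * \sum_(a <- s) F a.
Proof.
move=> Fr sO; rewrite big_cat big_map /= [X in _ + X]big_seq.
by rewrite [X in _ + X](eq_bigr F) => [|a as_]; [rewrite -big_seq; ring|exact/Fr/sO].
Qed.

Lemma double_uniq s : seq_in orn s -> seq_in OE (s ++ map (@rev R X) s).
Proof.
move=> [us so]; split; last first.
  move=> a; rewrite mem_cat => /orP[/so/orn_oe//|/mapP[b /so/orn_oe OEb ->]].
  exact: oe_rev.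
rewrite cat_uniq us map_inj_uniq ?us ?andbT /=; last first.
  by move=> a b e; rewrite -(revK a) e revK.
apply/hasPn => _ /mapP[b bs ->]; apply/negP => /so.
by move=> /(orn_rev (orn_oe (so b bs))); apply; exact: so.
Qed.

Section Projection.
Variable e : oarc X.
Hypothesis OEe : OE e.

Definition proj_form (a : oarc X) : R := len a * orb_lim g e a.

Lemma coef_proj_form a : OE a -> coef proj_form a = orb_lim g e a.
Proof. by move=> /oe_len l0; rewrite /coef /proj_form mulrAC mulfV ?mul1r// gt_eqF. Qed.

Lemma coef_dform a : OE a -> coef (dform e) a = edge_form g e a.
Proof.
move=> OEa; have l0 := oe_len OEa; have ne := oe_rev_neq OEe.
rewrite /coef /dform /edge_form /=.
have [->|nae] := eqVneq a e; first by rewrite eq_sym (negbTE ne) divff ?subr0// gt_eqF// (oe_len OEe).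
have [->|_] := eqVneq a (rev e); last by rewrite mul0r subrr.
by rewrite mulNr divff ?sub0r// gt_eqF// (oe_len OEe).
Qed.

Lemma C1_dform : C1 V (dform e).
Proof.
move=> a OEa; rewrite /dform.
have e1 : (rev a == e) = (a == rev e) by apply/eqP/eqP => [<-|->]; rewrite revK.
have e2 : (rev a == rev e) = (a == e).
  by apply/eqP/eqP => [h|->//]; rewrite -(revK a) h revK.
rewrite e1 e2; have ne := oe_rev_neq OEe.
have [->|nae] := eqVneq a e; first by rewrite eq_sym (negbTE ne).
by case: ifP; rewrite ?opprK ?oppr0.
Qed.

Lemma edge_form_bound : exists M : R, forall s, seq_in OE s ->
  \sum_(a <- s) len a * edge_form g e a ^+ 2 <= M.
Proof.
have fe : finform g (edge_form g e) by exact: finform_edge.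
by exists (dot g (edge_form g e) (edge_form g e)) => s [us so]; exact: (dot_ge fe us so).
Qed.

Lemma L2_of_coef w z : C1 V w -> (forall a, OE a -> coef w a = z a) ->
  (exists M : R, forall s, seq_in OE s -> \sum_(a <- s) len a * z a ^+ 2 <= M) -> L2 V w.
Proof.
move=> cw wz [M hM]; apply/L2_bound; split=> //; exists M => s [us so].
have sO : seq_in OE s by split=> // a /so/orn_oe.
apply: le_trans (hM s sO); rewrite le_eqVlt; apply/orP; left; apply/eqP.
by rewrite big_seq [RHS]big_seq; apply: eq_bigr => a /sO.2 OEa; rewrite wz// mulrC.
Qed.

Lemma L2_dform : L2 V (dform e).
Proof. exact: L2_of_coef C1_dform coef_dform edge_form_bound. Qed.

Lemma L2_proj_form : L2 V proj_form.
Proof.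
apply: L2_of_coef coef_proj_form _.
  move=> a OEa; rewrite /proj_form; have := antisym_orb_lim (g := g) OEe OEa.
  by rewrite /= => ->; rewrite mulrN.
(* From [y^2 <= 2 x^2 + 2 (x - y)^2]: the gap at index 0 bounds the squared distance from the edge
   form to its limit. *)
have [M hM] := edge_form_bound; exists (2 * M + 2 * gap g e 0) => s [us so].
have h1 := hM s (conj us so); have h2 := orb_lim_sub_le (g := g) OEe 0 us so.
apply: (@le_trans _ _ (2 * \sum_(a <- s) len a * edge_form g e a ^+ 2 +
   2 * \sum_(a <- s) len a * (orb g e 0.*2 a - orb_lim g e a) ^+ 2)); last first.
  by apply: lerD; apply: ler_wpM2l.
rewrite !mulr_sumr -big_split /=; rewrite big_seq [leRHS]big_seq.
apply: ler_sum => a /so OEa; have l0 := ltW (oe_len OEa).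
rewrite /orb /=; set x := edge_form _ _ _; set y := orb_lim _ _ _.
rewrite -subr_ge0.
have -> : 2 * (len a * x ^+ 2) + 2 * (len a * (x - y) ^+ 2) - len a * y ^+ 2 =
  len a * (2 * x - y) ^+ 2 by ring.
by rewrite mulr_ge0// sqr_ge0.
Qed.

Lemma proj_form_harmonic : harmonic_L2 V proj_form.
Proof.
split; first exact: L2_proj_form.
have [cp _] := L2_proj_form; apply/(harmonic_bdry cp) => v.
rewrite -(bdry_orb_lim (g := g) OEe v) /bdry big_seq [RHS]big_seq.
by apply: eq_bigr => a /(outsP finout)[OEa _]; exact: coef_proj_form.
Qed.

Lemma coef_residual a : OE a ->
  coef (fun b => dform e b - proj_form b) a = edge_form g e a - orb_lim g e a.
Proof. by move=> OEa; rewrite -coef_dform// -coef_proj_form// /coef mulrBl. Qed.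

(** Translates [orb_lim_orth], which sums over all oriented edges, to the pairing over an
    orientation: a finite set is completed by its reversals, and the summand being invariant under
    reversal, the sum doubles. *)
Lemma proj_form_orth k : harmonic_L2 V k ->
  pairing V (fun a => dform e a - proj_form a) k = 0.
Proof.
move=> [lk hk]; have [ck [M hM]] := (L2_bound k).1 lk.
have lr := L2_sub L2_dform L2_proj_form.
apply/eqP; rewrite -normr_le0; apply/ler_addgt0Pr => delta d0; rewrite add0r.
have d2 : 0 < delta / 2 by rewrite divr_gt0.
have [B [uB oB] hB] := pairing_approx lr lk d2.
have az := coef_anti ck.
(* The bound is [2 * M] because a set of oriented edges splits into a part in the orientation and a
   part whose reversals are in it, each contributing at most [M]. *)
have [||E uE hE] := @orb_lim_orth _ _ _ g e OEe (coef k) (2 * M) delta az _ _ d0.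
- exact/(harmonic_bdry ck).
- move=> s us so.
  pose s1 := [seq a <- s | `[< orn a >]]; pose s2 := map (@rev R X) [seq a <- s | ~~ `[< orn a >]].
  have h1 : seq_in orn s1.
    by split; [rewrite filter_uniq|move=> a; rewrite mem_filter => /andP[/asboolP]].
  have h2 : seq_in orn s2.
    split.
      rewrite map_inj_uniq ?filter_uniq// => a b e'; by rewrite -(revK a) e' revK.
    move=> _ /mapP[a + ->]; rewrite mem_filter => /andP[/asboolP oa /so OEa].
    exact/orn_rev.
  have := hM _ h1; have := hM _ h2.
  rewrite big_map !big_filter [in X in _ -> _ -> X <= _](bigID (fun a => `[< orn a >])) /=.
  have -> : \sum_(a <- s | ~~ `[< orn a >]) coef k (rev a) ^+ 2 * len a =
     \sum_(a <- s | ~~ `[< orn a >]) len a * coef k a ^+ 2.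
    rewrite big_seq_cond [RHS]big_seq_cond; apply: eq_bigr => a /andP[/so OEa _].
    by rewrite az//= sqrrN mulrC.
  have -> : \sum_(a <- s | `[< orn a >]) coef k a ^+ 2 * len a =
     \sum_(a <- s | `[< orn a >]) len a * coef k a ^+ 2.
    by apply: eq_bigr => a _; rewrite mulrC.
  lra.
(* The star is turned into the orientation, so that the set [s] doubled by reversal contains it
   again. *)
pose E' := [seq (if `[< orn a >] then a else rev a) | a <- star_edges g E].
pose s := undup (B ++ E').
have ss : seq_in orn s.
  split; first exact: undup_uniq.
  move=> a; rewrite mem_undup mem_cat => /orP[/oB//|/mapP[b /star_edgesP[OEb _] ->]].
  by case: asboolP => // nb; apply/orn_rev.
have := hB s ss; have [uD DD] := double_uniq ss.
have := hE _ uD DD.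
rewrite (@sum_double (fun a => len a * ((edge_form g e a - orb_lim g e a) * coef k a))); last first.
- by move=> a /ss.2/orn_oe.
- move=> a OEa; have [ax _] := finform_edge (g := g) OEe.
  have := ax a OEa; have := antisym_orb_lim (g := g) OEe OEa.
  by rewrite /= => -> ->; rewrite az//=; ring.
move=> h1 h2; have {}h1 := h1 _; have {}h2 : _ := h2 _.
have h1' : `|2 * \sum_(a <- s) len a * ((edge_form g e a - orb_lim g e a) * coef k a)| <= delta.
  apply: h1 => a aE; rewrite mem_cat.
  have aE' : (if `[< orn a >] then a else rev a) \in s.
    by rewrite mem_undup mem_cat orbC (map_f (fun a => if `[< orn a >] then a else rev a)).
  case: (asboolP (orn a)) aE' => oa h; first by rewrite h.
  by apply/orP; right; apply/mapP; exists (rev a); rewrite ?revK.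
have h2' := h2 (fun a aB => etrans (mem_undup _ _) (etrans (mem_cat _ _ _) (introT orP (or_introl aB)))).
move: h2'; set p := pairing _ _ _.
have -> : \sum_(a <- s) coef (fun b => dform e b - proj_form b) a * coef k a * len a =
    \sum_(a <- s) len a * ((edge_form g e a - orb_lim g e a) * coef k a).
  rewrite big_seq [RHS]big_seq; apply: eq_bigr => a /ss.2/orn_oe OEa.
  by rewrite coef_residual// mulrC.
move: h1'; set t := \sum_(a <- s) _.
rewrite !ler_norml => /andP[? ?] /andP[? ?]; apply/andP; split; lra.
Qed.

(** Uniqueness of the projection: the difference [k] of two candidates is harmonic, orthogonal to
    both residuals, and is itself the difference of these residuals, so its norm is 0. Hence the
    form picked by [harmonic_proj] has the coefficient of [proj_form] at [e]. *)
Lemma coef_harmonic_proj : coef (harmonic_proj V (dform e)) e = amp_lim g e.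
Proof.
have [hh horth] : [set h | harmonic_L2 V h /\
    forall k, harmonic_L2 V k -> pairing V (fun a => dform e a - h a) k = 0]
    (harmonic_proj V (dform e)).
  apply: (xgetPex (fun=> 0)); exists proj_form; split; first exact: proj_form_harmonic.
  exact: proj_form_orth.
set h := harmonic_proj V (dform e) in hh horth *.
rewrite -(orb_lim_edge g e) -coef_proj_form//.
pose k a := proj_form a - h a.
have hk : harmonic_L2 V k by apply: harmonic_L2_sub => //; exact: proj_form_harmonic.
have [lk _] := hk; have [ck _] := lk; have [lh _] := hh.
have p1 := horth k hk; have p2 := proj_form_orth hk.
have l1 := L2_sub L2_dform lh; have l2 := L2_sub L2_dform L2_proj_form.
have k0 a : orn a -> coef k a = 0.
  move=> oa; have l0 := oe_len (orn_oe oa).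
  suff : coef k a ^+ 2 * len a <= 0.
    rewrite pmulr_lle0// => k2; apply/eqP; rewrite -sqrf_eq0 eq_le k2 sqr_ge0//.
  apply/ler_addgt0Pr => delta d0; rewrite add0r.
  have d2 : 0 < delta / 2 by rewrite divr_gt0.
  have [B1 [_ oB1] h1] := pairing_approx l1 lk d2.
  have [B2 [_ oB2] h2] := pairing_approx l2 lk d2.
  pose s := undup (a :: (B1 ++ B2)).
  have ss : seq_in orn s.
    split; first exact: undup_uniq.
    by move=> b; rewrite mem_undup inE mem_cat => /orP[/eqP->//|/orP[/oB1|/oB2]].
  have s1 : {subset B1 <= s} by move=> b bB; rewrite mem_undup inE mem_cat bB orbT.
  have s2 : {subset B2 <= s} by move=> b bB; rewrite mem_undup inE mem_cat bB !orbT.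
  have := h1 s ss s1; have := h2 s ss s2; rewrite p1 p2 !subr0 !ler_norml.
  move=> /andP[e1 e2] /andP[e3 e4].
  have : \sum_(b <- s) coef k b ^+ 2 * len b <= delta.
    have -> : \sum_(b <- s) coef k b ^+ 2 * len b =
        \sum_(b <- s) coef (fun a => dform e a - h a) b * coef k b * len b -
        \sum_(b <- s) coef (fun a => dform e a - proj_form a) b * coef k b * len b.
      by rewrite -sumrB; apply: eq_bigr => b _; rewrite /coef /k; ring.
    lra.
  apply: le_trans.
  rewrite (bigD1_seq a) ?ss.1//=; last by rewrite mem_undup mem_head.
  rewrite lerDl big_seq_cond sumr_ge0// => b /andP[/ss.2/orn_oe/oe_len/ltW lb _].
  by rewrite mulr_ge0// sqr_ge0.
have ke : coef k e = 0.
  have [oe|oe] := orn_total OEe; first exact: k0.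
  have := k0 _ oe; rewrite (coef_anti ck OEe) => /eqP; rewrite oppr_eq0.
  by move/eqP.
by apply/eqP; rewrite -subr_eq0 -[X in X == 0]opprK opprB -mulrBl -/(coef k e) ke oppr0.
Qed.

End Projection.

End HarmonicForms.

(** * Canonical measures *)

Lemma amp_lim_ge0 (R : realType) (T U : choiceType) (g : lfgraph R T U) (e : T) :
  gD g e -> 0 <= amp_lim g e.
Proof.
move=> De; apply: limr_ge; first exact: (is_cvg_amp De).
by apply: nearW => k; exact: amp_double_ge0.
Qed.

Lemma lebesgue_itv_le (R : realType) (l : R) (B : set R) : 0 < l ->
  (lebesgue_measure (`]0%R, l[ `&` B) <= l%:E)%E.
Proof.
move=> l0; have -> : l%:E = lebesgue_measure `]0%R, l[%classic :> \bar R.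
  by rewrite lebesgue_measure_itv/= lte_fin l0 oppr0 adde0.
(* The set [B] is arbitrary: the value is that of an outer measure, which is monotone on all
   sets. *)
rewrite /lebesgue_measure /lebesgue_stieltjes_measure /measure_extension.
by apply: le_mu_ext; exact: subIsetl.
Qed.

Section FiniteModelMeasure.
Context {R : realType} {X : metricType R} (V : set X).
Local Notation orn := (orientation V).
Hypothesis finorn : finite_set orn.

Definition edge_share (a : oarc X) (A : set X) : R :=
  (len a)^-1 * fine (lebesgue_measure (`]0%R, len a[ `&` arc a @^-1` A)).

Lemma edge_share_itv a A : orn a -> 0 <= edge_share a A <= 1.
Proof.
move=> /orn_oe/oe_len l0; have h := lebesgue_itv_le (arc a @^-1` A) l0.
rewrite /edge_share; set mu := lebesgue_measure _ in h *.
have m0 : (0 <= mu)%E by exact: measure_ge0.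
have mf : mu \is a fin_num by rewrite ge0_fin_numE// (le_lt_trans h)// ltry.
apply/andP; split; first by rewrite mulr_ge0 ?invr_ge0 ?fine_ge0// ltW.
by rewrite mulrC ler_pdivrMr// mul1r -lee_fin fineK.
Qed.

Lemma edge_measureE (m : oarc X -> R) A : (forall a, orn a -> 0 <= m a) ->
  edge_measure V (fun a => (m a)%:E) A =
    (\sum_(a <- fset_set orn) m a * edge_share a A)%:E.
Proof.
move=> m0; rewrite /edge_measure.
rewrite (@eq_esum _ _ _ _ (fun a => (m a * edge_share a A)%:E)); last first.
  move=> a oa; have l0 := oe_len (orn_oe oa).
  have h := lebesgue_itv_le (arc a @^-1` A) l0.
  rewrite /edge_share; set mu := lebesgue_measure _ in h *.
  have m0' : (0 <= mu)%E by exact: measure_ge0.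
  have mf : mu \is a fin_num by rewrite ge0_fin_numE// (le_lt_trans h)// ltry.
  by rewrite !EFinM fineK// muleA.
rewrite esum_fset//; first by rewrite fsbig_finite//= sumEFin.
move=> a /set_mem oa; rewrite lee_fin mulr_ge0 ?m0//.
by have /andP[] := edge_share_itv A oa.
Qed.

End FiniteModelMeasure.

(** All these measures see a set through the same shares of the edges, numbers in [[0, 1]]. The
    difference is thus at most the number of edges times the largest difference of masses, uniformly
    over all sets. *)
Lemma near_edge_measure (R : realType) (X : metricType R) (V : set X)
    (m : nat -> oarc X -> R) (m' : oarc X -> R) : finite_set (orientation V) ->
  (forall n a, orientation V a -> 0 <= m n a) ->
  (forall a, orientation V a -> 0 <= m' a) ->
  (forall eps, 0 < eps -> \forall n \near \oo,
     forall a, orientation V a -> `|m n a - m' a| <= eps) ->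
  (fun n => variation_dist (edge_measure V (fun a => (m n a)%:E))
     (edge_measure V (fun a => (m' a)%:E))) @ \oo --> 0%E.
Proof.
move=> fo m0 m0' h.
pose vd n := variation_dist (edge_measure V (fun a => (m n a)%:E))
     (edge_measure V (fun a => (m' a)%:E)).
have vd0 n : (0 <= vd n)%E.
  apply: le_trans (ereal_sup_ubound _); last by exists set0 => //; exact: sigma_algebra0.
  exact: abse_ge0.
(* The [+ 1] allows division by [N] when there are no edges. *)
pose N : R := (size (fset_set (orientation V)))%:R + 1.
have N0 : 0 < N by rewrite ltr_wpDl.
have vde eps : 0 < eps -> \forall n \near \oo, (vd n <= eps%:E)%E.
  move=> e0; have eN : 0 < eps / N by rewrite divr_gt0.
  apply: filterS (h _ eN) => n hn; apply: ge_ereal_sup => _ [A _ <-].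
  rewrite !edge_measureE//; last exact: m0.
  rewrite -EFinB abse_EFin lee_fin -sumrB.
  apply: (@le_trans _ _ (\sum_(a <- fset_set (orientation V)) (eps / N))).
    apply: le_trans (ler_norm_sum _ _ _) _.
    rewrite big_seq [leRHS]big_seq; apply: ler_sum => a.
    rewrite mem_fset_set// => /set_mem oa; rewrite -mulrBl normrM.
    have /andP[s0 s1] := edge_share_itv A oa; rewrite (ger0_norm s0).
    by apply: le_trans (hn a oa); rewrite ler_piMr.
  rewrite big_const_seq count_predT iter_addr_0 -[leLHS]mulr_natr.
  rewrite mulrAC ler_pdivrMr// ler_wpM2l// ?ltW//.
  by rewrite /N ltrDl.
apply/fine_cvgP; split.
  apply: filterS (vde 1 ltr01) => n hn.
  by rewrite -/(vd n) ge0_fin_numE// (le_lt_trans hn)// ltry.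
apply/cvgrPdist_le => eps e0; apply: filterS (vde eps e0) => n hn.
have vf : vd n \is a fin_num by rewrite ge0_fin_numE// (le_lt_trans hn)// ltry.
by rewrite sub0r normrN /= -/(vd n) ger0_norm ?fine_ge0// -lee_fin fineK.
Qed.

Section CanonicalMass.
Context {R : realType} {X : metricType R} (V : set X).
Local Notation OE := (oriented_edges V).
Local Notation orn := (orientation V).
Hypothesis srcV : forall a : oarc X, OE a -> V (source a).
Hypothesis finout : forall v : X, finite_set [set a | OE a /\ source a = v].
Variable c : R.
Hypothesis c_gt0 : 0 < c.
Hypothesis outc : forall v : X, \sum_(a <- outs V v) (len a)^-1 <= c / 2.
Local Notation g := (model_graph finout c_gt0 outc).

(** Distinct edges of the orientation have disjoint supports, so a single term of the sum
    survives. *)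
Lemma mu_can_orn a : orn a -> mu_can V (support a) = (amp_lim g a)%:E.
Proof.
move=> oa; have OEa := orn_oe oa; have l0 := oe_len OEa.
rewrite /mu_can /edge_measure.
have termE b : orn b -> ((coef (harmonic_proj V (dform b)) b)%:E * ((len b)^-1)%:E *
    lebesgue_measure (`]0%R, len b[ `&` arc b @^-1` support a))%E =
    (if b == a then amp_lim g a else 0)%:E.
  move=> ob; have OEb := orn_oe ob.
  rewrite (coef_harmonic_proj srcV finout c_gt0 outc OEb).
  have [->|nba] := eqVneq b a.
    have -> : `]0%R, len a[ `&` arc a @^-1` support a = `]0%R, len a[%classic.
      by apply/seteqP; split=> [t []//|t tl]; split=> //; exists t.
    rewrite lebesgue_measure_itv/= lte_fin l0 oppr0 adde0 -!EFinM mulfVK//.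
    by rewrite gt_eqF.
  have -> : `]0%R, len b[ `&` arc b @^-1` support a = set0.
    rewrite -subset0 => t [/= tl sa].
    have sb : support b (arc b t) by exists t.
    have e := edges_disjoint (oe_edge OEb) (oe_edge OEa) sb sa.
    have [ba|ba] := oe_unique OEb OEa e; first by rewrite ba eqxx in nba.
    by have := (orn_rev OEa).1; rewrite -ba => /(_ ob); exact.
  by rewrite measure0 mule0.
rewrite (eq_esum termE) (@esumID _ _ [set a])/=; last first.
  by move=> b ob; rewrite lee_fin; case: ifP => // _; exact: amp_lim_ge0.
have -> : orn `&` [set a] = [set a].
  by apply/seteqP; split=> [b []//|b /= ->]; split.
rewrite esum_set1 ?eqxx ?lee_fin; last exact: amp_lim_ge0.
rewrite esum1 ?adde0// => b [_ /eqP nb].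
by rewrite (negbTE nb).
Qed.

Lemma mu_can_support a : OE a -> mu_can V (support a) = (amp_lim g a)%:E.
Proof.
move=> OEa; have [oa|oa] := orn_total OEa; first exact: mu_can_orn.
rewrite -support_rev mu_can_orn//; congr (_%:E).
exact: (@amp_lim_rv _ _ _ g).
Qed.

End CanonicalMass.

Section Pushdown.
Context {R : realType} {Y G : metricType R} (f : Y -> G) (V : set G).
Hypothesis galf : galois_cover f.
Hypothesis modelV : vertex_set V.
Hypothesis graphG : metric_graph G.
Hypothesis compactG : compact [set: G].
Hypothesis graphY : metric_graph Y.
Variable y : Y.
Local Notation V' := (f @^-1` V).
Local Notation g := (cover_graph galf modelV graphG compactG).

Lemma support_proj (a : oarc Y) : support (proj_arc f a) = f @` support a.
Proof. by rewrite /support /= image_comp. Qed.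

(** Whatever lift is chosen, it is the support of an arc of the cover which, reversed if necessary,
    projects onto [b] with its orientation. *)
Lemma lift_edge_arc b : oriented_edges V b -> exists2 a, oriented_edges V' a &
  proj_arc f a = b /\ lift_edge f V (support b) = support a.
Proof.
move=> OEb; have [covf _] := galf.
have [a0 OEa0 pa0] := oe_lift galf modelV graphG y OEb.
have [Ee fe] : [set e' | edges V' e' /\ f @` e' = support b] (lift_edge f V (support b)).
  apply: (xgetPex set0); exists (support a0); split; first exact: oe_edge OEa0.
  by rewrite -support_proj pa0.
set e := lift_edge _ _ _ in Ee fe *.
have [q eq] : exists q, e q.
  have [p Vp <-] := Ee; exists p; exact: connected_component_refl.
have nVq : ~ V' q.
  by move=> Vq; have [p Vp ep] := Ee; move: eq; rewrite -ep => /connected_component_sub; exact.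
have [a OEa [aq OEpa]] := cover_edge covf modelV compactG nVq.
have sa : support a = e by exact: edges_disjoint (oe_edge OEa) Ee aq eq.
have sp : support (proj_arc f a) = support b by rewrite support_proj sa fe.
have [pb|pb] := oe_unique OEpa OEb sp; first by exists a.
exists (rev a); first exact: oe_rev.
by rewrite proj_arc_rev pb revK support_rev.
Qed.

Definition lift_mass (b : oarc G) : R := fine (mu_can V' (lift_edge f V (support b))).

Lemma lift_massE b : oriented_edges V b -> exists2 a, oriented_edges V' a &
  proj_arc f a = b /\ mu_can V' (lift_edge f V (support b)) = (amp_lim g a)%:E.
Proof.
move=> OEb; have [covf _] := galf; have [a OEa [pa ->]] := lift_edge_arc OEb.
exists a => //; split=> //; apply: mu_can_support => // a' OEa'.
exact: (cover_source covf modelV compactG).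
Qed.

Lemma lift_mass_ge0 b : oriented_edges V b -> 0 <= lift_mass b.
Proof.
move=> /lift_massE[a OEa [_ e]]; rewrite /lift_mass e; exact: (@amp_lim_ge0 _ _ _ g).
Qed.

Lemma mu_pushdownE : mu_pushdown f V = edge_measure V (fun b => (lift_mass b)%:E).
Proof.
apply/funext => A; apply: eq_esum => b /orn_oe OEb.
by have [a _ [_ e]] := lift_massE OEb; rewrite /lift_mass e.
Qed.

End Pushdown.

Theorem theoremA (R : realType)
  (G : metricType R) (G' : metricType R) (Gn : nat -> metricType R)
  (phi : G' -> G) (phin : forall n, Gn n -> G)
  (x : G) (y : G') (yn : forall n, Gn n)
  (V : set G)
  (graphG : metric_graph G) (compactG : compact [set: G])
  (graphG' : metric_graph G')
  (phi_galois : galois_cover phi) (phi_infinite : infinite_degree phi)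
  (graphGn : forall n, metric_graph (Gn n))
  (phin_galois : forall n, galois_cover (phin n))
  (phin_finite : forall n, finite_degree (phin n))
  (ascending : forall n, exists2 psi : Gn n.+1 -> Gn n,
     continuous psi & forall z, phin n.+1 z = phin n (psi z))
  (phi_y : phi y = x) (phin_yn : forall n, phin n (yn n) = x)
  (converging :
     \bigcap_n pi1_image (phin n) (yn n) = pi1_image phi y)
  (modelV : vertex_set V) :
  (fun n => variation_dist (mu_pushdown (phin n) V) (mu_pushdown phi V))
    @ \oo --> 0%E.
Proof.
subst x; have finO : finite_set (orientation V).
  by apply: sub_finite_set (oe_finite modelV compactG graphG) => a; exact: orn_oe.
rewrite (mu_pushdownE phi_galois modelV graphG compactG y).
under eq_fun do rewrite (mu_pushdownE (phin_galois _) modelV graphG compactG (yn _)).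
apply: near_edge_measure => //.
- by move=> n a /orn_oe; exact: (lift_mass_ge0 (phin_galois n) modelV graphG compactG (yn n)).
- by move=> a /orn_oe; exact: (lift_mass_ge0 phi_galois modelV graphG compactG y).
move=> eps e0.
(* The estimate is uniform over all lifts of an edge, so the choices hidden in [lift_edge], which
   vary with [n], are harmless. *)
apply: filterS (amp_lim_near graphG compactG graphG' graphGn phi_galois phi_infinite
  phin_galois ascending phin_yn converging modelV e0) => n hn b /orn_oe OEb.
have [a OEa [pa e]] := lift_massE (phin_galois n) modelV graphG compactG (yn n) OEb.
have [a' OEa' [pa' e']] := lift_massE phi_galois modelV graphG compactG y OEb.
rewrite /lift_mass e e' /=; apply: hn => //; by rewrite pa pa'.
Qed.
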